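(* Consider a $C^\infty$ system $$\dot u=u\,(u+v+O_2(u,v)),\qquad \dot v=-v\,(u+v+O_2(u,v)),\qquad \dot t=1,$$ defined for $(u,v)$ in a neighbourhood of $(0,0)$ in $\mathbb R^2$ and $t\in\mathbb T=\mathbb R/2\pi\mathbb Z$, where the $O_2(u,v)$ terms are $2\pi$-periodic functions of $t$. There exist $0<\rho<1$ and $C>0$ such that for any $0<a<\rho$ there exists $0<\delta<a/2$ such that the Poincaré map $\Psi_{\mathrm{loc}}:\Sigma^1_{a,\delta}\to\Sigma^0_{a,\delta^{1-Ca}}$ associated to the system is well defined. Moreover: (1) there exist $\widetilde C_1,\widetilde C_2>0$ such that, for any $(u,a,t_0)\in\Sigma^1_{a,\delta}$, $(a,v_1,t_1)=\Psi_{\mathrm{loc}}(u,a,t_0)$ satisfies $$u^{1+Ca}\le v_1\le u^{1-Ca},\qquad \widetilde C_1u^{-(1-Ca)/2}\le t_1-t_0\le\widetilde C_2u^{-(1+Ca)/2};$$ (2) if $\gamma(u)=(u,a,t_0(u))$, $u\in[0,\delta)$, is a $C^1$ curve (with $\gamma(u)\in\Sigma^1_{a,\delta}$ for $u>0$), $(a,v_1(u),t_1(u))=\Psi_{\mathrm{loc}}(\gamma(u))$, and $\delta$ is small enough, then there exist $C_1,C_2>0$ such that $$\left|\frac{v_1'(u)}{t_1'(u)}\right|\le C_1u^{1-Ca},\qquad |t_1'(u)|\ge C_2\frac1{u^{9/10-Ca}},\qquad u\in(0,\delta).$$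
   Context: For $0<\delta<a$, $\Sigma^0_{a,\delta}=\{(u,v,t): u=a,\ 0<v<\delta,\ t\in\mathbb T\}$ and $\Sigma^1_{a,\delta}=\{(u,v,t): 0<u<\delta,\ v=a,\ t\in\mathbb T\}$. $\Psi_{\mathrm{loc}}$ is the map sending a point of $\Sigma^1_{a,\delta}$ to the first intersection of its forward orbit (inside $\{u,v>0\}$, near the origin) with $\{u=a\}$. In the estimates, $t_1-t_0$ denotes the transit time, i.e. $t_1$ is taken in the lift to $\mathbb R$. $O_2(u,v)$ denotes terms of order at least $2$ in $(u,v)$, uniformly in $t$. *)

(* Defs.v *)
From Stdlib Require Import Reals.
From Coquelicot Require Import Coquelicot.
Open Scope R_scope.

(* Points (u, v, t).  The circle T = R / 2 pi Z is handled through its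
   universal cover: t is a real number and the vector field is
   2 pi-periodic in t. *)
Definition pt : Type := (R * R * R)%type.

(* F is of class C^k on the open set W: all its iterated partial derivatives
   of order at most k exist and are continuous on W. *)
Fixpoint Ck (k : nat) (W : pt -> Prop) (F : R -> R -> R -> R) : Prop :=
  (forall u v t, W (u, v, t) ->
     continuous (fun p : pt => F (fst (fst p)) (snd (fst p)) (snd p)) (u, v, t)) /\
  match k with
  | O => True
  | S k' =>
      (forall u v t, W (u, v, t) ->
         ex_derive (fun x => F x v t) u /\
         ex_derive (fun x => F u x t) v /\
         ex_derive (fun x => F u v x) t) /\
      Ck k' W (fun u v t => Derive (fun x => F x v t) u) /\
      Ck k' W (fun u v t => Derive (fun x => F u x t) v) /\
      Ck k' W (fun u v t => Derive (fun x => F u v x) t)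
  end.

Definition smooth_on (W : pt -> Prop) (F : R -> R -> R -> R) : Prop :=
  forall k : nat, Ck k W F.

(* D x T, with D a subset of the (u, v)-plane. *)
Definition cyl (D : R * R -> Prop) (p : pt) : Prop := D (fst p).

Definition periodic_t (D : R * R -> Prop) (f : R -> R -> R -> R) : Prop :=
  forall u v t, D (u, v) -> f u v (t + 2 * PI) = f u v t.

(* f = O_2(u, v), uniformly in t. *)
Definition O2 (f : R -> R -> R -> R) : Prop :=
  exists K : R,
    locally ((0, 0) : R * R)
      (fun p => forall t : R,
         Rabs (f (fst p) (snd p) t) <= K * (fst p ^ 2 + snd p ^ 2)).

Definition field_u (f : R -> R -> R -> R) (u v t : R) : R :=
  u * (u + v + f u v t).

Definition field_v (g : R -> R -> R -> R) (u v t : R) : R :=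
  - v * (u + v + g u v t).

Definition Sigma0 (a delta : R) (p : pt) : Prop :=
  let '(u, v, _) := p in u = a /\ 0 < v < delta.

Definition Sigma1 (a delta : R) (p : pt) : Prop :=
  let '(u, v, _) := p in 0 < u < delta /\ v = a.

(* (U, V, Th) solves the system on [0, tau] inside D.  Derivatives are
   two-sided at the end points too; since D is open, every solution on
   [0, tau] extends slightly beyond, so this is no restriction. *)
Definition solution (D : R * R -> Prop) (f g : R -> R -> R -> R)
    (tau : R) (U V Th : R -> R) : Prop :=
  forall s, 0 <= s <= tau ->
    D (U s, V s) /\
    is_derive U s (field_u f (U s) (V s) (Th s)) /\
    is_derive V s (field_v g (U s) (V s) (Th s)) /\
    is_derive Th s 1.

(* Graph of Psi_loc: q is the first intersection with {u = a} of the forward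
   orbit of p, the orbit staying in {u, v > 0} up to that intersection.  The
   time coordinate of q is the lifted one, so that t1 - t0 is the transit
   time. *)
Definition Psi_loc (D : R * R -> Prop) (f g : R -> R -> R -> R) (a : R)
    (p q : pt) : Prop :=
  exists (tau : R) (U V Th : R -> R),
    0 < tau /\
    solution D f g tau U V Th /\
    (forall s, 0 <= s <= tau -> 0 < U s /\ 0 < V s) /\
    (U 0, V 0, Th 0) = p /\
    (U tau, V tau, Th tau) = q /\
    U tau = a /\
    (forall s, 0 <= s < tau -> U s <> a).

(* h is of class C^1 on [0, d), with one-sided derivative at 0. *)
Definition C1_Ico (d : R) (h : R -> R) : Prop :=
  exists dh : R -> R, forall u, 0 <= u < d ->
    filterlim (fun y => (h y - h u) / (y - u))
      (within (fun y => 0 <= y < d /\ y <> u) (locally u)) (locally (dh u)) /\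
    filterlim dh (within (fun y => 0 <= y < d) (locally u)) (locally (dh u)).

(* Main.v *)
Require Import Defs.
From Stdlib Require Import Reals Lra Lia Psatz ZArith FunctionalExtensionality IndefiniteDescription.
From Coquelicot Require Import Coquelicot.
Open Scope R_scope.

(* In the logarithmic coordinates x = ln u, y = ln v the system reads
   x' = p := u + v + f, y' = - q := - (u + v + g), and q = (1 + O(a)) p near the
   origin.  Hence y + x varies by at most O(a) times the variation of x, which
   gives the estimate of v1, and u v = u0^(1 + O(a)) along an orbit.  The
   transit time is then bounded above by p >= sqrt(u v), and below by the time
   spent where u is comparable to sqrt(u0).

   For the derivatives, compare orbits at the same absolute time: the
   logarithmic variations (xi, eta) solve
   xi' = u (1 + f_u) xi + v (1 + f_v) eta,
   eta' = - u (1 + g_u) xi - v (1 + g_v) eta,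
   an equation without t-derivatives.  The initial data along the curve are
   (1/u0 - p t0', q t0'), close to (1/u0, 0).  A cone of the form
   (v / (2 r) - O(r) - 1) xi < eta < xi, with r = u + v, is invariant, and in it
   (xi / r) exp (16 K (u - v)) increases, so xi >= c / u0 at the exit.  Finally
   t1' = - xi / p and v1' / v1 = eta + q xi / p at the exit. *)

(** * Calculus on an interval *)

(** Only the products [u * (u + v + f)] and [- v * (u + v + g)] are assumed smooth, and they say
    nothing of f at u = 0 or of g at v = 0. So f, g and their partial derivatives are treated as
    quotients on the open quadrant, with bounds taken from third derivatives of the field. Since t'
    = 1, orbits compared at equal absolute time have no variation in t; the slope t0' enters only
    through the initial data. The cone needs its peculiar lower edge because xi + eta is conserved
    to leading order: the edge eta = - xi would be only neutrally invariant, and any error could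
    break it. The term v / (2 r) decreases along orbits and so pushes strictly inwards, except near
    v = 0, where the term in K r takes over. The constant C = 48 K is twice 24 K: one half bounds
    the relative difference of p and q, and the other absorbs the factor |ln u| in the upper bound
    of the transit time. The derivative t1' is in fact at least of order 1 / u, which implies the
    bound with exponent 9/10 - C a. *)

Lemma continuous_epsP (f : R -> R) (x : R) :
  continuous f x <->
  forall eps, 0 < eps -> exists d, 0 < d /\
    forall y, Rabs (y - x) < d -> Rabs (f y - f x) < eps.
Proof.
split.
- intros H eps He.
  destruct (proj1 (filterlim_locally f (f x)) H (mkposreal eps He)) as [d Hd].
  exists d; split; [apply cond_pos|].
  intros y Hy; exact (Hd y Hy).
- intros H. apply filterlim_locally. intros eps.
  destruct (H eps (cond_pos eps)) as [d [Hd Hy]].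
  exists (mkposreal d Hd). intros y Hxy. exact (Hy y Hxy).
Qed.

Lemma is_derive_epsP (f : R -> R) (x l : R) :
  is_derive f x l <->
  forall eps, 0 < eps -> exists d, 0 < d /\
    forall y, Rabs (y - x) < d ->
      Rabs (f y - f x - l * (y - x)) <= eps * Rabs (y - x).
Proof.
split.
- intros H eps He.
  apply is_derive_Reals in H.
  destruct (H eps He) as [d Hd].
  exists d; split; [apply cond_pos|].
  intros y Hy.
  destruct (Req_dec y x) as [->|Hne].
  + replace (f x - f x - l * (x - x)) with 0 by ring.
    rewrite Rabs_R0. replace (x - x) with 0 by ring. rewrite Rabs_R0. lra.
  + assert (Hh : y - x <> 0) by lra.
    specialize (Hd (y - x) Hh Hy).
    replace (x + (y - x)) with y in Hd by ring.
    replace (f y - f x - l * (y - x)) with (((f y - f x) / (y - x) - l) * (y - x))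
      by (field; lra).
    rewrite Rabs_mult. apply Rmult_le_compat_r; [apply Rabs_pos|lra].
- intros H. apply is_derive_Reals. intros eps He.
  destruct (H (eps / 2) ltac:(lra)) as [d [Hd Hy]].
  exists (mkposreal d Hd). intros h Hh Hhd. simpl in Hhd.
  specialize (Hy (x + h)). replace (x + h - x) with h in Hy by ring.
  specialize (Hy Hhd).
  replace ((f (x + h) - f x) / h - l) with ((f (x + h) - f x - l * h) / h)
    by (field; lra).
  assert (0 < Rabs h) by (apply Rabs_pos_lt; lra).
  unfold Rdiv. rewrite Rabs_mult, Rabs_inv.
  apply Rle_lt_trans with (eps / 2); [|lra].
  apply Rmult_le_reg_r with (Rabs h); [lra|].
  rewrite Rmult_assoc, Rinv_l by lra. lra.
Qed.

Lemma is_derive_continuous (f : R -> R) (x l : R) :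
  is_derive f x l -> continuous f x.
Proof.
intros H. apply (ex_derive_continuous f). now exists l.
Qed.

Lemma mean_value (f df : R -> R) (a b : R) :
  a <= b -> (forall s, a <= s <= b -> is_derive f s (df s)) ->
  exists c, a <= c <= b /\ f b - f a = df c * (b - a).
Proof.
intros Hab H.
destruct (MVT_gen f a b df) as [c [Hc E]].
- intros x. rewrite Rmin_left, Rmax_right by lra. intros Hx. apply H; lra.
- intros x. rewrite Rmin_left, Rmax_right by lra. intros Hx.
  apply continuity_pt_filterlim.
  exact (is_derive_continuous _ _ _ (H x Hx)).
- rewrite Rmin_left, Rmax_right in Hc by lra. now exists c.
Qed.

Lemma mean_value_between (f df : R -> R) (a b : R) :
  (forall s, Rmin a b <= s <= Rmax a b -> is_derive f s (df s)) ->
  exists c, Rmin a b <= c <= Rmax a b /\ f b - f a = df c * (b - a).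
Proof.
intros H.
destruct (Rle_or_lt a b) as [h|h].
- rewrite Rmin_left, Rmax_right in * by lra. now apply mean_value.
- rewrite Rmin_right, Rmax_left in * by lra.
  destruct (mean_value f df b a) as [c [Hc E]]; [lra|easy|].
  exists c; split; [easy|lra].
Qed.

Lemma derive_nonneg_le (f df : R -> R) (a b : R) :
  a <= b -> (forall s, a <= s <= b -> is_derive f s (df s)) ->
  (forall s, a <= s <= b -> 0 <= df s) -> f a <= f b.
Proof.
intros Hab H Hp. destruct (mean_value f df a b Hab H) as [c [Hc E]].
specialize (Hp c Hc). nra.
Qed.

Lemma derive_sign_of_pos_right (h : R -> R) (z d b : R) :
  z < b -> is_derive h z d -> h z = 0 -> (forall w, z < w <= b -> 0 < h w) ->
  0 <= d.
Proof.
intros Hzb Hd Hz Hp.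
apply Rnot_lt_le. intros Hneg.
destruct (proj1 (is_derive_epsP h z d) Hd (- d / 2) ltac:(lra)) as [e [He H]].
set (w := z + Rmin (e / 2) (b - z)).
assert (Hm : 0 < Rmin (e / 2) (b - z)) by (apply Rmin_glb_lt; lra).
assert (Hm1 := Rmin_l (e / 2) (b - z)). assert (Hm2 := Rmin_r (e / 2) (b - z)).
specialize (Hp w ltac:(unfold w; lra)).
specialize (H w). replace (w - z) with (Rmin (e / 2) (b - z)) in H by (unfold w; ring).
rewrite (Rabs_pos_eq (Rmin _ _)) in H by lra. specialize (H ltac:(lra)).
rewrite Hz in H. apply Rabs_le_between in H. nra.
Qed.

Lemma derive_sign_of_pos_left (h : R -> R) (z d a : R) :
  a < z -> is_derive h z d -> h z = 0 -> (forall w, a <= w < z -> 0 < h w) ->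
  d <= 0.
Proof.
intros Haz Hd Hz Hp.
cut (0 <= - d); [lra|].
apply (derive_sign_of_pos_right (fun s => h (- s)) (- z) (- d) (- a)); [lra| | |].
- evar_last.
  + apply (is_derive_comp h Ropp (- z)).
    * replace (- - z) with z by ring. exact Hd.
    * auto_derive; [easy|reflexivity].
  + simpl. unfold scal; simpl; unfold mult; simpl. ring.
- now rewrite Ropp_involutive.
- intros w Hw. apply Hp; lra.
Qed.

(** The zero is the supremum of the points up to which [h] stays positive; continuity excludes both
    signs there. *)
Lemma first_zero (h : R -> R) (a s : R) :
  a <= s -> (forall w, a <= w <= s -> continuous h w) -> 0 < h a -> h s <= 0 ->
  exists z, a < z <= s /\ h z = 0 /\ forall w, a <= w < z -> 0 < h w.
Proof.
intros Has Hc Ha Hs.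
set (E := fun x => a <= x <= s /\ forall w, a <= w <= x -> 0 < h w).
assert (HEa : E a). { split; [lra|]. intros w Hw. now replace w with a by lra. }
destruct (completeness E) as [z [Hub Hlub]].
- exists s. intros x [Hx _]. lra.
- now exists a.
- assert (Haz : a <= z) by (now apply Hub).
  assert (Hzs : z <= s). { apply Hlub. intros x [Hx _]. lra. }
  assert (Hpos : forall w, a <= w < z -> 0 < h w).
  { intros w Hw. apply Rnot_le_lt. intros Hle.
    cut (z <= w); [lra|]. apply Hlub. intros x [Hx Hxp].
    apply Rnot_lt_le. intros Hwx. specialize (Hxp w ltac:(lra)). lra. }
  assert (Hz : h z = 0).
  { destruct (Rtotal_order (h z) 0) as [Hlt|[He|Hgt]]; [|easy|].
    - exfalso.
      destruct (proj1 (continuous_epsP h z) (Hc z ltac:(lra)) (- h z) ltac:(lra))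
        as [d [Hd H]].
      destruct (Req_dec a z) as [<-|Hne]; [lra|].
      set (w := Rmax a (z - d / 2)).
      assert (w < z) by (unfold w; apply Rmax_lub_lt; lra).
      assert (Hw1 : a <= w) by apply Rmax_l.
      assert (Hw2 : z - d / 2 <= w) by apply Rmax_r.
      specialize (Hpos w ltac:(lra)). specialize (H w).
      rewrite Rabs_left in H by lra. specialize (H ltac:(lra)).
      apply Rabs_lt_between in H. lra.
    - exfalso.
      destruct (proj1 (continuous_epsP h z) (Hc z ltac:(lra)) (h z) ltac:(lra))
        as [d [Hd H]].
      assert (z <> s) by (intros ->; lra).
      set (w := Rmin s (z + d / 2)).
      assert (z < w) by (unfold w; apply Rmin_glb_lt; lra).
      assert (Hw1 : w <= s) by apply Rmin_l.
      assert (Hw2 : w <= z + d / 2) by apply Rmin_r.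
      cut (w <= z); [lra|]. apply Hub. split; [lra|].
      intros x Hx. destruct (Rlt_or_le x z) as [Hxz|Hxz]; [apply Hpos; lra|].
      specialize (H x). rewrite Rabs_pos_eq in H by lra.
      specialize (H ltac:(lra)). apply Rabs_lt_between in H. lra. }
  exists z. split; [|split; [easy|easy]].
  split; [|easy]. destruct (Req_dec a z) as [<-|]; lra.
Qed.

(** If [h s] were positive, the last zero before [s], found by [first_zero] after a reflection of
    time, would have a nonnegative derivative. *)
Lemma barrier (h dh : R -> R) (a b : R) :
  (forall s, a <= s <= b -> is_derive h s (dh s)) -> h a <= 0 ->
  (forall s, a <= s <= b -> h s = 0 -> dh s < 0) ->
  forall s, a <= s <= b -> h s <= 0.
Proof.
intros Hd Ha Hb s Hs. apply Rnot_lt_le. intros Hpos.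
destruct (first_zero (fun w => h (- w)) (- s) (- a)) as [z [Hz [Hz0 Hzp]]].
- lra.
- intros w Hw. apply (continuous_comp Ropp h).
  + apply (continuous_opp (fun x : R => x)), continuous_id.
  + apply (is_derive_continuous h _ (dh (- w))). apply Hd. lra.
- now rewrite Ropp_involutive.
- now rewrite Ropp_involutive.
- assert (0 <= dh (- z)).
  { apply (derive_sign_of_pos_right h (- z) _ s); [lra| apply Hd; lra | easy |].
    intros w Hw. specialize (Hzp (- w) ltac:(lra)). now rewrite Ropp_involutive in Hzp. }
  specialize (Hb (- z) ltac:(lra) Hz0). lra.
Qed.

Lemma exp_growth (h dh : R -> R) (k a b : R) :
  a <= b -> (forall s, a <= s <= b -> is_derive h s (dh s)) ->
  (forall s, a <= s <= b -> dh s <= k * h s) ->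
  h b <= h a * exp (k * (b - a)).
Proof.
intros Hab Hd Hle.
assert (H : - (h a * exp (- k * a)) <= - (h b * exp (- k * b))).
{ apply (derive_nonneg_le (fun s => - (h s * exp (- k * s)))
    (fun s => (k * h s - dh s) * exp (- k * s))); [easy| |].
  - intros s Hs. specialize (Hd s Hs).
    auto_derive; [now exists (dh s)|].
    replace (Derive (fun x : R => h x) s) with (dh s) by (symmetry; now apply is_derive_unique). ring.
  - intros s Hs. specialize (Hle s Hs). assert (0 < exp (- k * s)) by apply exp_pos.
    nra. }
replace (k * (b - a)) with (- k * a + k * b) by ring.
rewrite exp_plus, <- Rmult_assoc.
apply Rmult_le_reg_r with (exp (- k * b)); [apply exp_pos|].
rewrite (Rmult_assoc (h a * _)), <- exp_plus.
replace (k * b + - k * b) with 0 by ring. rewrite exp_0. lra.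
Qed.

(** Squares are used because absolute values are not differentiable. Adding [m ^ 2] to the sum of
    squares turns the forcing [m] into part of a homogeneous inequality, to which [exp_growth]
    applies. *)
Lemma gronwall_planar (x dx y dy : R -> R) (k m a b : R) :
  a <= b -> 0 <= k ->
  (forall s, a <= s <= b -> is_derive x s (dx s) /\ is_derive y s (dy s)) ->
  (forall s, a <= s <= b -> Rabs (dx s) <= k * (Rabs (x s) + Rabs (y s)) + m /\
                            Rabs (dy s) <= k * (Rabs (x s) + Rabs (y s)) + m) ->
  x b ^ 2 + y b ^ 2 <= (x a ^ 2 + y a ^ 2 + m ^ 2) * exp ((4 * k + 2) * (b - a)).
Proof.
intros Hab Hk Hd Hle.
apply Rle_trans with (x b ^ 2 + y b ^ 2 + m ^ 2); [nra|].
apply (exp_growth (fun s => x s ^ 2 + y s ^ 2 + m ^ 2)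
  (fun s => 2 * x s * dx s + 2 * y s * dy s)); [easy| |].
- intros s Hs. destruct (Hd s Hs) as [H1 H2].
  auto_derive; [split; [now exists (dx s)|split; [now exists (dy s)|easy]]|].
  replace (Derive (fun z : R => x z) s) with (dx s) by (symmetry; now apply is_derive_unique).
  replace (Derive (fun z : R => y z) s) with (dy s) by (symmetry; now apply is_derive_unique). ring.
- intros s Hs. destruct (Hle s Hs) as [H1 H2].
  assert (A1 : x s * dx s <= Rabs (x s) * (k * (Rabs (x s) + Rabs (y s)) + m)).
  { apply Rle_trans with (Rabs (x s * dx s)); [apply Rle_abs|].
    rewrite Rabs_mult. apply Rmult_le_compat_l; [apply Rabs_pos|easy]. }
  assert (A2 : y s * dy s <= Rabs (y s) * (k * (Rabs (x s) + Rabs (y s)) + m)).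
  { apply Rle_trans with (Rabs (y s * dy s)); [apply Rle_abs|].
    rewrite Rabs_mult. apply Rmult_le_compat_l; [apply Rabs_pos|easy]. }
  rewrite <- (pow2_abs (x s)), <- (pow2_abs (y s)).
  set (X := Rabs (x s)) in *. set (Y := Rabs (y s)) in *. clearbody X Y.
  assert (B1 : 0 <= k * (X - Y) ^ 2) by (apply Rmult_le_pos; [easy|apply pow2_ge_0]).
  assert (B2 := pow2_ge_0 (X - m)). assert (B3 := pow2_ge_0 (Y - m)).
  assert (B4 : 0 <= k * m ^ 2) by (apply Rmult_le_pos; [easy|apply pow2_ge_0]).
  nra.
Qed.

(** * Planar differential equations *)

Lemma exp_le_compat (x y : R) : x <= y -> exp x <= exp y.
Proof. intros [H | ->]; [left; now apply exp_increasing | now right]. Qed.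

Lemma exp_bound_right (phi dphi : R -> R) (t0 m k s : R) :
  0 < k -> (forall w, is_derive phi w (dphi w)) -> phi t0 = 0 ->
  (forall w, t0 <= w -> dphi w <= m * exp (k * (w - t0))) ->
  t0 <= s -> phi s <= m / k * exp (k * (s - t0)) - m / k.
Proof.
intros Hk Hd H0 Hb Hs.
cut (m / k * exp (k * (t0 - t0)) - phi t0 <= m / k * exp (k * (s - t0)) - phi s).
{ replace (t0 - t0) with 0 by ring. rewrite Rmult_0_r, exp_0, H0. lra. }
apply (derive_nonneg_le (fun w => m / k * exp (k * (w - t0)) - phi w)
  (fun w => m * exp (k * (w - t0)) - dphi w)); [easy| |].
- intros w _. specialize (Hd w). auto_derive; [now exists (dphi w)|].
  replace (Derive (fun z : R => phi z) w) with (dphi w)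
    by (symmetry; now apply is_derive_unique).
  unfold Rminus. field; lra.
- intros w Hw. specialize (Hb w ltac:(lra)). lra.
Qed.

(** Integrating from [t0] under the weight exp (k |s - t0|) gains a factor 1 / k. With k large
    compared with the Lipschitz constant, Picard iteration then contracts on the whole line at once.
    The left side of [t0] follows from the right one by reflection. *)
Lemma exp_bound (phi dphi : R -> R) (t0 m k s : R) :
  0 < k -> (forall w, is_derive phi w (dphi w)) -> phi t0 = 0 ->
  (forall w, Rabs (dphi w) <= m * exp (k * Rabs (w - t0))) ->
  Rabs (phi s) <= m / k * exp (k * Rabs (s - t0)).
Proof.
assert (K : forall phi dphi s, 0 < k -> (forall w, is_derive phi w (dphi w)) ->
  phi t0 = 0 -> (forall w, Rabs (dphi w) <= m * exp (k * Rabs (w - t0))) ->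
  t0 <= s -> Rabs (phi s) <= m / k * exp (k * Rabs (s - t0))).
{ clear. intros phi dphi s Hk Hd H0 Hb Hs.
  assert (Hm : 0 <= m / k).
  { specialize (Hb t0). replace (t0 - t0) with 0 in Hb by ring.
    rewrite Rabs_R0, Rmult_0_r, exp_0 in Hb.
    assert (H := Rabs_pos (dphi t0)). apply Rdiv_le_0_compat; lra. }
  rewrite (Rabs_pos_eq (s - t0)) by lra.
  apply Rabs_le. split.
  - assert (H := exp_bound_right (fun w => - phi w) (fun w => - dphi w) t0 m k s Hk).
    apply Ropp_le_cancel. rewrite Ropp_involutive.
    eapply Rle_trans; [apply H|]; [| lra | | easy | lra].
    + intros w. now apply (is_derive_opp phi).
    + intros w Hw. specialize (Hb w). rewrite (Rabs_pos_eq (w - t0)) in Hb by lra.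
      apply Rabs_le_between in Hb. lra.
  - eapply Rle_trans;
      [apply (exp_bound_right phi dphi t0 m k s Hk Hd H0)|]; [ | easy | lra].
    intros w Hw. specialize (Hb w). rewrite (Rabs_pos_eq (w - t0)) in Hb by lra.
    apply Rabs_le_between in Hb. lra. }
intros Hk Hd H0 Hb.
destruct (Rle_or_lt t0 s) as [Hs|Hs]; [now apply (K phi dphi)|].
specialize (K (fun w => phi (2 * t0 - w)) (fun w => - dphi (2 * t0 - w)) (2 * t0 - s) Hk).
cbv beta in K.
replace (2 * t0 - (2 * t0 - s)) with s in K by ring.
replace (Rabs (s - t0)) with (Rabs (2 * t0 - s - t0))
  by (rewrite <- Rabs_Ropp; f_equal; ring).
apply K; [| | |lra].
- intros w. evar_last.
  + apply (is_derive_comp phi (fun w => 2 * t0 - w) w); [apply Hd|].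
    auto_derive; [easy|reflexivity].
  + simpl. unfold scal; simpl; unfold mult; simpl. ring.
- now replace (2 * t0 - t0) with t0 by ring.
- intros w. rewrite Rabs_Ropp.
  replace (Rabs (w - t0)) with (Rabs (2 * t0 - w - t0)); [apply Hb|].
  rewrite <- Rabs_Ropp; f_equal; ring.
Qed.

Definition planar_lipschitz (L : R) (P : R -> R -> R -> R) : Prop :=
  forall t x y x' y',
    Rabs (P t x y - P t x' y') <= L * (Rabs (x - x') + Rabs (y - y')).

(** Continuity along continuous curves is what the integrands of the Picard iteration call for; it
    replaces joint continuity in three variables. *)
Definition curve_continuous (P : R -> R -> R -> R) : Prop :=
  forall X Y t, continuous X t -> continuous Y t ->
    continuous (fun s => P s (X s) (Y s)) t.

Lemma is_derive_primitive (h : R -> R) (c t0 : R) :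
  (forall s, continuous h s) ->
  forall s, is_derive (fun w => c + RInt h t0 w) s (h s).
Proof.
intros Hc s.
replace (h s) with (0 + h s) by ring.
apply (is_derive_plus (fun _ => c) (fun w => RInt h t0 w)); [exact (is_derive_const c s)|].
apply (is_derive_RInt h (fun w => RInt h t0 w) t0 s); [|apply Hc].
apply filter_forall. intros w. apply (@RInt_correct R_CompleteNormedModule).
apply (@ex_RInt_continuous R_CompleteNormedModule). intros; apply Hc.
Qed.

Fixpoint picard (P Q : R -> R -> R -> R) (t0 x0 y0 : R) (n : nat) :
  (R -> R) * (R -> R) :=
  match n with
  | O => (fun _ => x0, fun _ => y0)
  | S n =>
      let '(X, Y) := picard P Q t0 x0 y0 n in
      (fun s => x0 + RInt (fun w => P w (X w) (Y w)) t0 s,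
       fun s => y0 + RInt (fun w => Q w (X w) (Y w)) t0 s)
  end.

Lemma is_lim_seq_geom_half (c : R) : is_lim_seq (fun n => c * (1 / 2) ^ n) 0.
Proof.
replace (Finite 0) with (Rbar_mult c 0) by (simpl; f_equal; ring).
apply is_lim_seq_scal_l. apply is_lim_seq_geom. rewrite Rabs_pos_eq; lra.
Qed.

Lemma geom_half_small (c eps : R) : 0 <= c -> 0 < eps ->
  exists n, c * (1 / 2) ^ n < eps.
Proof.
intros Hc He.
assert (H := is_lim_seq_geom_half c). apply is_lim_seq_spec in H.
destruct (H (mkposreal eps He)) as [n Hn]. exists n. specialize (Hn n (le_n n)). simpl in Hn.
apply Rabs_lt_between in Hn. lra.
Qed.

Lemma geom_cauchy_lim (u : nat -> R) (c : R) :
  (forall n, Rabs (u (S n) - u n) <= c * (1 / 2) ^ n) ->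
  exists l, forall n, Rabs (l - u n) <= 2 * c * (1 / 2) ^ n.
Proof.
intros H.
assert (Hc : 0 <= c).
{ specialize (H O). simpl in H. assert (A := Rabs_pos (u 1%nat - u O)). lra. }
assert (Hd : forall n k, Rabs (u (n + k)%nat - u n) <= 2 * c * (1 / 2) ^ n).
{ intros n k.
  cut (Rabs (u (n + k)%nat - u n) <= 2 * c * (1 / 2) ^ n - 2 * c * (1 / 2) ^ (n + k)).
  { assert (0 <= (1 / 2) ^ (n + k)) by (apply pow_le; lra). nra. }
  induction k as [|k IH].
  - rewrite Nat.add_0_r. rewrite !Rminus_diag, Rabs_R0. lra.
  - replace (n + S k)%nat with (S (n + k)) by lia.
    specialize (H (n + k)%nat).
    replace (u (S (n + k)) - u n) with
      ((u (S (n + k)) - u (n + k)%nat) + (u (n + k)%nat - u n)) by ring.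
    eapply Rle_trans; [apply Rabs_triang|]. simpl. lra. }
assert (Hex : ex_finite_lim_seq u).
{ apply ex_lim_seq_cauchy_corr. intros [eps He].
  destruct (geom_half_small (2 * c) (eps / 2) ltac:(lra) ltac:(lra)) as [N HN].
  exists N. intros n m Hn Hm. simpl.
  replace n with (N + (n - N))%nat by lia. replace m with (N + (m - N))%nat by lia.
  assert (A := Hd N (n - N)%nat). assert (B := Hd N (m - N)%nat).
  apply Rabs_le_between in A. apply Rabs_le_between in B.
  apply Rabs_lt_between. lra. }
destruct Hex as [l Hl]. exists l. intros n.
assert (Hl' : is_lim_seq (fun k => Rabs (u (n + k)%nat - u n)) (Rabs (l - u n))).
{ apply (is_lim_seq_abs (fun k => u (n + k)%nat - u n) (Finite (l - u n))).
  apply (is_lim_seq_minus' (fun k => u (n + k)%nat) (fun _ => u n)); [|apply is_lim_seq_const].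
  apply is_lim_seq_ext with (fun k => u (k + n)%nat); [intros k; f_equal; lia|].
  now apply is_lim_seq_incr_n. }
exact (is_lim_seq_le _ _ _ _ (Hd n) Hl' (is_lim_seq_const _)).
Qed.

(** The error bound depends on the point through [b]; continuity of [b] makes it uniform near each
    point, which is enough. *)
Lemma locally_uniform_limit_continuous (u : nat -> R -> R) (l b : R -> R) :
  (forall n s, continuous (u n) s) -> (forall s, continuous b s) ->
  (forall n s, Rabs (l s - u n s) <= b s * (1 / 2) ^ n) ->
  forall s, continuous l s.
Proof.
intros Hu Hb H s. apply continuous_epsP. intros eps He.
assert (Hb0 : 0 <= b s).
{ specialize (H O s). simpl in H. assert (A := Rabs_pos (l s - u O s)). lra. }
destruct (geom_half_small (b s + 1) (eps / 3) ltac:(lra) ltac:(lra)) as [n Hn].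
destruct (proj1 (continuous_epsP _ _) (Hu n s) (eps / 3) ltac:(lra)) as [d1 [Hd1 H1]].
destruct (proj1 (continuous_epsP _ _) (Hb s) 1 ltac:(lra)) as [d2 [Hd2 H2]].
exists (Rmin d1 d2). split; [now apply Rmin_glb_lt|].
intros y Hy. specialize (H1 y (Rlt_le_trans _ _ _ Hy (Rmin_l _ _))).
specialize (H2 y (Rlt_le_trans _ _ _ Hy (Rmin_r _ _))).
assert (A1 := H n s). assert (A2 := H n y).
apply Rabs_lt_between in H1. apply Rabs_lt_between in H2.
apply Rabs_le_between in A1. apply Rabs_le_between in A2.
assert (0 < (1 / 2) ^ n) by (apply pow_lt; lra).
assert (b y * (1 / 2) ^ n <= (b s + 1) * (1 / 2) ^ n) by (apply Rmult_le_compat_r; lra).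
assert (b s * (1 / 2) ^ n <= (b s + 1) * (1 / 2) ^ n) by (apply Rmult_le_compat_r; lra).
apply Rabs_lt_between. lra.
Qed.

Lemma continuous_exp_dist (c k t0 s : R) :
  continuous (fun s => c * exp (k * Rabs (s - t0))) s.
Proof.
apply (continuous_scal_r c (fun s => exp (k * Rabs (s - t0)))).
apply (continuous_comp (fun s => k * Rabs (s - t0)) exp).
- apply (continuous_scal_r k (fun s => Rabs (s - t0))).
  apply (continuous_comp (fun s => s - t0) Rabs).
  + apply (continuous_minus (fun s : R => s) (fun _ => t0));
      [apply continuous_id|apply continuous_const].
  + apply continuous_Rabs.
- apply (is_derive_continuous exp _ (exp (k * Rabs (s - t0)))).
  auto_derive; [easy|ring].
Qed.

Lemma planar_flow_exists (P Q : R -> R -> R -> R) (L B t0 x0 y0 : R) :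
  0 < L -> planar_lipschitz L P -> planar_lipschitz L Q ->
  curve_continuous P -> curve_continuous Q ->
  (forall t, Rabs (P t x0 y0) <= B) -> (forall t, Rabs (Q t x0 y0) <= B) ->
  exists X Y : R -> R, X t0 = x0 /\ Y t0 = y0 /\
    forall t, is_derive X t (P t (X t) (Y t)) /\ is_derive Y t (Q t (X t) (Y t)).
Proof.
intros HL LP LQ CP CQ BP BQ.
set (u := fun n => fst (picard P Q t0 x0 y0 n)).
set (v := fun n => snd (picard P Q t0 x0 y0 n)).
assert (HuS : forall n s, u (S n) s = x0 + RInt (fun w => P w (u n w) (v n w)) t0 s).
{ intros n s. unfold u, v. simpl. now destruct (picard P Q t0 x0 y0 n). }
assert (HvS : forall n s, v (S n) s = y0 + RInt (fun w => Q w (u n w) (v n w)) t0 s).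
{ intros n s. unfold u, v. simpl. now destruct (picard P Q t0 x0 y0 n). }
assert (Hcont : forall n s, continuous (u n) s /\ continuous (v n) s).
{ induction n as [|n IH]; intros s.
  - split; apply continuous_const.
  - split.
    + apply continuous_ext with (fun s => x0 + RInt (fun w => P w (u n w) (v n w)) t0 s);
        [intros; symmetry; apply HuS|].
      eapply is_derive_continuous.
      apply (is_derive_primitive (fun w => P w (u n w) (v n w))).
      intros w. apply CP; apply IH.
    + apply continuous_ext with (fun s => y0 + RInt (fun w => Q w (u n w) (v n w)) t0 s);
        [intros; symmetry; apply HvS|].
      eapply is_derive_continuous.
      apply (is_derive_primitive (fun w => Q w (u n w) (v n w))).
      intros w. apply CQ; apply IH. }
assert (Hdu : forall n s, is_derive (u (S n)) s (P s (u n s) (v n s))).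
{ intros n s.
  apply is_derive_ext with (fun s => x0 + RInt (fun w => P w (u n w) (v n w)) t0 s);
    [intros; symmetry; apply HuS|].
  apply (is_derive_primitive (fun w => P w (u n w) (v n w))).
  intros w. apply CP; apply Hcont. }
assert (Hdv : forall n s, is_derive (v (S n)) s (Q s (u n s) (v n s))).
{ intros n s.
  apply is_derive_ext with (fun s => y0 + RInt (fun w => Q w (u n w) (v n w)) t0 s);
    [intros; symmetry; apply HvS|].
  apply (is_derive_primitive (fun w => Q w (u n w) (v n w))).
  intros w. apply CQ; apply Hcont. }
assert (Hu0 : forall n, u n t0 = x0).
{ intros [|n]; [easy|]. rewrite HuS, RInt_point. unfold zero; simpl; ring. }
assert (Hv0 : forall n, v n t0 = y0).
{ intros [|n]; [easy|]. rewrite HvS, RInt_point. unfold zero; simpl; ring. }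
(* With this weight each iteration halves the distance: two coordinates contribute 2 L, and
   integration divides by 4 L. *)
set (k := 4 * L).
set (E := fun s => exp (k * Rabs (s - t0))).
assert (HE : forall s, 1 <= E s).
{ intros s. unfold E. apply Rle_trans with (1 + k * Rabs (s - t0)); [|apply exp_ineq1_le].
  assert (0 <= k * Rabs (s - t0)) by (apply Rmult_le_pos; [unfold k; lra|apply Rabs_pos]).
  lra. }
assert (Hk : 0 < k) by (unfold k; lra).
assert (HB : 0 <= B) by (apply Rle_trans with (1 := Rabs_pos (P 0 x0 y0)), BP).
assert (Hstep : forall n s,
  Rabs (u (S n) s - u n s) <= B / k * (1 / 2) ^ n * E s /\
  Rabs (v (S n) s - v n s) <= B / k * (1 / 2) ^ n * E s).
{ induction n as [|n IH]; intros s.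
  - simpl pow. rewrite Rmult_1_r. unfold E. split.
    + apply (exp_bound (fun s => u 1%nat s - u O s) (fun s => P s (u O s) (v O s))).
      * easy.
      * intros w. replace (P w (u O w) (v O w)) with (P w (u O w) (v O w) - 0) by ring.
        apply (is_derive_minus (u 1%nat) (u O)); [apply Hdu|exact (is_derive_const x0 w)].
      * rewrite !Hu0; ring.
      * intros w. eapply Rle_trans; [apply BP|]. fold (E w). specialize (HE w). nra.
    + apply (exp_bound (fun s => v 1%nat s - v O s) (fun s => Q s (u O s) (v O s))).
      * easy.
      * intros w. replace (Q w (u O w) (v O w)) with (Q w (u O w) (v O w) - 0) by ring.
        apply (is_derive_minus (v 1%nat) (v O)); [apply Hdv|exact (is_derive_const y0 w)].
      * rewrite !Hv0; ring.
      * intros w. eapply Rle_trans; [apply BQ|]. fold (E w). specialize (HE w). nra.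
  - replace (B / k * (1 / 2) ^ S n) with (L * (2 * (B / k * (1 / 2) ^ n)) / k)
      by (simpl; unfold k; field; lra).
    assert (G : forall F, planar_lipschitz L F -> forall w,
      Rabs (F w (u (S n) w) (v (S n) w) - F w (u n w) (v n w)) <=
      L * (2 * (B / k * (1 / 2) ^ n)) * exp (k * Rabs (w - t0))).
    { intros F LF w. eapply Rle_trans; [apply LF|]. rewrite Rmult_assoc.
      apply Rmult_le_compat_l; [lra|]. destruct (IH w) as [I1 I2]. unfold E in I1, I2. lra. }
    split.
    + apply (exp_bound (fun s => u (S (S n)) s - u (S n) s)
        (fun s => P s (u (S n) s) (v (S n) s) - P s (u n s) (v n s))); [easy| | |now apply G].
      * intros w. apply (is_derive_minus (u (S (S n))) (u (S n))); apply Hdu.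
      * rewrite !Hu0; ring.
    + apply (exp_bound (fun s => v (S (S n)) s - v (S n) s)
        (fun s => Q s (u (S n) s) (v (S n) s) - Q s (u n s) (v n s))); [easy| | |now apply G].
      * intros w. apply (is_derive_minus (v (S (S n))) (v (S n))); apply Hdv.
      * rewrite !Hv0; ring. }
assert (HX : forall s, exists l, forall n,
  Rabs (l - u n s) <= 2 * (B / k * E s) * (1 / 2) ^ n).
{ intros s. apply geom_cauchy_lim. intros n. destruct (Hstep n s). lra. }
assert (HY : forall s, exists l, forall n,
  Rabs (l - v n s) <= 2 * (B / k * E s) * (1 / 2) ^ n).
{ intros s. apply geom_cauchy_lim. intros n. destruct (Hstep n s). lra. }
(* [Lim_seq] is total, so the limit is a function without any choice; [Hlim] below identifies it
   with the limits given by [HX] and [HY]. *)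
set (X := fun s => real (Lim_seq (fun n => u n s))).
set (Y := fun s => real (Lim_seq (fun n => v n s))).
assert (Hlim : forall (w : nat -> R) (c l : R),
  (forall n, Rabs (l - w n) <= c * (1 / 2) ^ n) -> real (Lim_seq w) = l).
{ intros w c l H. rewrite (is_lim_seq_unique w l); [easy|].
  apply is_lim_seq_spec. intros [eps He].
  assert (Hc : 0 <= c).
  { specialize (H O). simpl in H. assert (A := Rabs_pos (l - w O)). lra. }
  destruct (geom_half_small c eps Hc He) as [N HN]. exists N. intros n Hn. simpl.
  rewrite Rabs_minus_sym. eapply Rle_lt_trans; [apply H|].
  eapply Rle_lt_trans; [|apply HN]. apply Rmult_le_compat_l; [easy|].
  replace n with (N + (n - N))%nat by lia. rewrite pow_add.
  rewrite <- (Rmult_1_r ((1 / 2) ^ N)) at 2.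
  apply Rmult_le_compat_l; [apply pow_le; lra|].
  apply Rle_trans with (1 ^ (n - N)); [apply pow_incr; lra|rewrite pow1; lra]. }
assert (HXb : forall n s, Rabs (X s - u n s) <= 2 * (B / k) * E s * (1 / 2) ^ n).
{ intros n s. destruct (HX s) as [l Hl]. unfold X. rewrite (Hlim _ _ l Hl).
  specialize (Hl n). lra. }
assert (HYb : forall n s, Rabs (Y s - v n s) <= 2 * (B / k) * E s * (1 / 2) ^ n).
{ intros n s. destruct (HY s) as [l Hl]. unfold Y. rewrite (Hlim _ _ l Hl).
  specialize (Hl n). lra. }
assert (HXc : forall s, continuous X s).
{ apply (locally_uniform_limit_continuous u X (fun s => 2 * (B / k) * E s)); [|apply continuous_exp_dist|easy].
  intros; apply Hcont. }
assert (HYc : forall s, continuous Y s).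
{ apply (locally_uniform_limit_continuous v Y (fun s => 2 * (B / k) * E s)); [|apply continuous_exp_dist|easy].
  intros; apply Hcont. }
(* The Picard integral of the limit is itself a limit of the iterates, by the same weighted
   estimate; hence the limit is a fixed point. *)
assert (Hfix : forall F c (w : nat -> R -> R), planar_lipschitz L F -> curve_continuous F ->
  (forall n s, is_derive (w (S n)) s (F s (u n s) (v n s))) ->
  (forall n, w n t0 = c) -> forall s n,
  Rabs (c + RInt (fun z => F z (X z) (Y z)) t0 s - w (S n) s) <= B / k * E s * (1 / 2) ^ n).
{ intros F c w LF CF Hdw Hw0 s n.
  replace (B / k * E s * (1 / 2) ^ n) with (B * (1 / 2) ^ n / k * E s) by (field; lra).
  apply (exp_bound (fun s => c + RInt (fun z => F z (X z) (Y z)) t0 s - w (S n) s)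
    (fun s => F s (X s) (Y s) - F s (u n s) (v n s))); [easy| | |].
  - intros z. apply (is_derive_minus (fun s => c + RInt (fun z => F z (X z) (Y z)) t0 s) (w (S n)));
      [|apply Hdw].
    apply (is_derive_primitive (fun z => F z (X z) (Y z))). intros; now apply CF.
  - rewrite Hw0, RInt_point. unfold zero; simpl; ring.
  - intros z. eapply Rle_trans; [apply LF|]. fold (E z).
    specialize (HXb n z). specialize (HYb n z).
    replace (B * (1 / 2) ^ n * E z) with (L * (2 * (2 * (B / k) * E z * (1 / 2) ^ n)))
      by (unfold k; field; lra).
    apply Rmult_le_compat_l; [lra|]. rewrite <- Rplus_diag. now apply Rplus_le_compat. }
assert (HXfix : forall s, x0 + RInt (fun z => P z (X z) (Y z)) t0 s = X s).
{ intros s. unfold X at 2. symmetry.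
  rewrite <- Lim_seq_incr_1.
  apply (Hlim (fun n => u (S n) s) (B / k * E s)). intros n. now apply Hfix. }
assert (HYfix : forall s, y0 + RInt (fun z => Q z (X z) (Y z)) t0 s = Y s).
{ intros s. unfold Y at 2. symmetry.
  rewrite <- Lim_seq_incr_1.
  apply (Hlim (fun n => v (S n) s) (B / k * E s)). intros n. now apply Hfix. }
exists X, Y. split; [|split].
- rewrite <- HXfix, RInt_point. unfold zero; simpl; ring.
- rewrite <- HYfix, RInt_point. unfold zero; simpl; ring.
- intros t. split.
  + apply is_derive_ext with (1 := HXfix).
    apply (is_derive_primitive (fun z => P z (X z) (Y z))). intros; now apply CP.
  + apply is_derive_ext with (1 := HYfix).
    apply (is_derive_primitive (fun z => Q z (X z) (Y z))). intros; now apply CQ.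
Qed.

(** * Dependence of solutions and of hitting times on a parameter *)

Definition solves (P Q : R -> R -> R -> R) (X Y : R -> R) : Prop :=
  forall t, is_derive X t (P t (X t) (Y t)) /\ is_derive Y t (Q t (X t) (Y t)).

Lemma solutions_dist (P Q : R -> R -> R -> R) (L a b : R) (X Y X' Y' : R -> R) :
  0 <= L -> planar_lipschitz L P -> planar_lipschitz L Q -> a <= b ->
  (forall t, a <= t <= b ->
     is_derive X t (P t (X t) (Y t)) /\ is_derive Y t (Q t (X t) (Y t))) ->
  (forall t, a <= t <= b ->
     is_derive X' t (P t (X' t) (Y' t)) /\ is_derive Y' t (Q t (X' t) (Y' t))) ->
  (X b - X' b) ^ 2 + (Y b - Y' b) ^ 2 <=
  ((X a - X' a) ^ 2 + (Y a - Y' a) ^ 2) * exp ((4 * L + 2) * (b - a)).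
Proof.
intros HL LP LQ Hab H H'.
eapply Rle_trans; [apply (gronwall_planar (fun t => X t - X' t)
  (fun t => P t (X t) (Y t) - P t (X' t) (Y' t)) (fun t => Y t - Y' t)
  (fun t => Q t (X t) (Y t) - Q t (X' t) (Y' t)) L 0 a b Hab HL)|right; ring].
- intros t Ht. destruct (H t Ht), (H' t Ht).
  split; [now apply (is_derive_minus X X')|now apply (is_derive_minus Y Y')].
- intros t Ht. rewrite Rplus_0_r. split; [apply LP|apply LQ].
Qed.

(** Differentiability in the parameter is carried from time [a] to time [b]. The error
    [xs l - xs l0 - (l - l0) xi] solves the linearised equation up to a remainder quadratic in the
    distance of the two solutions, which is of order (l - l0)^2 by [solutions_dist]. Gronwall then
    keeps an error that is o(l - l0) at [a] of that order at [b]. *)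
Lemma derive_transport (P Q : R -> R -> R -> R) (L M l0 rho a b : R)
  (xs ys : R -> R -> R) (A B A' B' xi eta : R -> R) :
  0 < rho -> a <= b -> 0 <= L -> 0 <= M ->
  planar_lipschitz L P -> planar_lipschitz L Q ->
  (forall l, Rabs (l - l0) < rho -> solves P Q (xs l) (ys l)) ->
  (forall t, a <= t <= b ->
     Rabs (A t) <= L /\ Rabs (B t) <= L /\ Rabs (A' t) <= L /\ Rabs (B' t) <= L) ->
  (forall t x y, a <= t <= b ->
     Rabs (P t x y - P t (xs l0 t) (ys l0 t)
           - A t * (x - xs l0 t) - B t * (y - ys l0 t))
     <= M * (Rabs (x - xs l0 t) + Rabs (y - ys l0 t)) ^ 2 /\
     Rabs (Q t x y - Q t (xs l0 t) (ys l0 t)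
           - A' t * (x - xs l0 t) - B' t * (y - ys l0 t))
     <= M * (Rabs (x - xs l0 t) + Rabs (y - ys l0 t)) ^ 2) ->
  (forall t, a <= t <= b ->
     is_derive xi t (A t * xi t + B t * eta t) /\
     is_derive eta t (A' t * xi t + B' t * eta t)) ->
  is_derive (fun l => xs l a) l0 (xi a) ->
  is_derive (fun l => ys l a) l0 (eta a) ->
  is_derive (fun l => xs l b) l0 (xi b) /\ is_derive (fun l => ys l b) l0 (eta b).
Proof.
intros Hrho Hab HL HM LP LQ Hsol Hbd Hrem Hlin Hxa Hya.
set (G := exp ((4 * L + 2) * (b - a))).
assert (HG : 1 <= G).
{ unfold G. apply Rle_trans with (1 + (4 * L + 2) * (b - a)); [|apply exp_ineq1_le].
  assert (0 <= (4 * L + 2) * (b - a)) by (apply Rmult_le_pos; lra). lra. }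
(* [C] times |l - l0|^2 will bound the squared distance at time [a], and [C2] times it the squared
   sum of distances on [a, b]; the 2 in [C2] passes from a sum of squares to the square of a sum. *)
set (C := (Rabs (xi a) + 1) ^ 2 + (Rabs (eta a) + 1) ^ 2).
assert (HC : 0 <= C) by (unfold C; apply Rplus_le_le_0_compat; apply pow2_ge_0).
set (C2 := 2 * (C * G)).
assert (HC2 : 0 <= C2) by (unfold C2; apply Rmult_le_pos; [lra|apply Rmult_le_pos; lra]).
cut (forall eps, 0 < eps -> exists d, 0 < d /\ forall l, Rabs (l - l0) < d ->
  (xs l b - xs l0 b - xi b * (l - l0)) ^ 2 + (ys l b - ys l0 b - eta b * (l - l0)) ^ 2
   <= (eps * Rabs (l - l0)) ^ 2).
{ intros K.
  assert (Hsq : forall x y z, 0 <= z -> x ^ 2 + y ^ 2 <= z ^ 2 -> Rabs x <= z /\ Rabs y <= z).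
  { intros x y z Hz Hxy. rewrite <- (pow2_abs x), <- (pow2_abs y) in Hxy.
    assert (A1 := pow2_ge_0 (Rabs x)). assert (A2 := pow2_ge_0 (Rabs y)).
    assert (A3 := Rabs_pos x). assert (A4 := Rabs_pos y).
    split; apply Rnot_lt_le; intros A5; nra. }
  split; apply is_derive_epsP; intros eps He; destruct (K eps He) as [d [Hd H]];
    exists d; split; try easy; intros l Hl; specialize (H l Hl);
    apply Hsq in H; try easy; apply Rmult_le_pos; try lra; apply Rabs_pos. }
intros eps He.
set (e1 := Rmin 1 (eps / (2 * G))).
assert (He1 : 0 < e1).
{ unfold e1. apply Rmin_glb_lt; [lra|]. apply Rdiv_lt_0_compat; lra. }
assert (He1a : e1 <= 1) by apply Rmin_l.
assert (He1b : e1 * (2 * G) <= eps).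
{ apply Rmult_le_reg_r with (/ (2 * G)); [apply Rinv_0_lt_compat; lra|].
  rewrite Rmult_assoc, Rinv_r by lra. rewrite Rmult_1_r. apply Rmin_r. }
destruct (proj1 (is_derive_epsP _ _ _) Hxa e1 He1) as [d1 [Hd1 H1]].
destruct (proj1 (is_derive_epsP _ _ _) Hya e1 He1) as [d2 [Hd2 H2]].
(* Below [d3] the quadratic remainder uses at most half of the allowance [eps ^ 2]; the initial
   error, governed by [e1], uses the other half. *)
set (d3 := eps / (2 * G * (M * C2 + 1))).
assert (HMC : 0 <= M * C2) by (apply Rmult_le_pos; easy).
assert (Hd3 : 0 < d3).
{ unfold d3. apply Rdiv_lt_0_compat; [easy|]. apply Rmult_lt_0_compat; lra. }
exists (Rmin rho (Rmin d1 (Rmin d2 d3))).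
split; [repeat apply Rmin_glb_lt; easy|].
intros l Hl.
apply Rmin_Rgt_l in Hl. destruct Hl as [Hl0 Hl].
apply Rmin_Rgt_l in Hl. destruct Hl as [Hl1 Hl].
apply Rmin_Rgt_l in Hl. destruct Hl as [Hl2 Hl3].
specialize (H1 l Hl1). specialize (H2 l Hl2).
set (h := l - l0) in *. set (H := Rabs h) in *.
assert (HH : 0 <= H) by apply Rabs_pos.
assert (HhH : h ^ 2 = H ^ 2) by (unfold H; now rewrite pow2_abs).
assert (Hs0 : solves P Q (xs l0) (ys l0)).
{ apply Hsol. rewrite Rminus_diag, Rabs_R0. easy. }
assert (Hs := Hsol l Hl0).
assert (D0 : (xs l a - xs l0 a) ^ 2 + (ys l a - ys l0 a) ^ 2 <= C * H ^ 2).
{ assert (T : forall z c, Rabs (z - c * h) <= e1 * H -> z ^ 2 <= (Rabs c + 1) ^ 2 * H ^ 2).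
  { intros z c Hz. rewrite <- (pow2_abs z), <- Rpow_mult_distr. apply pow_incr.
    split; [apply Rabs_pos|]. replace z with ((z - c * h) + c * h) by ring.
    eapply Rle_trans; [apply Rabs_triang|]. rewrite Rabs_mult. fold H. nra. }
  apply T in H1. apply T in H2. unfold C. lra. }
assert (D : forall t, a <= t <= b ->
  (Rabs (xs l t - xs l0 t) + Rabs (ys l t - ys l0 t)) ^ 2 <= C2 * H ^ 2).
{ intros t Ht.
  assert (E := solutions_dist P Q L a t (xs l) (ys l) (xs l0) (ys l0) HL LP LQ (proj1 Ht)
    (fun t _ => Hs t) (fun t _ => Hs0 t)).
  assert (HGt : exp ((4 * L + 2) * (t - a)) <= G).
  { apply exp_le_compat. apply Rmult_le_compat_l; lra. }
  rewrite <- (pow2_abs (xs l t - xs l0 t)), <- (pow2_abs (ys l t - ys l0 t)) in E.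
  assert (E2 : ((xs l a - xs l0 a) ^ 2 + (ys l a - ys l0 a) ^ 2) * exp ((4 * L + 2) * (t - a))
    <= C * H ^ 2 * G).
  { apply Rmult_le_compat; [apply Rplus_le_le_0_compat; apply pow2_ge_0|left; apply exp_pos|easy|easy]. }
  unfold C2. assert (N := pow2_ge_0 (Rabs (xs l t - xs l0 t) - Rabs (ys l t - ys l0 t))).
  nra. }
assert (Gr := gronwall_planar (fun t => xs l t - xs l0 t - h * xi t)
  (fun t => P t (xs l t) (ys l t) - P t (xs l0 t) (ys l0 t) - h * (A t * xi t + B t * eta t))
  (fun t => ys l t - ys l0 t - h * eta t)
  (fun t => Q t (xs l t) (ys l t) - Q t (xs l0 t) (ys l0 t) - h * (A' t * xi t + B' t * eta t))
  L (M * C2 * H ^ 2) a b Hab HL).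
cbv beta in Gr. fold G in Gr.
rewrite (Rmult_comm (xi b)), (Rmult_comm (eta b)).
eapply Rle_trans; [apply Gr|]; clear Gr.
- intros t Ht. destruct (Hs t) as [S1 S2], (Hs0 t) as [S3 S4], (Hlin t Ht) as [S5 S6].
  split.
  + apply (is_derive_minus (fun t => xs l t - xs l0 t) (fun t => h * xi t)).
    * now apply (is_derive_minus (xs l) (xs l0)).
    * now apply (is_derive_scal xi).
  + apply (is_derive_minus (fun t => ys l t - ys l0 t) (fun t => h * eta t)).
    * now apply (is_derive_minus (ys l) (ys l0)).
    * now apply (is_derive_scal eta).
- intros t Ht. destruct (Hrem t (xs l t) (ys l t) Ht) as [R1 R2].
  destruct (Hbd t Ht) as [B1 [B2 [B3 B4]]]. specialize (D t Ht).
  assert (HMD : M * (Rabs (xs l t - xs l0 t) + Rabs (ys l t - ys l0 t)) ^ 2 <= M * C2 * H ^ 2).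
  { rewrite Rmult_assoc. now apply Rmult_le_compat_l. }
  assert (T : forall F F0 c c', Rabs c <= L -> Rabs c' <= L ->
    Rabs (F - F0 - c * (xs l t - xs l0 t) - c' * (ys l t - ys l0 t)) <= M * C2 * H ^ 2 ->
    Rabs (F - F0 - h * (c * xi t + c' * eta t)) <=
    L * (Rabs (xs l t - xs l0 t - h * xi t) + Rabs (ys l t - ys l0 t - h * eta t))
      + M * C2 * H ^ 2).
  { intros F F0 c c' Hc Hc' HF.
    replace (F - F0 - h * (c * xi t + c' * eta t)) with
     (c * (xs l t - xs l0 t - h * xi t) + c' * (ys l t - ys l0 t - h * eta t) +
      (F - F0 - c * (xs l t - xs l0 t) - c' * (ys l t - ys l0 t))) by ring.
    eapply Rle_trans; [apply Rabs_triang|]. apply Rplus_le_compat; [|easy].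
    eapply Rle_trans; [apply Rabs_triang|]. rewrite !Rabs_mult, Rmult_plus_distr_l.
    apply Rplus_le_compat; apply Rmult_le_compat_r; try easy; apply Rabs_pos. }
  split; apply T; try easy; eapply Rle_trans; eauto.
- rewrite (Rmult_comm h (xi a)), (Rmult_comm h (eta a)).
  assert (T : forall z, Rabs z <= e1 * H -> z ^ 2 <= e1 ^ 2 * H ^ 2).
  { intros z Hz. rewrite <- (pow2_abs z), <- Rpow_mult_distr. apply pow_incr.
    split; [apply Rabs_pos|easy]. }
  apply T in H1. apply T in H2.
  assert (U1 : 2 * e1 ^ 2 * G <= eps ^ 2 / 2).
  { assert (e1 ^ 2 * (2 * G) ^ 2 <= eps ^ 2).
    { rewrite <- Rpow_mult_distr. apply pow_incr. split; [|easy].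
      apply Rmult_le_pos; lra. }
    assert (0 <= e1 ^ 2) by nra. nra. }
  assert (U2 : (M * C2 * H) ^ 2 * G <= eps ^ 2 / 2).
  { assert (V : M * C2 * H * (2 * G) <= eps).
    { apply Rle_trans with (d3 * (2 * G * (M * C2 + 1))).
      - replace (M * C2 * H * (2 * G)) with ((H * (M * C2)) * (2 * G)) by ring.
        replace (d3 * (2 * G * (M * C2 + 1))) with (d3 * (M * C2 + 1) * (2 * G)) by ring.
        apply Rmult_le_compat_r; [lra|]. apply Rmult_le_compat; lra.
      - unfold d3. right. field. split; lra. }
    assert (W : (M * C2 * H) ^ 2 * (2 * G) ^ 2 <= eps ^ 2).
    { rewrite <- Rpow_mult_distr. apply pow_incr. split; [|easy].
      apply Rmult_le_pos; [apply Rmult_le_pos|]; lra. }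
    assert (0 <= (M * C2 * H) ^ 2) by apply pow2_ge_0. nra. }
  replace ((M * C2 * H ^ 2) ^ 2) with ((M * C2 * H) ^ 2 * H ^ 2) by ring.
  rewrite (Rpow_mult_distr eps).
  assert (0 <= H ^ 2) by apply pow2_ge_0.
  apply Rle_trans with ((e1 ^ 2 * H ^ 2 + e1 ^ 2 * H ^ 2 + (M * C2 * H) ^ 2 * H ^ 2) * G).
  + apply Rmult_le_compat_r; lra.
  + replace ((e1 ^ 2 * H ^ 2 + e1 ^ 2 * H ^ 2 + (M * C2 * H) ^ 2 * H ^ 2) * G) with
      ((2 * e1 ^ 2 * G + (M * C2 * H) ^ 2 * G) * H ^ 2) by ring.
    apply Rmult_le_compat_r; lra.
Qed.

(** Joint continuity in (l, t) of [F] along the family, when the solutions are known to depend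
    continuously on l only at the moving time [tau l]. The bound [Bd] on the field pays for moving
    from [tau l] to t. *)
Lemma field_limit (P Q F : R -> R -> R -> R) (L Bd l0 rho : R)
  (xs ys : R -> R -> R) (tau : R -> R) :
  0 < rho -> 0 <= L -> 0 <= Bd -> planar_lipschitz L F -> curve_continuous F ->
  (forall t x y, Rabs (P t x y) <= Bd) -> (forall t x y, Rabs (Q t x y) <= Bd) ->
  (forall l, Rabs (l - l0) < rho -> solves P Q (xs l) (ys l)) ->
  continuous tau l0 ->
  continuous (fun l => xs l (tau l)) l0 -> continuous (fun l => ys l (tau l)) l0 ->
  forall eps, 0 < eps -> exists d, 0 < d /\ forall l t,
    Rabs (l - l0) < d -> Rabs (t - tau l0) < d ->
    Rabs (F t (xs l t) (ys l t) - F (tau l0) (xs l0 (tau l0)) (ys l0 (tau l0))) <= eps.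
Proof.
intros Hrho HL HBd LF CF BP BQ Hsol Ht Hx Hy eps He.
set (x0 := xs l0 (tau l0)). set (y0 := ys l0 (tau l0)).
set (e := eps / (8 * (L * (Bd + 1) + 1))).
assert (HLB : 0 <= L * Bd) by (apply Rmult_le_pos; easy).
assert (Hee : 0 < e) by (unfold e; apply Rdiv_lt_0_compat; lra).
assert (Hee' : e * (8 * (L * (Bd + 1) + 1)) = eps) by (unfold e; field; lra).
destruct (proj1 (continuous_epsP _ _) Ht e Hee) as [d1 [Hd1 H1]].
destruct (proj1 (continuous_epsP _ _) Hx e Hee) as [d2 [Hd2 H2]].
destruct (proj1 (continuous_epsP _ _) Hy e Hee) as [d3 [Hd3 H3]].
destruct (proj1 (continuous_epsP _ _)
  (CF (fun _ => x0) (fun _ => y0) (tau l0) (continuous_const _ _) (continuous_const _ _)) e Hee)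
  as [d4 [Hd4 H4]].
exists (Rmin rho (Rmin e (Rmin (Rmin d1 d2) (Rmin d3 d4)))).
split; [repeat apply Rmin_glb_lt; easy|].
intros l t Hl Htt.
apply Rmin_Rgt_l in Hl. destruct Hl as [Hl0 Hl].
apply Rmin_Rgt_l in Hl. destruct Hl as [_ Hl].
apply Rmin_Rgt_l in Hl. destruct Hl as [Hl1 Hl].
apply Rmin_Rgt_l in Hl1. destruct Hl1 as [Hl1 Hl2].
apply Rmin_Rgt_l in Hl. destruct Hl as [Hl3 _].
apply Rmin_Rgt_l in Htt. destruct Htt as [_ Htt].
apply Rmin_Rgt_l in Htt. destruct Htt as [Ht1 Htt].
apply Rmin_Rgt_l in Htt. destruct Htt as [_ Htt].
apply Rmin_Rgt_l in Htt. destruct Htt as [_ Ht4].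
specialize (H1 l Hl1). specialize (H2 l Hl2). specialize (H3 l Hl3). specialize (H4 t Ht4).
cbv beta in H4.
assert (Htau : Rabs (t - tau l) <= 2 * e).
{ replace (t - tau l) with ((t - tau l0) - (tau l - tau l0)) by ring.
  eapply Rle_trans; [apply Rabs_triang|]. rewrite Rabs_Ropp. lra. }
assert (S := Hsol l Hl0).
assert (Hmv : forall (z dz : R -> R), (forall w, is_derive z w (dz w)) ->
  (forall w, Rabs (dz w) <= Bd) -> Rabs (z t - z (tau l)) <= 2 * Bd * e).
{ intros z dz Hz Hdz.
  destruct (mean_value_between z dz (tau l) t (fun w _ => Hz w)) as [c [_ E]].
  rewrite E, Rabs_mult. rewrite (Rmult_comm 2), Rmult_assoc.
  apply Rmult_le_compat; try apply Rabs_pos; easy. }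
assert (Mx := Hmv (xs l) _ (fun w => proj1 (S w)) (fun w => BP _ _ _)).
assert (My := Hmv (ys l) _ (fun w => proj2 (S w)) (fun w => BQ _ _ _)).
replace (F t (xs l t) (ys l t) - F (tau l0) x0 y0) with
  ((F t (xs l t) (ys l t) - F t x0 y0) + (F t x0 y0 - F (tau l0) x0 y0)) by ring.
eapply Rle_trans; [apply Rabs_triang|].
eapply Rle_trans; [apply Rplus_le_compat; [apply LF|left; apply H4]|].
assert (Ex : Rabs (xs l t - x0) <= 2 * Bd * e + e).
{ replace (xs l t - x0) with ((xs l t - xs l (tau l)) + (xs l (tau l) - x0)) by ring.
  eapply Rle_trans; [apply Rabs_triang|]. fold x0 in H2. lra. }
assert (Ey : Rabs (ys l t - y0) <= 2 * Bd * e + e).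
{ replace (ys l t - y0) with ((ys l t - ys l (tau l)) + (ys l (tau l) - y0)) by ring.
  eapply Rle_trans; [apply Rabs_triang|]. fold y0 in H3. lra. }
assert (L * (Rabs (xs l t - x0) + Rabs (ys l t - y0)) <= L * (2 * (2 * Bd * e + e)))
  by (apply Rmult_le_compat_l; lra).
assert (0 <= e * L) by (apply Rmult_le_pos; lra).
assert (0 <= e * (L * Bd)) by (apply Rmult_le_pos; lra).
nra.
Qed.

(** The effect of moving the time of evaluation, separated from the variation at fixed time: by the
    mean value theorem in t it is a speed close to [c] times the increment of [tau]. *)
Lemma derive_slide (z F : R -> R -> R) (tau : R -> R) (l0 rho c theta : R) :
  0 < rho ->
  (forall l, Rabs (l - l0) < rho -> forall t, is_derive (z l) t (F l t)) ->
  (forall eps, 0 < eps -> exists d, 0 < d /\ forall l t,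
    Rabs (l - l0) < d -> Rabs (t - tau l0) < d -> Rabs (F l t - c) <= eps) ->
  is_derive tau l0 theta ->
  is_derive (fun l => z l (tau l) - z l (tau l0)) l0 (c * theta).
Proof.
intros Hrho Hz HF Ht. apply is_derive_epsP. intros eps He.
set (k := Rabs theta + 1). assert (Hk : 0 < k) by (unfold k; assert (H := Rabs_pos theta); lra).
set (e := Rmin 1 (eps / (2 * (k + Rabs c)))).
assert (Hc := Rabs_pos c).
assert (He0 : 0 < e).
{ apply Rmin_glb_lt; [lra|]. apply Rdiv_lt_0_compat; lra. }
assert (He1 : e <= 1) by apply Rmin_l.
assert (He2 : e * (2 * (k + Rabs c)) <= eps).
{ apply Rmult_le_reg_r with (/ (2 * (k + Rabs c))); [apply Rinv_0_lt_compat; lra|].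
  rewrite Rmult_assoc, Rinv_r by lra. rewrite Rmult_1_r. apply Rmin_r. }
destruct (HF e He0) as [d1 [Hd1 H1]].
destruct (proj1 (is_derive_epsP _ _ _) Ht e He0) as [d2 [Hd2 H2]].
destruct (proj1 (continuous_epsP _ _) (is_derive_continuous _ _ _ Ht) d1 Hd1) as [d3 [Hd3 H3]].
exists (Rmin (Rmin rho d1) (Rmin d2 d3)). split; [repeat apply Rmin_glb_lt; easy|].
intros l Hl.
apply Rmin_Rgt_l in Hl. destruct Hl as [Hl Hl'].
apply Rmin_Rgt_l in Hl. destruct Hl as [Hl0 Hl1].
apply Rmin_Rgt_l in Hl'. destruct Hl' as [Hl2 Hl3].
specialize (H2 l Hl2). specialize (H3 l Hl3).
destruct (mean_value_between (z l) (F l) (tau l0) (tau l) (fun w _ => Hz l Hl0 w))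
  as [w [Hw E]].
rewrite E, Rminus_diag, Rminus_0_r.
assert (Hwd : Rabs (w - tau l0) < d1).
{ eapply Rle_lt_trans; [|apply H3].
  unfold Rmin, Rmax in Hw. destruct (Rle_dec (tau l0) (tau l)) in Hw.
  - rewrite !Rabs_pos_eq by lra. lra.
  - rewrite !Rabs_left1 by lra. lra. }
specialize (H1 l w Hl1 Hwd).
replace (F l w * (tau l - tau l0) - c * theta * (l - l0)) with
  ((F l w - c) * (tau l - tau l0) + c * (tau l - tau l0 - theta * (l - l0))) by ring.
eapply Rle_trans; [apply Rabs_triang|]. rewrite !Rabs_mult.
set (h := Rabs (l - l0)) in *. assert (Hh : 0 <= h) by apply Rabs_pos.
assert (Hdt : Rabs (tau l - tau l0) <= k * h).
{ replace (tau l - tau l0) with ((tau l - tau l0 - theta * (l - l0)) + theta * (l - l0)) by ring.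
  eapply Rle_trans; [apply Rabs_triang|]. rewrite Rabs_mult. unfold k, h in *. nra. }
apply Rle_trans with (e * (k * h) + Rabs c * (e * h)).
- apply Rplus_le_compat.
  + apply Rmult_le_compat; try apply Rabs_pos; easy.
  + apply Rmult_le_compat_l; easy.
- nra.
Qed.

(** An implicit function theorem in one variable: the mean value theorem in t writes
    [b - z l (tau l0)] as a speed at least [m] times the increment of [tau]. *)
Lemma derive_hitting_time (z F : R -> R -> R) (tau : R -> R) (l0 rho c m b xi : R) :
  0 < rho -> 0 < m ->
  (forall l, Rabs (l - l0) < rho -> forall t, is_derive (z l) t (F l t)) ->
  (forall l, Rabs (l - l0) < rho -> forall t, m <= F l t) ->
  (forall eps, 0 < eps -> exists d, 0 < d /\ forall l t,
    Rabs (l - l0) < d -> Rabs (t - tau l0) < d -> Rabs (F l t - c) <= eps) ->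
  (forall l, Rabs (l - l0) < rho -> z l (tau l) = b) ->
  is_derive (fun l => z l (tau l0)) l0 xi ->
  is_derive tau l0 (- xi / c).
Proof.
intros Hrho Hm Hz HFm HF Hb Hxi.
assert (Hc : m <= c).
{ apply Rnot_lt_le. intros Hlt. destruct (HF ((m - c) / 2) ltac:(lra)) as [d [Hd H]].
  specialize (H l0 (tau l0)). rewrite !Rminus_diag, Rabs_R0 in H. specialize (H Hd Hd).
  specialize (HFm l0). rewrite Rminus_diag, Rabs_R0 in HFm. specialize (HFm Hrho (tau l0)).
  apply Rabs_le_between in H. lra. }
assert (Hz0 : z l0 (tau l0) = b) by (apply Hb; rewrite Rminus_diag, Rabs_R0; easy).
(* A Lipschitz constant of [tau] at [l0], obtained from the lower bound on the speed. It shows that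
   the intermediate time of the mean value theorem is close to [tau l0], although continuity of
   [tau] is not assumed. *)
set (k := (Rabs xi + 1) / m).
assert (Hk : 0 < k).
{ unfold k. apply Rdiv_lt_0_compat; [|easy]. assert (H := Rabs_pos xi); lra. }
apply is_derive_epsP. intros eps He.
set (e := Rmin 1 (eps * m / (k + 1))).
assert (He0 : 0 < e).
{ apply Rmin_glb_lt; [lra|]. apply Rdiv_lt_0_compat; nra. }
assert (He1 : e <= 1) by apply Rmin_l.
assert (He2 : e * (k + 1) <= eps * m).
{ apply Rmult_le_reg_r with (/ (k + 1)); [apply Rinv_0_lt_compat; lra|].
  rewrite Rmult_assoc, Rinv_r by lra. rewrite Rmult_1_r. apply Rmin_r. }
destruct (HF e He0) as [d1 [Hd1 H1]].
destruct (proj1 (is_derive_epsP _ _ _) Hxi e He0) as [d2 [Hd2 H2]].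
exists (Rmin (Rmin rho d1) (Rmin d2 (d1 / k))).
split; [repeat apply Rmin_glb_lt; try easy; now apply Rdiv_lt_0_compat|].
intros l Hl.
apply Rmin_Rgt_l in Hl. destruct Hl as [Hl Hl'].
apply Rmin_Rgt_l in Hl. destruct Hl as [Hl0 Hl1].
apply Rmin_Rgt_l in Hl'. destruct Hl' as [Hl2 Hl3].
specialize (H2 l Hl2). cbv beta in H2. rewrite Hz0 in H2.
destruct (mean_value_between (z l) (F l) (tau l0) (tau l) (fun w _ => Hz l Hl0 w))
  as [w [Hw E]].
rewrite (Hb l Hl0) in E. specialize (HFm l Hl0 w).
set (h := Rabs (l - l0)) in *. assert (Hh : 0 <= h) by apply Rabs_pos.
set (D := tau l - tau l0) in *.
assert (HD : Rabs D <= k * h).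
{ apply Rmult_le_reg_l with m; [easy|].
  apply Rle_trans with (Rabs (F l w * D)).
  - rewrite Rabs_mult. apply Rmult_le_compat_r; [apply Rabs_pos|].
    eapply Rle_trans; [apply HFm|apply Rle_abs].
  - rewrite <- E, <- Rabs_Ropp.
    replace (- (b - z l (tau l0))) with ((z l (tau l0) - b - xi * (l - l0)) + xi * (l - l0)) by ring.
    eapply Rle_trans; [apply Rabs_triang|]. rewrite Rabs_mult. fold h.
    replace (m * (k * h)) with ((Rabs xi + 1) * h) by (unfold k; field; lra). nra. }
assert (Hwd : Rabs (w - tau l0) < d1).
{ apply Rle_lt_trans with (Rabs D).
  - unfold D. unfold Rmin, Rmax in Hw. destruct (Rle_dec (tau l0) (tau l)) in Hw.
    + rewrite !Rabs_pos_eq by lra. lra.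
    + rewrite !Rabs_left1 by lra. lra.
  - eapply Rle_lt_trans; [apply HD|]. apply Rmult_lt_reg_r with (/ k).
    + now apply Rinv_0_lt_compat.
    + replace (k * h * / k) with h by (field; lra). easy. }
specialize (H1 l w Hl1 Hwd).
apply Rmult_le_reg_l with c; [lra|].
rewrite <- (Rabs_pos_eq c) at 1 by lra. rewrite <- Rabs_mult.
replace (c * (D - - xi / c * (l - l0))) with
  (- (z l (tau l0) - b - xi * (l - l0)) + - ((F l w - c) * D))
  by (transitivity (c * D + xi * (l - l0)); [ring_simplify; lra|field; lra]).
eapply Rle_trans; [apply Rabs_triang|]. rewrite !Rabs_Ropp, Rabs_mult.
apply Rle_trans with (e * h + e * (k * h)).
- apply Rplus_le_compat; [easy|]. apply Rmult_le_compat; try apply Rabs_pos; easy.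
- assert (0 <= eps * h) by (apply Rmult_le_pos; lra). nra.
Qed.

(** * Estimates on f and g *)

Lemma lipschitz_of_derive (f df : R -> R) (M lo hi : R) :
  (forall u, lo < u < hi -> is_derive f u (df u)) ->
  (forall u, lo < u < hi -> Rabs (df u) <= M) ->
  forall u w, lo < u < hi -> lo < w < hi -> Rabs (f u - f w) <= M * Rabs (u - w).
Proof.
intros Hd Hb u w Hu Hw.
assert (HI : forall s, Rmin w u <= s <= Rmax w u -> lo < s < hi).
{ intros s Hs. unfold Rmin, Rmax in Hs. destruct (Rle_dec w u) in Hs; lra. }
destruct (mean_value_between f df w u) as [c [Hc E]].
- intros s Hs. apply Hd. now apply HI.
- rewrite E, Rabs_mult. apply Rmult_le_compat_r; [apply Rabs_pos|]. apply Hb. now apply HI.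
Qed.

(** The derivative of k / u is (u k' - k) / u^2. Its numerator vanishes at 0 and has derivative u
    k'', so the mean value theorem bounds it without the integral form of Hadamard's lemma. *)
Lemma quotient_lipschitz (k k1 k2 : R -> R) (M eps : R) :
  k 0 = 0 ->
  (forall u, 0 <= u < eps -> is_derive k u (k1 u) /\ is_derive k1 u (k2 u)) ->
  (forall u, 0 <= u < eps -> Rabs (k2 u) <= M) ->
  forall u w, 0 < u < eps -> 0 < w < eps ->
    Rabs (k u / u - k w / w) <= M * Rabs (u - w).
Proof.
intros H0 Hd Hb.
apply (lipschitz_of_derive (fun u => k u / u) (fun u => (u * k1 u - k u) / u ^ 2)).
- intros u Hu. destruct (Hd u ltac:(lra)) as [D _].
  auto_derive; [split; [now exists (k1 u)|split; [lra|easy]]|].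
  replace (Derive (fun x : R => k x) u) with (k1 u) by (symmetry; now apply is_derive_unique).
  field; lra.
- intros u Hu.
  destruct (mean_value (fun u => u * k1 u - k u) (fun u => u * k2 u) 0 u) as [c [Hc E]].
  + lra.
  + intros s Hs. destruct (Hd s ltac:(lra)) as [D1 D2].
    auto_derive; [split; [now exists (k2 s)|split; [now exists (k1 s)|easy]]|].
    replace (Derive (fun x : R => k x) s) with (k1 s) by (symmetry; now apply is_derive_unique).
    replace (Derive (fun x : R => k1 x) s) with (k2 s) by (symmetry; now apply is_derive_unique).
    ring.
  + rewrite H0 in E. replace (u * k1 u - k u) with (c * k2 c * u) by lra.
    replace (c * k2 c * u / u ^ 2) with (c / u * k2 c) by (field; lra).
    rewrite Rabs_mult. specialize (Hb c ltac:(lra)).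
    assert (Hcu : 0 <= c / u <= 1).
    { split; [apply Rdiv_le_0_compat; lra|]. apply Rmult_le_reg_r with u; [lra|].
      unfold Rdiv. rewrite Rmult_assoc, Rinv_l; lra. }
    rewrite (Rabs_pos_eq (c / u)) by lra.
    assert (A := Rabs_pos (k2 c)). nra.
Qed.

(** The same device one order higher: the second derivative of h / u has denominator u^3 and a
    numerator whose derivative is u^2 h'''. *)
Lemma quotient_derive_lipschitz (h h1 h2 h3 : R -> R) (M eps : R) :
  h 0 = 0 ->
  (forall u, 0 <= u < eps ->
     is_derive h u (h1 u) /\ is_derive h1 u (h2 u) /\ is_derive h2 u (h3 u)) ->
  (forall u, 0 <= u < eps -> Rabs (h3 u) <= M) ->
  forall u w, 0 < u < eps -> 0 < w < eps ->
    Rabs ((h1 u / u - h u / u ^ 2) - (h1 w / w - h w / w ^ 2)) <= M * Rabs (u - w).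
Proof.
intros H0 Hd Hb.
apply (lipschitz_of_derive (fun u => h1 u / u - h u / u ^ 2)
  (fun u => (u ^ 2 * h2 u - 2 * u * h1 u + 2 * h u) / u ^ 3)).
- intros u Hu. destruct (Hd u ltac:(lra)) as [D1 [D2 _]].
  assert (u * (u * 1) <> 0) by (apply Rmult_integral_contrapositive; split; lra).
  auto_derive.
  + repeat split; try easy; try lra; [now exists (h2 u)|now exists (h1 u)].
  + replace (Derive (fun x : R => h x) u) with (h1 u) by (symmetry; now apply is_derive_unique).
    replace (Derive (fun x : R => h1 x) u) with (h2 u) by (symmetry; now apply is_derive_unique).
    field; lra.
- intros u Hu.
  destruct (mean_value (fun u => u ^ 2 * h2 u - 2 * u * h1 u + 2 * h u)
    (fun u => u ^ 2 * h3 u) 0 u) as [c [Hc E]].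
  + lra.
  + intros s Hs. destruct (Hd s ltac:(lra)) as [D1 [D2 D3]].
    auto_derive.
    * repeat split; try easy; [now exists (h3 s)|now exists (h2 s)|now exists (h1 s)].
    * replace (Derive (fun x : R => h x) s) with (h1 s) by (symmetry; now apply is_derive_unique).
      replace (Derive (fun x : R => h1 x) s) with (h2 s) by (symmetry; now apply is_derive_unique).
      replace (Derive (fun x : R => h2 x) s) with (h3 s) by (symmetry; now apply is_derive_unique).
      ring.
  + rewrite H0 in E.
    replace (u ^ 2 * h2 u - 2 * u * h1 u + 2 * h u) with (c ^ 2 * h3 c * u) by lra.
    replace (c ^ 2 * h3 c * u / u ^ 3) with ((c / u) ^ 2 * h3 c) by (field; lra).
    rewrite Rabs_mult. specialize (Hb c ltac:(lra)).
    assert (Hcu : 0 <= c / u <= 1).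
    { split; [apply Rdiv_le_0_compat; lra|]. apply Rmult_le_reg_r with u; [lra|].
      unfold Rdiv. rewrite Rmult_assoc, Rinv_l; lra. }
    rewrite (Rabs_pos_eq ((c / u) ^ 2)) by apply pow2_ge_0.
    assert (A := Rabs_pos (h3 c)).
    assert ((c / u) ^ 2 <= 1) by nra. nra.
Qed.

(* The bounds on [fu] and [fv] interpolate between [f = O(r^2)] and the
   Lipschitz bounds on [fu], [fv], with a step of length [r = u + v]. *)
Lemma quotient_estimates (F Fu Fuu Fuuu Fv Fuv Fuuv Fvv Fuvv : R -> R -> R)
  (K M eps : R) :
  0 <= K -> 0 <= M ->
  (forall u v, 0 <= u < eps -> 0 <= v < eps ->
     is_derive (fun x => F x v) u (Fu u v) /\
     is_derive (fun x => Fu x v) u (Fuu u v) /\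
     is_derive (fun x => Fuu x v) u (Fuuu u v) /\
     is_derive (fun x => F u x) v (Fv u v) /\
     is_derive (fun x => Fv x v) u (Fuv u v) /\
     is_derive (fun x => Fuv x v) u (Fuuv u v) /\
     is_derive (fun x => Fv u x) v (Fvv u v) /\
     is_derive (fun x => Fvv x v) u (Fuvv u v)) ->
  (forall u v, 0 <= u < eps -> 0 <= v < eps ->
     Rabs (Fuuu u v) <= M /\ Rabs (Fuuv u v) <= M /\ Rabs (Fuvv u v) <= M) ->
  (forall v, 0 <= v < eps -> F 0 v = 0 /\ Fv 0 v = 0 /\ Fvv 0 v = 0) ->
  let f u v := F u v / u - u - v in
  let fu u v := Fu u v / u - F u v / u ^ 2 - 1 in
  let fv u v := Fv u v / u - 1 in
  (forall u v, 0 < u < eps -> 0 < v < eps -> Rabs (f u v) <= K * (u ^ 2 + v ^ 2)) ->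
  forall u v, 0 < u < eps / 3 -> 0 < v < eps / 3 ->
    Rabs (fu u v) <= (6 * K + M) * (u + v) /\
    Rabs (fv u v) <= (6 * K + M) * (u + v) /\
    forall u0 v0, 0 < u0 < eps / 3 -> 0 < v0 < eps / 3 ->
      Rabs (f u v - f u0 v0 - fu u0 v0 * (u - u0) - fv u0 v0 * (v - v0))
      <= M * (Rabs (u - u0) + Rabs (v - v0)) ^ 2.
Proof.
intros HK HM Hd Hb H0 f fu fv Hf.
assert (Lu : forall v u w, 0 < v < eps -> 0 < u < eps -> 0 < w < eps ->
  Rabs (fu u v - fu w v) <= M * Rabs (u - w)).
{ intros v u w Hv Hu Hw. unfold fu.
  replace (Fu u v / u - F u v / u ^ 2 - 1 - (Fu w v / w - F w v / w ^ 2 - 1)) with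
   ((Fu u v / u - F u v / u ^ 2) - (Fu w v / w - F w v / w ^ 2)) by ring.
  apply (quotient_derive_lipschitz (fun u => F u v) (fun u => Fu u v) (fun u => Fuu u v)
    (fun u => Fuuu u v) M eps); try easy.
  - apply H0; lra.
  - intros x Hx. destruct (Hd x v Hx ltac:(lra)) as [? [? [? _]]]. easy.
  - intros x Hx. apply (Hb x v); lra. }
assert (Lvu : forall v u w, 0 < v < eps -> 0 < u < eps -> 0 < w < eps ->
  Rabs (fv u v - fv w v) <= M * Rabs (u - w)).
{ intros v u w Hv Hu Hw. unfold fv.
  replace (Fv u v / u - 1 - (Fv w v / w - 1)) with (Fv u v / u - Fv w v / w) by ring.
  apply (quotient_lipschitz (fun u => Fv u v) (fun u => Fuv u v) (fun u => Fuuv u v) M eps);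
    try easy.
  - apply H0; lra.
  - intros x Hx. destruct (Hd x v Hx ltac:(lra)) as [_ [_ [_ [_ [? [? _]]]]]]. easy.
  - intros x Hx. apply (Hb x v); lra. }
assert (Lvv : forall u v w, 0 < u < eps -> 0 < v < eps -> 0 < w < eps ->
  Rabs (fv u v - fv u w) <= M * Rabs (v - w)).
{ intros u v w Hu. revert v w.
  apply (lipschitz_of_derive (fun v => fv u v) (fun v => Fvv u v / u)).
  - intros v Hv. destruct (Hd u v ltac:(lra) ltac:(lra)) as [_ [_ [_ [_ [_ [_ [D _]]]]]]].
    unfold fv. auto_derive; [repeat split; now exists (Fvv u v)|].
    replace (Derive (fun x : R => Fv u x) v) with (Fvv u v)
      by (symmetry; now apply is_derive_unique).
    field; lra.
  - intros v Hv.
    destruct (mean_value (fun u => Fvv u v) (fun u => Fuvv u v) 0 u) as [c [Hc E]]; [lra| |].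
    + intros s Hs. destruct (Hd s v ltac:(lra) ltac:(lra)) as [_ [_ [_ [_ [_ [_ [_ D]]]]]]].
      exact D.
    + rewrite (proj2 (proj2 (H0 v ltac:(lra)))) in E.
      replace (Fvv u v / u) with (Fuvv c v)
        by (replace (Fvv u v) with (Fuvv c v * u) by lra; field; lra).
      apply (Hb c v); lra. }
assert (Du : forall u v, 0 < u < eps -> 0 < v < eps ->
  is_derive (fun x => f x v) u (fu u v)).
{ intros u v Hu Hv. destruct (Hd u v ltac:(lra) ltac:(lra)) as [D _].
  unfold f, fu. auto_derive; [split; [now exists (Fu u v)|split; [lra|easy]]|].
  replace (Derive (fun x : R => F x v) u) with (Fu u v)
      by (symmetry; now apply is_derive_unique).
  field; lra. }
assert (Dv : forall u v, 0 < u < eps -> 0 < v < eps ->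
  is_derive (fun x => f u x) v (fv u v)).
{ intros u v Hu Hv. destruct (Hd u v ltac:(lra) ltac:(lra)) as [_ [_ [_ [D _]]]].
  unfold f, fv. auto_derive; [repeat split; now exists (Fv u v)|].
  replace (Derive (fun x : R => F u x) v) with (Fv u v)
      by (symmetry; now apply is_derive_unique).
  field; lra. }
(* The step is r = u + v. At the shifted points (2 u + v, v) and (u, u + 2 v), which stay in the box
   because u and v are below eps / 3, the bound on f is at most 5 K r^2. *)
assert (Interp : forall (p dp : R -> R) w r, 0 < r ->
  (forall x, w <= x <= w + r -> is_derive p x (dp x)) ->
  (forall x, w <= x <= w + r -> Rabs (dp x - dp w) <= M * Rabs (x - w)) ->
  Rabs (p w) <= K * r ^ 2 -> Rabs (p (w + r)) <= 5 * K * r ^ 2 ->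
  Rabs (dp w) <= (6 * K + M) * r).
{ intros p dp w r Hr Hp Hl B1 B2.
  destruct (mean_value p dp w (w + r)) as [c [Hc E]]; [lra|easy|].
  specialize (Hl c Hc). rewrite (Rabs_pos_eq (c - w)) in Hl by lra.
  replace (w + r - w) with r in E by ring.
  apply Rabs_le_between in B1. apply Rabs_le_between in B2. apply Rabs_le_between in Hl.
  assert (M * (c - w) <= M * r) by (apply Rmult_le_compat_l; lra).
  assert (Hcr : - (6 * K * r) <= dp c <= 6 * K * r).
  { split; apply Rmult_le_reg_r with r; lra. }
  apply Rabs_le. lra. }
intros u v Hu Hv.
assert (HKr : 0 <= K * (u * v)) by (apply Rmult_le_pos; nra).
assert (HKu : 0 <= K * (u * u)) by (apply Rmult_le_pos; nra).
assert (HKv : 0 <= K * (v * v)) by (apply Rmult_le_pos; nra).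
split; [|split].
- apply (Interp (fun x => f x v) (fun x => fu x v) u (u + v)); [lra| | | |].
  + intros x Hx. apply Du; lra.
  + intros x Hx. apply Lu; lra.
  + eapply Rle_trans; [apply Hf; lra|]. nra.
  + eapply Rle_trans; [apply Hf; lra|]. nra.
- apply (Interp (fun x => f u x) (fun x => fv u x) v (u + v)); [lra| | | |].
  + intros x Hx. apply Dv; lra.
  + intros x Hx. apply Lvv; lra.
  + eapply Rle_trans; [apply Hf; lra|]. nra.
  + eapply Rle_trans; [apply Hf; lra|]. nra.
- intros u0 v0 Hu0 Hv0.
  assert (Hbt : forall x y z, 0 < x < eps -> 0 < y < eps -> Rmin x y <= z <= Rmax x y ->
    0 < z < eps /\ Rabs (z - x) <= Rabs (y - x)).
  { intros x y z Hx Hy Hz. unfold Rmin, Rmax in Hz.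
    destruct (Rle_dec x y) in Hz; split; try lra.
    - rewrite !Rabs_pos_eq; lra.
    - rewrite !Rabs_left1; lra. }
  (* The increment of f is split at the corner (u, v0): first along u at height v0, then along v.
     The estimate [Lvu] compares [fv] at the corner with [fv] at the base point. *)
  destruct (mean_value_between (fun x => f x v0) (fun x => fu x v0) u0 u) as [c [Hc Ec]].
  { intros s Hs. destruct (Hbt u0 u s ltac:(lra) ltac:(lra) Hs). apply Du; lra. }
  destruct (mean_value_between (fun x => f u x) (fun x => fv u x) v0 v) as [d [Hcd Ed]].
  { intros s Hs. destruct (Hbt v0 v s ltac:(lra) ltac:(lra) Hs). apply Dv; lra. }
  apply Hbt in Hc; [|lra|lra]. apply Hbt in Hcd; [|lra|lra].
  destruct Hc as [Hc1 Hc2]. destruct Hcd as [Hd1 Hd2].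
  assert (L1 := Lu v0 c u0 ltac:(lra) Hc1 ltac:(lra)).
  assert (L2 := Lvv u d v0 ltac:(lra) Hd1 ltac:(lra)).
  assert (L3 := Lvu v0 u u0 ltac:(lra) ltac:(lra) ltac:(lra)).
  replace (f u v - f u0 v0 - fu u0 v0 * (u - u0) - fv u0 v0 * (v - v0)) with
   ((fu c v0 - fu u0 v0) * (u - u0) + ((fv u d - fv u v0) + (fv u v0 - fv u0 v0)) * (v - v0))
   by lra.
  eapply Rle_trans; [apply Rabs_triang|]. rewrite !Rabs_mult.
  assert (T := Rabs_triang (fv u d - fv u v0) (fv u v0 - fv u0 v0)).
  set (x := Rabs (u - u0)) in *. set (y := Rabs (v - v0)) in *.
  assert (Hx : 0 <= x) by apply Rabs_pos. assert (Hy : 0 <= y) by apply Rabs_pos.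
  assert (M * Rabs (c - u0) <= M * x) by (now apply Rmult_le_compat_l).
  assert (M * Rabs (d - v0) <= M * y) by (now apply Rmult_le_compat_l).
  apply Rle_trans with (M * x * x + (M * y + M * x) * y).
  + apply Rplus_le_compat; apply Rmult_le_compat_r; lra.
  + assert (0 <= M * (x * y)) by (apply Rmult_le_pos; nra). nra.
Qed.

(** * Uniform bounds by compactness and periodicity *)

Lemma bounded_on_box (G : pt -> R) (a b c : R) :
  (forall u v t, 0 <= u <= a -> 0 <= v <= b -> 0 <= t <= c -> continuous G (u, v, t)) ->
  exists M, forall u v t, 0 <= u <= a -> 0 <= v <= b -> 0 <= t <= c ->
    Rabs (G (u, v, t)) <= M.
Proof.
intros Hc.
set (g := fun x : Compactness.Tn 3 R => G (fst x, fst (snd x), fst (snd (snd x)))).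
set (lo := (0, (0, (0, tt))) : Compactness.Tn 3 R).
set (hi := (a, (b, (c, tt))) : Compactness.Tn 3 R).
(* The gauge is made smaller than the inverse of |g x| + 1. A positive lower bound of the gauge,
   provided by [compactness_value], is then an upper bound on g. *)
assert (Hd : forall x, exists d : posreal, bounded_n 3 lo hi x ->
  (forall y, close_n 3 d y x -> Rabs (g y) <= Rabs (g x) + 1) /\ d <= / (Rabs (g x) + 1)).
{ intros [u [v [t []]]].
  assert (Hpos : 0 < / (Rabs (G (u, v, t)) + 1)).
  { apply Rinv_0_lt_compat. assert (H := Rabs_pos (G (u, v, t))). lra. }
  destruct (Classical_Prop.classic (bounded_n 3 lo hi (u, (v, (t, tt))))) as [HB|HB];
    [|exists (mkposreal 1 Rlt_0_1); easy].
  simpl in HB. destruct HB as [Hu [Hv [Ht _]]].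
  destruct (proj1 (filterlim_locally _ _) (Hc u v t Hu Hv Ht) (mkposreal 1 Rlt_0_1)) as [d Hd].
  exists (mkposreal _ (Rmin_pos _ _ (cond_pos d) Hpos)). intros _. split.
  - intros [u' [v' [t' []]]]. simpl. intros [A [B [C _]]]. unfold g; simpl.
    specialize (Hd (u', v', t')).
    assert (HB : ball (u, v, t) d (u', v', t')).
    { split; [split|]; simpl; eapply Rlt_le_trans; try apply Rmin_l; eassumption. }
    specialize (Hd HB).
    replace (G (u', v', t')) with ((G (u', v', t') - G (u, v, t)) + G (u, v, t)) by ring.
    eapply Rle_trans; [apply Rabs_triang|].
    assert (Rabs (G (u', v', t') - G (u, v, t)) < 1) by exact Hd. lra.
  - simpl. apply Rmin_r. }
apply functional_choice in Hd. destruct Hd as [delta Hdelta].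
destruct (compactness_value 3 lo hi delta) as [d Hd].
exists (/ d + 1). intros u v t Hu Hv Ht.
apply Rnot_lt_le. intros Hlt.
apply (Hd (u, (v, (t, tt)))); [now simpl|].
intros [x [Hx [Hcl Hdx]]].
destruct (Hdelta x Hx) as [H1 H2].
specialize (H1 _ Hcl). unfold g at 1 in H1. simpl in H1.
assert (Hgx : 0 < Rabs (g x) + 1) by (assert (H := Rabs_pos (g x)); lra).
assert (Hle : d <= / (Rabs (g x) + 1)) by lra.
assert (Rabs (g x) + 1 <= / d).
{ rewrite <- (Rinv_inv (Rabs (g x) + 1)). apply Rinv_le_contravar; [apply cond_pos|easy]. }
lra.
Qed.

Lemma Ck_continuous (k : nat) (W : pt -> Prop) (F : R -> R -> R -> R) (u v t : R) :
  Ck k W F -> W (u, v, t) ->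
  continuous (fun p : pt => F (fst (fst p)) (snd (fst p)) (snd p)) (u, v, t).
Proof. destruct k; intros [H _]; apply H. Qed.

Lemma Ck_partials (k : nat) (W : pt -> Prop) (F : R -> R -> R -> R) :
  Ck (S k) W F ->
  Ck k W (fun u v t => Derive (fun x => F x v t) u) /\
  Ck k W (fun u v t => Derive (fun x => F u x t) v) /\
  forall u v t, W (u, v, t) ->
    is_derive (fun x => F x v t) u (Derive (fun x => F x v t) u) /\
    is_derive (fun x => F u x t) v (Derive (fun x => F u x t) v).
Proof.
intros [_ [H1 [H2 [H3 _]]]]. split; [easy|split; [easy|]].
intros u v t Hw. destruct (H1 u v t Hw) as [A [B _]].
split; now apply Derive_correct.
Qed.

(** Exchanging the coordinates and the sign turns [field_v g] into a field of the form [field_u], so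
    that g inherits the estimates proved for f. *)
Lemma Ck_swap_opp (W W' : pt -> Prop) :
  (forall u v t, W' (u, v, t) -> W (v, u, t)) ->
  forall k F, Ck k W F -> Ck k W' (fun u v t => - F v u t).
Proof.
intros HW.
assert (Hcont : forall F, (forall u v t, W (u, v, t) ->
    continuous (fun p : pt => F (fst (fst p)) (snd (fst p)) (snd p)) (u, v, t)) ->
  forall u v t, W' (u, v, t) ->
    continuous (fun p : pt => - F (snd (fst p)) (fst (fst p)) (snd p)) (u, v, t)).
{ intros F HF u v t Hw.
  apply (continuous_opp (fun p : pt => F (snd (fst p)) (fst (fst p)) (snd p))).
  apply (continuous_comp (fun p : pt => (snd (fst p), fst (fst p), snd p) : pt)
    (fun p : pt => F (fst (fst p)) (snd (fst p)) (snd p))).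
  - apply filterlim_locally. intros e. exists e. intros [[u' v'] t'] [[A B] C].
    split; [split|]; easy.
  - apply HF. now apply HW. }
induction k as [|k IH]; intros F HF.
- destruct HF as [HF _]. split; [|easy]. now apply Hcont.
- destruct HF as [H0 [H1 [H2 [H3 H4]]]]. split; [now apply Hcont|split; [|split; [|split]]].
  + intros u v t Hw. destruct (H1 v u t (HW _ _ _ Hw)) as [A [B C]].
    split; [|split].
    * now apply (ex_derive_opp (fun x => F v x t)).
    * now apply (ex_derive_opp (fun x => F x u t)).
    * now apply (ex_derive_opp (fun x => F v u x)).
  + replace (fun u v t => Derive (fun x => - F v x t) u) with
      (fun u v t => - Derive (fun x => F v x t) u); [apply (IH _ H3)|].
    do 3 (apply functional_extensionality; intro). symmetry. apply Derive_opp.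
  + replace (fun u v t => Derive (fun x => - F x u t) v) with
      (fun u v t => - Derive (fun x => F x u t) v); [apply (IH _ H2)|].
    do 3 (apply functional_extensionality; intro). symmetry. apply Derive_opp.
  + replace (fun u v t => Derive (fun x => - F v u x) t) with
      (fun u v t => - Derive (fun x => F v u x) t); [apply (IH _ H4)|].
    do 3 (apply functional_extensionality; intro). symmetry. apply Derive_opp.
Qed.

Lemma periodic_IZR (h : R -> R) (T : R) :
  (forall t, h (t + T) = h t) -> forall (n : Z) t, h (t + IZR n * T) = h t.
Proof.
intros H.
assert (Hn : forall (n : nat) t, h (t + INR n * T) = h t).
{ induction n as [|n IH]; intros t.
  - simpl. f_equal; ring.
  - rewrite S_INR. replace (t + (INR n + 1) * T) with (t + INR n * T + T) by ring.
    now rewrite H. }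
intros n t. destruct (Z.le_gt_cases 0 n) as [Hz|Hz].
- rewrite <- (Z2Nat.id n Hz), <- INR_IZR_INZ. apply Hn.
- rewrite <- (Hn (Z.to_nat (- n)) (t + IZR n * T)).
  rewrite INR_IZR_INZ, Z2Nat.id, opp_IZR by lia. f_equal; ring.
Qed.

Lemma reduce_mod_period (T t : R) :
  0 < T -> exists n : Z, 0 <= t + IZR n * T <= T.
Proof.
intros HT. destruct (archimed (t / T)) as [H1 H2].
exists (1 - up (t / T))%Z. rewrite minus_IZR.
replace t with (t / T * T) at 1 3 by (field; lra). nra.
Qed.

(** Curves are confined to the open box, since f is recovered only where u is nonzero; composing
    with exponentials yields [curve_continuous]. *)
Definition box_continuous (eps : R) (F : R -> R -> R -> R) : Prop :=
  forall (X Y T : R -> R) (s : R), continuous X s -> continuous Y s -> continuous T s ->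
    0 < X s < eps -> 0 < Y s < eps -> continuous (fun w => F (X w) (Y w) (T w)) s.

(** All that the sequel uses of f. The partial derivatives enter only through a Taylor bound of
    order two, uniform in t, which is the form needed by [derive_transport]. *)
Definition regular (eps K M : R) (f fu fv : R -> R -> R -> R) : Prop :=
  (box_continuous eps f /\ box_continuous eps fu /\ box_continuous eps fv) /\
  forall u v t, 0 < u < eps -> 0 < v < eps ->
    Rabs (f u v t) <= K * (u + v) ^ 2 /\
    Rabs (fu u v t) <= K * (u + v) /\
    Rabs (fv u v t) <= K * (u + v) /\
    forall u0 v0, 0 < u0 < eps -> 0 < v0 < eps ->
      Rabs (f u v t - f u0 v0 t - fu u0 v0 t * (u - u0) - fv u0 v0 t * (v - v0))
      <= M * (Rabs (u - u0) + Rabs (v - v0)) ^ 2.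

Lemma regular_weaken (eps eps' K K' M M' : R) (f fu fv : R -> R -> R -> R) :
  eps' <= eps -> K <= K' -> M <= M' ->
  regular eps K M f fu fv -> regular eps' K' M' f fu fv.
Proof.
intros He HK HM [[C1 [C2 C3]] H].
assert (HC : forall F, box_continuous eps F -> box_continuous eps' F).
{ intros F HF X Y T s HX HY HT H1 H2. apply HF; try easy; lra. }
split; [split; [|split]; now apply HC|].
intros u v t Hu Hv. destruct (H u v t ltac:(lra) ltac:(lra)) as [B1 [B2 [B3 B4]]].
split; [|split; [|split]].
- eapply Rle_trans; [apply B1|]. apply Rmult_le_compat_r; [apply pow2_ge_0|easy].
- eapply Rle_trans; [apply B2|]. apply Rmult_le_compat_r; lra.
- eapply Rle_trans; [apply B3|]. apply Rmult_le_compat_r; lra.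
- intros u0 v0 Hu0 Hv0. eapply Rle_trans; [apply B4; lra|].
  apply Rmult_le_compat_r; [apply pow2_ge_0|easy].
Qed.

Lemma regular_swap (eps K M : R) (f fu fv : R -> R -> R -> R) :
  regular eps K M f fu fv ->
  regular eps K M (fun u v t => f v u t) (fun u v t => fv v u t) (fun u v t => fu v u t).
Proof.
intros [[C1 [C2 C3]] H].
assert (HC : forall F, box_continuous eps F -> box_continuous eps (fun u v t => F v u t)).
{ intros F HF X Y T s HX HY HT H1 H2. now apply HF. }
split; [split; [|split]; now apply HC|].
intros u v t Hu Hv. destruct (H v u t Hv Hu) as [B1 [B2 [B3 B4]]].
rewrite (Rplus_comm u v). split; [|split; [|split]]; try easy.
intros u0 v0 Hu0 Hv0. specialize (B4 v0 u0 Hv0 Hu0).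
rewrite (Rplus_comm (Rabs (u - u0))).
replace (f v u t - f v0 u0 t - fv v0 u0 t * (u - u0) - fu v0 u0 t * (v - v0)) with
  (f v u t - f v0 u0 t - fu v0 u0 t * (v - v0) - fv v0 u0 t * (u - u0)) by ring.
exact B4.
Qed.

Lemma continuous_along_curve (F : R -> R -> R -> R) (X Y T : R -> R) (s : R) :
  continuous (fun p : pt => F (fst (fst p)) (snd (fst p)) (snd p)) (X s, Y s, T s) ->
  continuous X s -> continuous Y s -> continuous T s ->
  continuous (fun w => F (X w) (Y w) (T w)) s.
Proof.
intros HF HX HY HT.
apply (continuous_comp_2 (fun w => (X w, Y w)) T (fun p t => F (fst p) (snd p) t)); try easy.
apply (continuous_comp_2 X Y (fun x y => (x, y))); try easy.
apply continuous_ext with (fun p : R * R => p); [now intros []|apply continuous_id].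
Qed.

(** The function f is recovered as F / u - u - v from the smooth field F, which vanishes at u = 0.
    The third derivatives of F are bounded on the closed square of side e / 2 over one period, and
    [quotient_estimates] keeps a third of that side. *)
Lemma regular_of_smooth (D : R * R -> Prop) (f : R -> R -> R -> R) (e K : R) :
  0 < e -> 0 <= K ->
  (forall u v, Rabs u < e -> Rabs v < e -> D (u, v)) ->
  smooth_on (cyl D) (field_u f) -> periodic_t D f ->
  (forall u v t, Rabs u < e -> Rabs v < e -> Rabs (f u v t) <= K * (u ^ 2 + v ^ 2)) ->
  exists fu fv K' M, 0 <= K' /\ 0 <= M /\ regular (e / 6) K' M f fu fv.
Proof.
intros He HK HD Hs Hper Hf.
set (F := field_u f).
set (Fu := fun u v t => Derive (fun x => F x v t) u).
set (Fuu := fun u v t => Derive (fun x => Fu x v t) u).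
set (Fuuu := fun u v t => Derive (fun x => Fuu x v t) u).
(* The derivatives in v are taken before those in u. Each quotient by u then concerns a function
   that vanishes at u = 0 together with its derivatives in u, and no exchange of partial derivatives
   occurs. *)
set (Fv := fun u v t => Derive (fun x => F u x t) v).
set (Fuv := fun u v t => Derive (fun x => Fv x v t) u).
set (Fuuv := fun u v t => Derive (fun x => Fuv x v t) u).
set (Fvv := fun u v t => Derive (fun x => Fv u x t) v).
set (Fuvv := fun u v t => Derive (fun x => Fvv x v t) u).
assert (C0 : Ck 3 (cyl D) F) by apply Hs.
destruct (Ck_partials 2 _ _ C0) as [Cu [Cv D0]]. fold Fu in Cu. fold Fv in Cv.
destruct (Ck_partials 1 _ _ Cu) as [Cuu [_ Du]]. fold Fuu in Cuu.
destruct (Ck_partials 0 _ _ Cuu) as [Cuuu [_ Duu]]. fold Fuuu in Cuuu.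
destruct (Ck_partials 1 _ _ Cv) as [Cuv [Cvv Dv]]. fold Fuv in Cuv. fold Fvv in Cvv.
destruct (Ck_partials 0 _ _ Cuv) as [Cuuv [_ Duv]]. fold Fuuv in Cuuv.
destruct (Ck_partials 0 _ _ Cvv) as [Cuvv [_ Dvv]]. fold Fuvv in Cuvv.
assert (HW : forall u v t, 0 <= u <= e / 2 -> 0 <= v <= e / 2 -> cyl D (u, v, t)).
{ intros u v t Hu Hv. apply HD; simpl; rewrite Rabs_pos_eq; lra. }
assert (Hbd : forall G, Ck 0 (cyl D) G -> exists M, forall u v t,
  0 <= u <= e / 2 -> 0 <= v <= e / 2 -> 0 <= t <= 2 * PI -> Rabs (G u v t) <= M).
{ intros G HG.
  apply (bounded_on_box (fun p => G (fst (fst p)) (snd (fst p)) (snd p)) (e / 2) (e / 2) (2 * PI)).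
  intros u v t Hu Hv _. apply (Ck_continuous 0 (cyl D) G u v t HG). now apply HW. }
destruct (Hbd _ Cuuu) as [M1 B1]. destruct (Hbd _ Cuuv) as [M2 B2].
destruct (Hbd _ Cuvv) as [M3 B3].
set (M := Rmax 0 (Rmax M1 (Rmax M2 M3))).
assert (HM : 0 <= M) by apply Rmax_l.
assert (HM1 : M1 <= M) by (eapply Rle_trans; [apply Rmax_l|apply Rmax_r]).
assert (HM' : Rmax M2 M3 <= M) by (eapply Rle_trans; [apply Rmax_r|apply Rmax_r]).
assert (HM2 : M2 <= M) by (eapply Rle_trans; [apply Rmax_l|apply HM']).
assert (HM3 : M3 <= M) by (eapply Rle_trans; [apply Rmax_r|apply HM']).
set (fu := fun u v t => Fu u v t / u - F u v t / u ^ 2 - 1).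
set (fv := fun u v t => Fv u v t / u - 1).
assert (Ef : forall u v t, 0 < u -> F u v t / u - u - v = f u v t).
{ intros u v t Hu. unfold F, field_u. field; lra. }
assert (F0 : forall v t, F 0 v t = 0) by (intros; unfold F, field_u; ring).
assert (Fv0 : forall v t, Fv 0 v t = 0).
{ intros v t. unfold Fv. rewrite (Derive_ext _ (fun _ => 0)); [apply Derive_const|easy]. }
assert (Fvv0 : forall v t, Fvv 0 v t = 0).
{ intros v t. unfold Fvv. rewrite (Derive_ext _ (fun _ => 0)); [apply Derive_const|easy]. }
assert (PF : forall u v t, Rabs u < e -> Rabs v < e -> F u v (t + 2 * PI) = F u v t).
{ intros u v t Hu Hv. unfold F, field_u. rewrite Hper; [easy|]. now apply HD. }
assert (Hloc : forall u, Rabs u < e -> locally u (fun x => Rabs x < e)).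
{ intros u Hu. assert (Hp : 0 < e - Rabs u) by lra. exists (mkposreal _ Hp).
  intros y Hy. assert (Hy' : Rabs (y - u) < e - Rabs u) by exact Hy.
  replace y with ((y - u) + u) by ring. eapply Rle_lt_trans; [apply Rabs_triang|]. lra. }
assert (PFu : forall u v t, Rabs u < e -> Rabs v < e -> Fu u v (t + 2 * PI) = Fu u v t).
{ intros u v t Hu Hv. apply Derive_ext_loc. generalize (Hloc u Hu). apply filter_imp.
  intros x Hx. now apply PF. }
assert (PFv : forall u v t, Rabs u < e -> Rabs v < e -> Fv u v (t + 2 * PI) = Fv u v t).
{ intros u v t Hu Hv. apply Derive_ext_loc. generalize (Hloc v Hv). apply filter_imp.
  intros x Hx. now apply PF. }
exists fu, fv, (6 * K + M), M. split; [lra|split; [easy|]].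
split.
- assert (HC : forall k G, Ck k (cyl D) G -> box_continuous (e / 6) G).
  { intros k G HG X Y T s HX HY HT H1 H2. apply continuous_along_curve; try easy.
    apply (Ck_continuous k (cyl D) G _ _ _ HG). apply HW; lra. }
  assert (Hinv : forall (X : R -> R) (s : R), continuous X s -> 0 < X s -> continuous (fun w => / X w) s).
  { intros X s HX H0. apply continuous_comp with (1 := HX). apply continuous_Rinv. lra. }
  split; [|split]; intros X Y T s HX HY HT H1 H2.
  + apply continuous_ext_loc with (fun w => F (X w) (Y w) (T w) / X w - X w - Y w).
    * assert (HL : locally s (fun w => 0 < X w)).
      { apply HX. apply open_gt. lra. }
      revert HL. apply filter_imp. intros w Hw. now apply Ef.
    * apply (continuous_minus (fun w => F (X w) (Y w) (T w) / X w - X w)); [|easy].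
      apply (continuous_minus (fun w => F (X w) (Y w) (T w) / X w)); [|easy].
      apply (continuous_mult (fun w => F (X w) (Y w) (T w)) (fun w => / X w)).
      -- now apply (HC _ _ C0).
      -- apply Hinv; [easy|lra].
  + unfold fu.
    apply (continuous_minus (fun w => Fu (X w) (Y w) (T w) / X w - F (X w) (Y w) (T w) / X w ^ 2));
      [|apply continuous_const].
    apply (continuous_minus (fun w => Fu (X w) (Y w) (T w) / X w)
      (fun w => F (X w) (Y w) (T w) / X w ^ 2)).
    * apply (continuous_mult (fun w => Fu (X w) (Y w) (T w)) (fun w => / X w)).
      -- now apply (HC _ _ Cu).
      -- apply Hinv; [easy|lra].
    * apply (continuous_mult (fun w => F (X w) (Y w) (T w)) (fun w => / (X w ^ 2))).
      -- now apply (HC _ _ C0).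
      -- apply (Hinv (fun w => X w ^ 2)); [|nra].
         apply continuous_ext with (fun w => mult (X w) (X w)).
         ++ intros w. unfold mult; simpl; ring.
         ++ now apply (continuous_mult X X).
  + unfold fv.
    apply (continuous_minus (fun w => Fv (X w) (Y w) (T w) / X w)); [|apply continuous_const].
    apply (continuous_mult (fun w => Fv (X w) (Y w) (T w)) (fun w => / X w)).
    * now apply (HC _ _ Cv).
    * apply Hinv; [easy|lra].
- assert (Hred : forall u v, 0 < u < e / 6 -> 0 < v < e / 6 -> forall (n : Z) t,
    f u v (t + IZR n * (2 * PI)) = f u v t /\ fu u v (t + IZR n * (2 * PI)) = fu u v t /\
    fv u v (t + IZR n * (2 * PI)) = fv u v t).
  { intros u v Hu Hv n t.
    assert (Au : Rabs u < e) by (rewrite Rabs_pos_eq; lra).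
    assert (Av : Rabs v < e) by (rewrite Rabs_pos_eq; lra).
    split; [|split].
    - apply (periodic_IZR (fun t => f u v t)). intros t'. apply Hper. now apply HD.
    - apply (periodic_IZR (fun t => fu u v t)). intros t'. unfold fu. now rewrite PFu, PF.
    - apply (periodic_IZR (fun t => fv u v t)). intros t'. unfold fv. now rewrite PFv. }
  intros u v t Hu Hv.
  (* The compactness bounds hold for t in one period; [Hred] transfers them to every t. *)
  destruct (reduce_mod_period (2 * PI) t ltac:(assert (H := PI_RGT_0); lra)) as [n Ht].
  set (t' := t + IZR n * (2 * PI)) in *.
  assert (Q := quotient_estimates (fun u v => F u v t') (fun u v => Fu u v t')
    (fun u v => Fuu u v t') (fun u v => Fuuu u v t') (fun u v => Fv u v t')
    (fun u v => Fuv u v t') (fun u v => Fuuv u v t') (fun u v => Fvv u v t')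
    (fun u v => Fuvv u v t') K M (e / 2) HK HM).
  cbv zeta beta in Q.
  replace (e / 2 / 3) with (e / 6) in Q by field.
  assert (Q' : forall u v, 0 < u < e / 6 -> 0 < v < e / 6 ->
    Rabs (fu u v t') <= (6 * K + M) * (u + v) /\
    Rabs (fv u v t') <= (6 * K + M) * (u + v) /\
    (forall u0 v0, 0 < u0 < e / 6 -> 0 < v0 < e / 6 ->
     Rabs (F u v t' / u - u - v - (F u0 v0 t' / u0 - u0 - v0) - fu u0 v0 t' * (u - u0)
           - fv u0 v0 t' * (v - v0)) <= M * (Rabs (u - u0) + Rabs (v - v0)) ^ 2)).
  { apply Q; clear Q.
    - intros x y Hx Hy.
      assert (W : cyl D (x, y, t')) by (apply HW; lra).
      destruct (D0 x y t' W) as [E1 E2]. destruct (Du x y t' W) as [E3 _].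
      destruct (Duu x y t' W) as [E4 _]. destruct (Dv x y t' W) as [E5 E6].
      destruct (Duv x y t' W) as [E7 _]. destruct (Dvv x y t' W) as [E8 _].
      exact (conj E1 (conj E3 (conj E4 (conj E2 (conj E5 (conj E7 (conj E6 E8))))))).
    - intros x y Hx Hy. split; [|split].
      + eapply Rle_trans; [apply B1; lra|easy].
      + eapply Rle_trans; [apply B2; lra|easy].
      + eapply Rle_trans; [apply B3; lra|easy].
    - intros y Hy. rewrite F0, Fv0, Fvv0. easy.
    - intros x y Hx Hy. rewrite Ef by lra. apply Hf; rewrite Rabs_pos_eq; lra. }
  destruct (Hred u v Hu Hv n t) as [R1 [R2 R3]]. fold t' in R1, R2, R3.
  destruct (Q' u v Hu Hv) as [Q1 [Q2 Q3]].
  rewrite R2 in Q1. rewrite R3 in Q2.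
  split; [|split; [easy|split; [easy|]]].
  + eapply Rle_trans; [apply Hf; rewrite Rabs_pos_eq; lra|].
    apply Rle_trans with (K * (u + v) ^ 2); [apply Rmult_le_compat_l; nra|].
    apply Rmult_le_compat_r; [apply pow2_ge_0|lra].
  + intros u0 v0 Hu0 Hv0. specialize (Q3 u0 v0 Hu0 Hv0).
    destruct (Hred u0 v0 Hu0 Hv0 n t) as [S1 [S2 S3]]. fold t' in S1, S2, S3.
    rewrite !Ef in Q3 by lra. now rewrite R1, S1, S2, S3 in Q3.
Qed.

(** * The invariant cone of the variational equation *)

Lemma Rabs_mult_ge (c e k : R) : 0 <= c -> Rabs e <= k -> - (c * k) <= c * e <= c * k.
Proof. intros Hc He. apply Rabs_le_between in He. split; nra. Qed.

(** With s = V / r and k = K r, the lower edge of the cone is eta = - c xi, and the expression is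
    the derivative of [N2] there, divided by r xi. Its main part is s / 2 - s^3 / 4 + 10 k (1 - 2 s)
    up to smaller terms. The first two terms vanish at s = 0, where the shift by 5 k in [c] supplies
    10 k; the margin of 6 k exceeds the errors, at most 3.6 k. *)
Lemma lower_edge_positive (s k e1 e2 e3 e4 p q : R) :
  0 <= s <= 1 -> 0 < k <= 1 / 100 ->
  Rabs e1 <= k -> Rabs e2 <= k -> Rabs e3 <= k -> Rabs e4 <= k ->
  Rabs p <= k -> Rabs q <= k ->
  let c := 1 - s / 2 + 5 * k in
  0 < c * (1 - s) * (1 + e1) - c ^ 2 * s * (1 + e2) - (1 - s) * (1 + e3)
      + c * s * (1 + e4) + s * (1 - s) * (1 + (p + q) / 2)
      + 5 * k * ((1 - s) * (1 + p) - s * (1 + q)).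
Proof.
intros Hs Hk H1 H2 H3 H4 Hp Hq c.
assert (Hc : 1 / 2 <= c <= 105 / 100) by (unfold c; lra).
assert (S1 : 0 <= c * (1 - s)) by nra.
assert (S2 : 0 <= c ^ 2 * s) by (apply Rmult_le_pos; nra).
assert (S3 : 0 <= 1 - s) by lra.
assert (S4 : 0 <= c * s) by nra.
assert (S5 : 0 <= s * (1 - s)) by nra.
assert (S6 : 0 <= 5 * k * (1 - s)) by nra.
assert (S7 : 0 <= 5 * k * s) by nra.
apply (Rabs_mult_ge _ _ _ S1) in H1. apply (Rabs_mult_ge _ _ _ S2) in H2.
apply (Rabs_mult_ge _ _ _ S3) in H3. apply (Rabs_mult_ge _ _ _ S4) in H4.
assert (P1 := Rabs_mult_ge _ _ _ S5 Hp). assert (P2 := Rabs_mult_ge _ _ _ S5 Hq).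
assert (P3 := Rabs_mult_ge _ _ _ S6 Hp). assert (P4 := Rabs_mult_ge _ _ _ S7 Hq).
assert (C2 : c ^ 2 <= 1.11) by nra.
assert (Err : c * (1 - s) * k + c ^ 2 * s * k + (1 - s) * k + c * s * k + s * (1 - s) * k
  + 5 * k * (1 - s) * k + 5 * k * s * k <= 36 / 10 * k).
{ assert (c ^ 2 * s <= 1.11 * 1) by (apply Rmult_le_compat; nra).
  assert (s * (1 - s) <= 1 / 4) by (assert (A := pow2_ge_0 (s - 1 / 2)); nra).
  replace (c * (1 - s) * k + c ^ 2 * s * k + (1 - s) * k + c * s * k + s * (1 - s) * k
  + 5 * k * (1 - s) * k + 5 * k * s * k) with
   (k * (c + c ^ 2 * s + (1 - s) + s * (1 - s) + 5 * k)) by ring.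
  rewrite (Rmult_comm (36 / 10)). apply Rmult_le_compat_l; [lra|]. lra. }
assert (Main : 6 * k <= c * (1 - s) - c ^ 2 * s - (1 - s) + c * s + s * (1 - s)
  + 5 * k * (1 - 2 * s)).
{ replace (c * (1 - s) - c ^ 2 * s - (1 - s) + c * s + s * (1 - s) + 5 * k * (1 - 2 * s))
   with (s / 2 - s * (s * s) / 4 + 10 * k * (1 - 2 * s) + 5 * k * s * s - 25 * k * (k * s))
   by (unfold c; field).
  assert (s * (s * s) <= s) by nra. assert (0 <= 5 * k * s * s) by (apply Rmult_le_pos; nra).
  assert (0 <= k * s <= s / 100) by (split; nra).
  assert (k * (k * s) <= 1 / 100 * (s / 100)) by (apply Rmult_le_compat; lra). lra. }
lra.
Qed.

(** Here w stands for eta / xi. Without errors the inequality reads 1 - 2 s <= 1 - s + s w, with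
    equality at w = -1, so that every error must be absorbed. Together they cost about 10 k, and the
    logarithmic derivative of the weight exp (16 K (U - V)) provides more. *)
Lemma growth_rate_positive (s k e1 e2 p q w : R) :
  0 <= s <= 1 -> 0 < k <= 1 / 100 ->
  Rabs e1 <= k -> Rabs e2 <= k -> Rabs p <= k -> Rabs q <= k -> - 1 - 5 * k <= w ->
  (1 - s) * (1 + p) - s * (1 + q) <=
  (1 - s) * (1 + e1) + s * (1 + e2) * w + 16 * k * ((1 - s) * (1 + p) + s * (1 + q)).
Proof.
intros Hs Hk H1 H2 Hp Hq Hw.
apply Rabs_le_between in H1. apply Rabs_le_between in H2.
apply Rabs_le_between in Hp. apply Rabs_le_between in Hq.
assert (S3 : 0 <= 1 - s) by lra.
assert (A1 : (1 - s) * (e1 - p) >= - (2 * k)) by nra.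
assert (A2 : s * (1 + e2) * w >= - (s + 7 * k)).
{ assert (0 <= s * (1 + e2) <= s + k) by nra. nra. }
assert (A3 : s * (1 + q) >= s - k) by nra.
assert (A4 : (1 - s) * (1 + p) + s * (1 + q) >= 99 / 100) by nra.
nra.
Qed.

(* [xi] and [eta] are the logarithmic variations of [U] and [V] at fixed time.
   To leading order [xi + eta] is conserved and [xi / (U + V)] increases; the
   cone [xi > eta], [eta > (V / (2 r) - 5 K r - 1) xi] absorbs the errors. *)
Lemma cone_estimate (U V f g fu fv gu gv xi eta : R -> R) (K R0 a b : R) :
  0 < K -> K * R0 <= 1 / 100 -> a <= b ->
  (forall s, a <= s <= b ->
     0 < U s /\ 0 < V s /\ U s + V s <= R0 /\
     Rabs (f s) <= K * (U s + V s) ^ 2 /\ Rabs (g s) <= K * (U s + V s) ^ 2 /\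
     Rabs (fu s) <= K * (U s + V s) /\ Rabs (fv s) <= K * (U s + V s) /\
     Rabs (gu s) <= K * (U s + V s) /\ Rabs (gv s) <= K * (U s + V s)) ->
  (forall s, a <= s <= b ->
     is_derive U s (U s * (U s + V s + f s)) /\
     is_derive V s (- V s * (U s + V s + g s)) /\
     is_derive xi s (U s * (1 + fu s) * xi s + V s * (1 + fv s) * eta s) /\
     is_derive eta s (- (U s * (1 + gu s)) * xi s + - (V s * (1 + gv s)) * eta s)) ->
  0 < xi a -> eta a < xi a ->
  (V a / (2 * (U a + V a)) - 5 * K * (U a + V a)) * xi a < xi a + eta a ->
  0 < xi b /\ Rabs (eta b) <= 2 * xi b /\
  xi a / (U a + V a) / 2 <= xi b / (U b + V b).
Proof.
intros HK HKR Hab Hbd Hd Ha1 Ha2 Ha3.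
(* The cone is [N1 > 0] and [N2 > 0], that is, (beta - 1) xi < eta < xi. *)
set (beta := fun s => V s / (2 * (U s + V s)) - 5 * K * (U s + V s)).
set (N1 := fun s => xi s - eta s).
set (N2 := fun s => xi s + eta s - beta s * xi s).
set (sg := fun s => V s / (U s + V s)).
set (kp := fun s => K * (U s + V s)).
assert (Hn : forall s, a <= s <= b ->
  0 < U s + V s /\ 0 <= sg s <= 1 /\ 0 < kp s <= 1 / 100 /\
  V s = sg s * (U s + V s) /\ U s = (1 - sg s) * (U s + V s) /\
  beta s = sg s / 2 - 5 * kp s /\
  Rabs (f s / (U s + V s)) <= kp s /\ Rabs (g s / (U s + V s)) <= kp s).
{ intros s Hs. destruct (Hbd s Hs) as [HU [HV [HR [Hf [Hg _]]]]].
  assert (Hr : 0 < U s + V s) by lra.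
  assert (Hdiv : forall h, Rabs h <= K * (U s + V s) ^ 2 -> Rabs (h / (U s + V s)) <= kp s).
  { intros h Hh. unfold Rdiv. rewrite Rabs_mult, Rabs_inv, (Rabs_pos_eq (U s + V s)) by lra.
    apply Rmult_le_reg_r with (U s + V s); [easy|]. rewrite Rmult_assoc, Rinv_l by lra.
    unfold kp. lra. }
  split; [easy|]. split.
  { unfold sg. split; [apply Rdiv_le_0_compat; lra|].
    apply Rmult_le_reg_r with (U s + V s); [easy|]. unfold Rdiv.
    rewrite Rmult_assoc, Rinv_l by lra. lra. }
  split; [unfold kp; split; nra|].
  split; [unfold sg; field; lra|]. split; [unfold sg; field; lra|].
  split; [unfold beta, sg, kp; field; lra|].
  split; now apply Hdiv. }
assert (DN1 : forall s, a <= s <= b -> is_derive N1 s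
  ((U s * (1 + fu s) * xi s + V s * (1 + fv s) * eta s) -
   (- (U s * (1 + gu s)) * xi s + - (V s * (1 + gv s)) * eta s))).
{ intros s Hs. destruct (Hd s Hs) as [_ [_ [D1 D2]]]. now apply (is_derive_minus xi eta). }
assert (DN2 : forall s, a <= s <= b -> N2 s = 0 -> 0 < xi s ->
  exists d, 0 < d /\ is_derive N2 s d).
{ intros s Hs H0 Hxi. destruct (Hn s Hs) as [Hr [Hsg [Hkp [EV [EU [Eb [Hf Hg]]]]]]].
  destruct (Hbd s Hs) as [_ [_ [_ [_ [_ [H1 [H2 [H3 H4]]]]]]]].
  destruct (Hd s Hs) as [DU [DV [D1 D2]]].
  exists ((U s + V s) * xi s *
    ((1 - sg s / 2 + 5 * kp s) * (1 - sg s) * (1 + fu s)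
     - (1 - sg s / 2 + 5 * kp s) ^ 2 * sg s * (1 + fv s) - (1 - sg s) * (1 + gu s)
      + (1 - sg s / 2 + 5 * kp s) * sg s * (1 + gv s)
      + sg s * (1 - sg s) * (1 + (f s / (U s + V s) + g s / (U s + V s)) / 2)
      + 5 * kp s * ((1 - sg s) * (1 + f s / (U s + V s)) - sg s * (1 + g s / (U s + V s))))).
  split.
  - apply Rmult_lt_0_compat; [now apply Rmult_lt_0_compat|].
    now apply lower_edge_positive.
  - assert (Eeta : eta s = (beta s - 1) * xi s) by (unfold N2 in H0; lra).
    unfold N2, beta. auto_derive.
    + repeat split; try (eexists; eassumption). lra.
    + replace (Derive (fun x : R => U x) s) with (U s * (U s + V s + f s))
        by (symmetry; now apply is_derive_unique).
      replace (Derive (fun x : R => V x) s) with (- V s * (U s + V s + g s))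
        by (symmetry; now apply is_derive_unique).
      replace (Derive (fun x : R => xi x) s)
        with (U s * (1 + fu s) * xi s + V s * (1 + fv s) * eta s)
        by (symmetry; now apply is_derive_unique).
      replace (Derive (fun x : R => eta x) s)
        with (- (U s * (1 + gu s)) * xi s + - (V s * (1 + gv s)) * eta s)
        by (symmetry; now apply is_derive_unique).
      rewrite Eeta. unfold beta, sg, kp. field. lra. }
assert (Hsum : forall s, a <= s <= b -> 0 <= N1 s -> 0 <= N2 s ->
  0 <= xi s /\ Rabs (eta s) <= 2 * xi s /\ (- 1 - 5 * kp s) * xi s <= eta s).
{ intros s Hs A1 A2. destruct (Hn s Hs) as [Hr [Hsg [Hkp [_ [_ [Eb _]]]]]].
  unfold N1 in A1. unfold N2 in A2. rewrite Eb in A2.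
  assert (Hxi : 0 <= xi s).
  { apply Rmult_le_reg_l with (2 - (sg s / 2 - 5 * kp s)); [lra|]. rewrite Rmult_0_r. lra. }
  split; [easy|]. split.
  - apply Rabs_le. split; nra.
  - nra. }
assert (Hpos : forall s, a <= s <= b -> 0 < Rmin (N1 s) (N2 s)).
{ intros s Hs. apply Rnot_le_lt. intros Hle.
  destruct (first_zero (fun s => Rmin (N1 s) (N2 s)) a s) as [z [Hz [Hz0 Hzp]]].
  - lra.
  - intros w Hw. destruct (Hd w ltac:(lra)) as [DU [DV [D1 D2]]].
    assert (CN1 : continuous N1 w) by (eapply is_derive_continuous; apply DN1; lra).
    assert (CN2 : continuous N2 w).
    { destruct (Hn w ltac:(lra)) as [Hr _].
      apply (ex_derive_continuous N2). unfold N2, beta. auto_derive.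
      repeat split; try (eexists; eassumption). lra. }
    apply continuous_ext with (fun w => (N1 w + N2 w - Rabs (N1 w - N2 w)) / 2).
    + intros x. unfold Rmin, Rabs.
      destruct (Rle_dec (N1 x) (N2 x)); destruct (Rcase_abs (N1 x - N2 x)); lra.
    + apply (continuous_mult (fun w => N1 w + N2 w - Rabs (N1 w - N2 w)) (fun _ => / 2));
        [|apply continuous_const].
      apply (continuous_minus (fun w => N1 w + N2 w) (fun w => Rabs (N1 w - N2 w))).
      * now apply (continuous_plus N1 N2).
      * apply (continuous_comp (fun w => N1 w - N2 w) Rabs); [|apply continuous_Rabs].
        now apply (continuous_minus N1 N2).
  - apply Rmin_glb_lt; unfold N1, N2, beta; lra.
  - easy.
  - assert (Hge : forall w, a <= w <= z -> 0 <= N1 w /\ 0 <= N2 w).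
    { intros w Hw. assert (Hm : 0 <= Rmin (N1 w) (N2 w)).
      { destruct (Req_dec w z) as [->|Hne]; [lra|]. left. apply Hzp. lra. }
      split; eapply Rle_trans; try exact Hm; [apply Rmin_l|apply Rmin_r]. }
    (* The orbit might leave through the vertex xi = eta = 0, where the edges give no sign. Inside
       the cone -xi' <= 4 R0 xi, so xi decays at most exponentially and the vertex is not reached in
       finite time. *)
    assert (Hxz : 0 < xi z).
    { assert (G := exp_growth (fun s => - xi s)
        (fun s => - (U s * (1 + fu s) * xi s + V s * (1 + fv s) * eta s)) (- (4 * R0)) a z).
      assert (HR0 : 0 < R0) by (destruct (Hbd a ltac:(lra)) as [? [? [? _]]]; lra).
      cut (- xi z <= - xi a * exp (- (4 * R0) * (z - a))).
      { intros Hle'. assert (E := exp_pos (- (4 * R0) * (z - a))). nra. }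
      apply G; [lra| |].
      - intros w Hw. destruct (Hd w ltac:(lra)) as [_ [_ [D1 _]]]. now apply (is_derive_opp xi).
      - intros w Hw. destruct (Hge w Hw) as [G1 G2].
        destruct (Hn w ltac:(lra)) as [Hr [_ [Hkp _]]].
        destruct (Hsum w ltac:(lra) G1 G2) as [X1 [X2 X3]].
        destruct (Hbd w ltac:(lra)) as [HU [HV [HR [_ [_ [H1 [H2 _]]]]]]].
        fold (kp w) in H1, H2.
        apply Rabs_le_between in H1. apply Rabs_le_between in H2.
        apply Rabs_le_between in X2.
        assert (0 <= U w * (1 + fu w) * xi w) by (repeat apply Rmult_le_pos; lra).
        assert (B1 : 0 <= V w * (1 + fv w) <= 2 * R0) by nra.
        nra. }
    destruct (Hbd z ltac:(lra)) as [HU [HV [_ [_ [_ [H1 [H2 [H3 H4]]]]]]]].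
    destruct (Hn z ltac:(lra)) as [_ [_ [Hkp _]]]. fold (kp z) in H1, H2, H3, H4.
    apply Rabs_le_between in H1. apply Rabs_le_between in H2.
    apply Rabs_le_between in H3. apply Rabs_le_between in H4.
    assert (HP1 : forall w, a <= w < z -> 0 < N1 w).
    { intros w Hw. eapply Rlt_le_trans; [apply (Hzp w Hw)|apply Rmin_l]. }
    assert (HP2 : forall w, a <= w < z -> 0 < N2 w).
    { intros w Hw. eapply Rlt_le_trans; [apply (Hzp w Hw)|apply Rmin_r]. }
    unfold Rmin in Hz0. destruct (Rle_dec (N1 z) (N2 z)).
    (* On the upper edge eta = xi, the derivative of [N1] is a sum of positive terms. *)
    + assert (HL := derive_sign_of_pos_left N1 z _ a (proj1 Hz) (DN1 z ltac:(lra)) Hz0 HP1).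
      assert (Eeta : eta z = xi z) by (unfold N1 in Hz0; lra). rewrite Eeta in HL.
      assert (0 < U z * (1 + fu z) * xi z) by (repeat apply Rmult_lt_0_compat; lra).
      assert (0 < V z * (1 + fv z) * xi z) by (repeat apply Rmult_lt_0_compat; lra).
      assert (0 < U z * (1 + gu z) * xi z) by (repeat apply Rmult_lt_0_compat; lra).
      assert (0 < V z * (1 + gv z) * xi z) by (repeat apply Rmult_lt_0_compat; lra).
      lra.
    + destruct (DN2 z ltac:(lra) Hz0 Hxz) as [d [Hd0 HdN]].
      assert (HL := derive_sign_of_pos_left N2 z d a (proj1 Hz) HdN Hz0 HP2). lra. }
assert (Hcone : forall s, a <= s <= b ->
  0 < xi s /\ Rabs (eta s) <= 2 * xi s /\ (- 1 - 5 * kp s) * xi s <= eta s).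
{ intros s Hs. specialize (Hpos s Hs).
  assert (A1 : 0 < N1 s) by (eapply Rlt_le_trans; [apply Hpos|apply Rmin_l]).
  assert (A2 : 0 < N2 s) by (eapply Rlt_le_trans; [apply Hpos|apply Rmin_r]).
  destruct (Hsum s Hs) as [X1 [X2 X3]]; try lra.
  split; [|easy]. destruct X1 as [X1|X1]; [easy|].
  exfalso. rewrite <- X1, Rmult_0_r in X2. apply Rabs_le_between in X2.
  unfold N1 in A1. lra. }
destruct (Hcone b ltac:(lra)) as [Xb1 [Xb2 _]].
split; [easy|split; [easy|]].
(* The derivative of U - V is U p + V q, positive and of order r^2: exactly the size of the errors
   in the growth of ln (xi / r). Since [W] varies by at most 32 K R0, this weight costs no more than
   the factor 2 of the conclusion. *)
set (W := fun s => 16 * K * (U s - V s)).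
assert (Hmono : xi a / (U a + V a) * exp (W a) <= xi b / (U b + V b) * exp (W b)).
{ apply (derive_nonneg_le (fun s => xi s / (U s + V s) * exp (W s))
   (fun s => xi s * exp (W s) *
     ((1 - sg s) * (1 + fu s) + sg s * (1 + fv s) * (eta s / xi s)
      + 16 * kp s * ((1 - sg s) * (1 + f s / (U s + V s)) + sg s * (1 + g s / (U s + V s)))
      - ((1 - sg s) * (1 + f s / (U s + V s)) - sg s * (1 + g s / (U s + V s)))))); [easy| |].
  - intros s Hs. destruct (Hd s Hs) as [DU [DV [D1 D2]]]. destruct (Hn s Hs) as [Hr _].
    destruct (Hcone s Hs) as [X1 _].
    unfold W. auto_derive.
    + repeat split; try (eexists; eassumption). lra.
    + replace (Derive (fun x : R => U x) s) with (U s * (U s + V s + f s))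
        by (symmetry; now apply is_derive_unique).
      replace (Derive (fun x : R => V x) s) with (- V s * (U s + V s + g s))
        by (symmetry; now apply is_derive_unique).
      replace (Derive (fun x : R => xi x) s)
        with (U s * (1 + fu s) * xi s + V s * (1 + fv s) * eta s)
        by (symmetry; now apply is_derive_unique).
      unfold sg, kp, Rminus. field. lra.
  - intros s Hs. destruct (Hcone s Hs) as [X1 [_ X3]].
    destruct (Hn s Hs) as [Hr [Hsg [Hkp [_ [_ [_ [Hf Hg]]]]]]].
    destruct (Hbd s Hs) as [_ [_ [_ [_ [_ [H1 [H2 _]]]]]]].
    apply Rmult_le_pos; [apply Rmult_le_pos; [lra|left; apply exp_pos]|].
    assert (Hw : - 1 - 5 * kp s <= eta s / xi s).
    { apply Rmult_le_reg_r with (xi s); [easy|]. unfold Rdiv.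
      rewrite Rmult_assoc, Rinv_l by lra. lra. }
    assert (Q := growth_rate_positive (sg s) (kp s) (fu s) (fv s) (f s / (U s + V s))
      (g s / (U s + V s)) (eta s / xi s) Hsg Hkp H1 H2 Hf Hg Hw). lra. }
assert (HWb : W b - W a <= 32 / 100).
{ unfold W. destruct (Hbd a ltac:(lra)) as [? [? [? _]]].
  destruct (Hbd b ltac:(lra)) as [? [? [? _]]]. nra. }
assert (Hexp : exp (W b) <= 2 * exp (W a)).
{ replace (W a) with (W b + (W a - W b)) by ring. rewrite exp_plus.
  assert (1 + (W a - W b) <= exp (W a - W b)) by apply exp_ineq1_le.
  assert (Eb := exp_pos (W b)). nra. }
assert (Hq : 0 < xi b / (U b + V b)).
{ apply Rdiv_lt_0_compat; [easy|]. destruct (Hbd b ltac:(lra)) as [? [? _]]. lra. }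
assert (Ea := exp_pos (W a)).
apply Rmult_le_reg_r with (2 * exp (W a)); [lra|].
eapply Rle_trans; [|apply Rmult_le_compat_l; [lra|apply Hexp]]. lra.
Qed.

(** * The system in logarithmic coordinates *)

(** Clamping the logarithmic coordinates before exponentiating makes the field bounded and globally
    Lipschitz, so that [planar_flow_exists] applies; inside the window the field is unchanged. *)
Definition clamp (lo hi z : R) : R := Rmax lo (Rmin hi z).

Definition clexp (lo hi z : R) : R := exp (clamp lo hi z).

Lemma clamp_bounds (lo hi z : R) : lo <= hi -> lo <= clamp lo hi z <= hi.
Proof.
intros H. unfold clamp. split; [apply Rmax_l|]. apply Rmax_lub; [easy|apply Rmin_l].
Qed.

Lemma clamp_id (lo hi z : R) : lo <= z <= hi -> clamp lo hi z = z.
Proof. intros H. unfold clamp. rewrite Rmin_right, Rmax_right; lra. Qed.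

Lemma clamp_contraction (lo hi z w : R) : Rabs (clamp lo hi z - clamp lo hi w) <= Rabs (z - w).
Proof.
unfold clamp, Rmax, Rmin.
destruct (Rle_dec hi z), (Rle_dec hi w);
  repeat match goal with |- context [Rle_dec ?x ?y] => destruct (Rle_dec x y) end;
  unfold Rabs; repeat match goal with |- context [Rcase_abs ?x] => destruct (Rcase_abs x) end; lra.
Qed.

Lemma clexp_bounds (lo hi z : R) : lo <= hi -> exp lo <= clexp lo hi z <= exp hi.
Proof.
intros H. destruct (clamp_bounds lo hi z H). split; now apply exp_le_compat.
Qed.

Lemma exp_lipschitz (b z w : R) : z <= b -> w <= b ->
  Rabs (exp z - exp w) <= exp b * Rabs (z - w).
Proof.
intros Hz Hw.
destruct (mean_value_between exp exp w z) as [c [Hc E]].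
{ intros s _. auto_derive; [easy|ring]. }
rewrite E, Rabs_mult, (Rabs_pos_eq (exp c)) by (left; apply exp_pos).
apply Rmult_le_compat_r; [apply Rabs_pos|]. apply exp_le_compat.
eapply Rle_trans; [apply Hc|]. now apply Rmax_lub.
Qed.

Lemma clexp_lipschitz (lo hi z w : R) : lo <= hi ->
  Rabs (clexp lo hi z - clexp lo hi w) <= exp hi * Rabs (z - w).
Proof.
intros H. eapply Rle_trans; [apply exp_lipschitz; apply clamp_bounds; exact H|].
apply Rmult_le_compat_l; [left; apply exp_pos|apply clamp_contraction].
Qed.

(** The margin 1 separates two cases. For |z - z0| < 1 no clamping occurs and the usual second order
    estimate holds; otherwise the Lipschitz bound is linear in |z - z0|, hence also bounded by its
    square. *)
Lemma clexp_remainder (lo hi z0 z : R) : lo + 1 <= z0 <= hi - 1 ->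
  Rabs (clexp lo hi z - exp z0 - exp z0 * (z - z0)) <= 2 * exp hi * (z - z0) ^ 2.
Proof.
intros H0.
assert (Ehi := exp_pos hi). assert (Ez0 := exp_pos z0).
assert (Ez0' : exp z0 <= exp hi) by (apply exp_le_compat; lra).
assert (C0 : clexp lo hi z0 = exp z0) by (unfold clexp; rewrite clamp_id; lra).
destruct (Rlt_or_le (Rabs (z - z0)) 1) as [Hc|Hf].
- assert (Hz : lo <= z <= hi) by (apply Rabs_lt_between in Hc; lra).
  unfold clexp. rewrite clamp_id by easy.
  destruct (mean_value_between (fun w => exp w - exp z0 * (w - z0))
    (fun w => exp w - exp z0) z0 z) as [c [Hb E]].
  { intros s _. auto_derive; [easy|ring]. }
  replace (exp z - exp z0 - exp z0 * (z - z0)) with ((exp c - exp z0) * (z - z0)) by lra.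
  rewrite Rabs_mult, <- (pow2_abs (z - z0)).
  assert (Hch : c <= hi /\ Rabs (c - z0) <= Rabs (z - z0)).
  { unfold Rmin, Rmax in Hb. destruct (Rle_dec z0 z) in Hb; split; try lra.
    - rewrite !Rabs_pos_eq; lra.
    - rewrite !Rabs_left1; lra. }
  assert (L := exp_lipschitz hi c z0 (proj1 Hch) ltac:(lra)).
  assert (exp hi * Rabs (c - z0) <= exp hi * Rabs (z - z0))
    by (apply Rmult_le_compat_l; lra).
  apply Rle_trans with (exp hi * Rabs (z - z0) * Rabs (z - z0)).
  + apply Rmult_le_compat_r; [apply Rabs_pos|lra].
  + assert (0 <= exp hi * (Rabs (z - z0) * Rabs (z - z0)))
      by (apply Rmult_le_pos; [lra|apply Rmult_le_pos; apply Rabs_pos]). lra.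
- rewrite <- C0 at 1. rewrite <- (pow2_abs (z - z0)).
  assert (L := clexp_lipschitz lo hi z z0 ltac:(lra)).
  replace (clexp lo hi z - clexp lo hi z0 - exp z0 * (z - z0)) with
    ((clexp lo hi z - clexp lo hi z0) + - (exp z0 * (z - z0))) by ring.
  eapply Rle_trans; [apply Rabs_triang|]. rewrite Rabs_Ropp, Rabs_mult.
  rewrite (Rabs_pos_eq (exp z0)) by lra.
  set (d := Rabs (z - z0)) in *.
  assert (exp z0 * d <= exp hi * d) by (apply Rmult_le_compat_r; lra).
  assert (exp hi * d <= exp hi * d ^ 2) by (apply Rmult_le_compat_l; nra). lra.
Qed.

Lemma clexp_continuous (lo hi : R) (X : R -> R) (s : R) : lo <= hi ->
  continuous X s -> continuous (fun w => clexp lo hi (X w)) s.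
Proof.
intros H HX. apply (continuous_comp X (clexp lo hi)); [easy|].
apply continuous_epsP. intros eps He.
assert (Ehi := exp_pos hi).
exists (eps / exp hi). split; [now apply Rdiv_lt_0_compat|].
intros y Hy. eapply Rle_lt_trans; [apply (clexp_lipschitz lo hi y (X s) H)|].
apply Rmult_lt_reg_r with (/ exp hi); [now apply Rinv_0_lt_compat|].
replace (exp hi * Rabs (y - X s) * / exp hi) with (Rabs (y - X s)) by (field; lra). easy.
Qed.

(** * Speeds in logarithmic coordinates, exact and clamped *)

Definition speed (h : R -> R -> R -> R) (u v t : R) : R := u + v + h u v t.

Definition clspeed (lo hi : R) (h : R -> R -> R -> R) (t x y : R) : R :=
  speed h (clexp lo hi x) (clexp lo hi y) t.

Lemma clspeed_curve_continuous (lo hi eps K M : R) (h hu hv : R -> R -> R -> R) :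
  lo <= hi -> exp hi < eps -> regular eps K M h hu hv ->
  curve_continuous (clspeed lo hi h).
Proof.
intros Hl He [[C _] _] X Y t HX HY.
assert (CX := clexp_continuous lo hi X t Hl HX).
assert (CY := clexp_continuous lo hi Y t Hl HY).
assert (BX := clexp_bounds lo hi (X t) Hl). assert (BY := clexp_bounds lo hi (Y t) Hl).
assert (El := exp_pos lo).
apply (continuous_plus (fun s => clexp lo hi (X s) + clexp lo hi (Y s))).
- now apply (continuous_plus (fun s => clexp lo hi (X s))).
- apply (C (fun s => clexp lo hi (X s)) (fun s => clexp lo hi (Y s)) (fun s => s)); try easy; lra.
Qed.

(** Read off from the Taylor bound: in the box the quadratic remainder is at most 2 eps times a
    linear one. *)
Lemma regular_lipschitz (eps K M : R) (h hu hv : R -> R -> R -> R) (u v u0 v0 t : R) :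
  0 <= K -> 0 <= M -> regular eps K M h hu hv ->
  0 < u < eps -> 0 < v < eps -> 0 < u0 < eps -> 0 < v0 < eps ->
  Rabs (h u v t - h u0 v0 t) <= 2 * eps * (K + M) * (Rabs (u - u0) + Rabs (v - v0)).
Proof.
intros HK HM [_ H] Hu Hv Hu0 Hv0.
destruct (H u v t Hu Hv) as [_ [_ [_ B]]]. specialize (B u0 v0 Hu0 Hv0).
destruct (H u0 v0 t Hu0 Hv0) as [_ [B1 [B2 _]]].
set (x := Rabs (u - u0)) in *. set (y := Rabs (v - v0)) in *.
assert (Hx : 0 <= x <= eps) by (split; [apply Rabs_pos|apply Rabs_le; lra]).
assert (Hy : 0 <= y <= eps) by (split; [apply Rabs_pos|apply Rabs_le; lra]).
replace (h u v t - h u0 v0 t) with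
  ((h u v t - h u0 v0 t - hu u0 v0 t * (u - u0) - hv u0 v0 t * (v - v0))
   + (hu u0 v0 t * (u - u0) + hv u0 v0 t * (v - v0))) by ring.
assert (T1 : Rabs (hu u0 v0 t * (u - u0) + hv u0 v0 t * (v - v0)) <= K * (2 * eps) * (x + y)).
{ eapply Rle_trans; [apply Rabs_triang|]. rewrite !Rabs_mult. fold x y.
  assert (K * (u0 + v0) <= K * (2 * eps)) by (apply Rmult_le_compat_l; lra).
  rewrite Rmult_plus_distr_l.
  apply Rplus_le_compat; apply Rmult_le_compat_r; lra. }
assert (T2 : M * (x + y) ^ 2 <= M * (2 * eps) * (x + y)).
{ rewrite Rmult_assoc. apply Rmult_le_compat_l; nra. }
eapply Rle_trans; [apply Rabs_triang|]. lra.
Qed.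

Lemma clspeed_lipschitz (lo hi eps K M : R) (h hu hv : R -> R -> R -> R) :
  lo <= hi -> exp hi < eps -> 0 <= K -> 0 <= M -> regular eps K M h hu hv ->
  planar_lipschitz ((1 + 2 * eps * (K + M)) * exp hi) (clspeed lo hi h).
Proof.
intros Hl He HK HM HR t x y x' y'.
assert (El := exp_pos lo). assert (Eh := exp_pos hi).
assert (B := fun z => clexp_bounds lo hi z Hl).
assert (L := regular_lipschitz eps K M h hu hv (clexp lo hi x) (clexp lo hi y)
  (clexp lo hi x') (clexp lo hi y') t HK HM HR).
assert (Lx := clexp_lipschitz lo hi x x' Hl). assert (Ly := clexp_lipschitz lo hi y y' Hl).
assert (Bx := B x). assert (By := B y). assert (Bx' := B x'). assert (By' := B y').
specialize (L ltac:(lra) ltac:(lra) ltac:(lra) ltac:(lra)).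
unfold clspeed, speed.
set (X := clexp lo hi x) in *. set (Y := clexp lo hi y) in *.
set (X' := clexp lo hi x') in *. set (Y' := clexp lo hi y') in *.
replace (X + Y + h X Y t - (X' + Y' + h X' Y' t)) with
  ((X - X') + (Y - Y') + (h X Y t - h X' Y' t)) by ring.
eapply Rle_trans; [apply Rabs_triang|].
eapply Rle_trans; [apply Rplus_le_compat_r, Rabs_triang|].
assert (S : Rabs (X - X') + Rabs (Y - Y') <= exp hi * (Rabs (x - x') + Rabs (y - y'))) by lra.
assert (HC : 0 <= 2 * eps * (K + M)) by (apply Rmult_le_pos; lra).
assert (2 * eps * (K + M) * (Rabs (X - X') + Rabs (Y - Y')) <=
  2 * eps * (K + M) * (exp hi * (Rabs (x - x') + Rabs (y - y'))))
  by (apply Rmult_le_compat_l; easy).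
lra.
Qed.

(** The chain rule with explicit remainder: the Taylor bound of [h] combined with [clexp_remainder]
    in each variable. It is the quadratic hypothesis of [derive_transport], valid for all (x, y) and
    not only near the orbit. *)
Lemma clspeed_remainder (lo hi eps K M : R) (h hu hv : R -> R -> R -> R) (t x0 y0 x y : R) :
  exp hi < eps -> 0 <= K -> 0 <= M -> regular eps K M h hu hv ->
  lo + 1 <= x0 <= hi - 1 -> lo + 1 <= y0 <= hi - 1 ->
  let u0 := exp x0 in let v0 := exp y0 in
  Rabs (clspeed lo hi h t x y - clspeed lo hi h t x0 y0
        - u0 * (1 + hu u0 v0 t) * (x - x0) - v0 * (1 + hv u0 v0 t) * (y - y0))
  <= ((1 + K * (2 * eps)) * (2 * exp hi) + M * exp hi ^ 2) * (Rabs (x - x0) + Rabs (y - y0)) ^ 2.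
Proof.
intros He HK HM HR Hx0 Hy0 u0 v0.
assert (Hl : lo <= hi) by lra.
assert (El := exp_pos lo). assert (Eh := exp_pos hi).
assert (Cx : clexp lo hi x0 = u0) by (unfold clexp; rewrite clamp_id; [easy|lra]).
assert (Cy : clexp lo hi y0 = v0) by (unfold clexp; rewrite clamp_id; [easy|lra]).
assert (B := fun z => clexp_bounds lo hi z Hl).
assert (Bx := B x). assert (By := B y). assert (Bx0 := B x0). assert (By0 := B y0).
rewrite Cx in Bx0. rewrite Cy in By0.
assert (Lx := clexp_lipschitz lo hi x x0 Hl). assert (Ly := clexp_lipschitz lo hi y y0 Hl).
assert (Rx := clexp_remainder lo hi x0 x Hx0). assert (Ry := clexp_remainder lo hi y0 y Hy0).
fold u0 in Rx. fold v0 in Ry. rewrite Cx in Lx. rewrite Cy in Ly.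
unfold clspeed, speed. rewrite Cx, Cy.
set (X := clexp lo hi x) in *. set (Y := clexp lo hi y) in *.
destruct HR as [_ HR].
destruct (HR X Y t ltac:(lra) ltac:(lra)) as [_ [_ [_ Q]]].
specialize (Q u0 v0 ltac:(lra) ltac:(lra)).
destruct (HR u0 v0 t ltac:(lra) ltac:(lra)) as [_ [B1 [B2 _]]].
assert (HKe : K * (u0 + v0) <= K * (2 * eps)) by (apply Rmult_le_compat_l; lra).
set (au := hu u0 v0 t) in *. set (av := hv u0 v0 t) in *.
replace (X + Y + h X Y t - (u0 + v0 + h u0 v0 t) - u0 * (1 + au) * (x - x0)
         - v0 * (1 + av) * (y - y0)) with
  ((h X Y t - h u0 v0 t - au * (X - u0) - av * (Y - v0))
   + ((1 + au) * (X - u0 - u0 * (x - x0)) + (1 + av) * (Y - v0 - v0 * (y - y0)))) by ring.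
set (dx := Rabs (x - x0)) in *. set (dy := Rabs (y - y0)) in *.
assert (Hdx : 0 <= dx) by apply Rabs_pos. assert (Hdy : 0 <= dy) by apply Rabs_pos.
rewrite <- (pow2_abs (x - x0)) in Rx. rewrite <- (pow2_abs (y - y0)) in Ry. fold dx in Rx. fold dy in Ry.
assert (T : forall c z d, Rabs c <= K * (u0 + v0) -> Rabs z <= 2 * exp hi * d ^ 2 ->
  Rabs ((1 + c) * z) <= (1 + K * (2 * eps)) * (2 * exp hi * d ^ 2)).
{ intros c z d Hc Hz. rewrite Rabs_mult. apply Rmult_le_compat; try apply Rabs_pos; [|easy].
  eapply Rle_trans; [apply Rabs_triang|]. rewrite Rabs_R1. lra. }
assert (T1 := T au _ dx B1 Rx). assert (T2 := T av _ dy B2 Ry).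
assert (T3 : M * (Rabs (X - u0) + Rabs (Y - v0)) ^ 2 <= M * (exp hi * (dx + dy)) ^ 2).
{ apply Rmult_le_compat_l; [easy|]. apply pow_incr. split; [|lra].
  apply Rplus_le_le_0_compat; apply Rabs_pos. }
assert (T4 : (1 + K * (2 * eps)) * (2 * exp hi) * (dx ^ 2 + dy ^ 2) <=
  (1 + K * (2 * eps)) * (2 * exp hi) * (dx + dy) ^ 2).
{ apply Rmult_le_compat_l; [|nra].
  assert (0 <= K * (2 * eps)) by (apply Rmult_le_pos; lra). apply Rmult_le_pos; lra. }
eapply Rle_trans; [apply Rabs_triang|].
eapply Rle_trans; [apply Rplus_le_compat_l, Rabs_triang|].
rewrite Rpow_mult_distr in T3. lra.
Qed.

(** The bound 3 a covers the clamped window, which extends to e a. Then r = u + v is at most 6 a,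
    and 600 K a <= 1 gives K r <= 1 / 100, the smallness required by the cone. *)
Definition admissible (eps K M a : R) (f fu fv g gu gv : R -> R -> R -> R) : Prop :=
  (0 < K /\ 0 <= M /\ 0 < a < 1 /\ 3 * a < eps /\ 600 * K * a <= 1) /\
  regular eps K M f fu fv /\ regular eps K M g gu gv.

(** Both f and g are at most 6 K a r, so the two speeds differ by at most 12 K a r, which is at most
    24 K a times the first one because it exceeds r / 2. *)
Lemma speed_bounds (eps K M a : R) (f fu fv g gu gv : R -> R -> R -> R) (u v t : R) :
  admissible eps K M a f fu fv g gu gv -> 0 < u <= 3 * a -> 0 < v <= 3 * a ->
  (u + v) / 2 <= speed f u v t <= 2 * (u + v) /\
  (u + v) / 2 <= speed g u v t <= 2 * (u + v) /\
  (1 - 24 * K * a) * speed f u v t <= speed g u v t <= (1 + 24 * K * a) * speed f u v t.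
Proof.
intros [[HK [HM [Ha [He HKa]]]] [[_ Rf] [_ Rg]]] Hu Hv.
destruct (Rf u v t ltac:(lra) ltac:(lra)) as [Bf _].
destruct (Rg u v t ltac:(lra) ltac:(lra)) as [Bg _].
unfold speed. set (r := u + v) in *.
assert (Hr : 0 < r <= 6 * a) by (unfold r; lra).
assert (HKr : K * r <= K * (6 * a)) by (apply Rmult_le_compat_l; lra).
assert (B : K * r ^ 2 <= K * (6 * a) * r).
{ replace (K * r ^ 2) with (K * r * r) by ring. apply Rmult_le_compat_r; lra. }
assert (B' : K * (6 * a) * r <= 1 / 100 * r) by (apply Rmult_le_compat_r; lra).
apply Rabs_le_between in Bf. apply Rabs_le_between in Bg.
assert (HKa0 : 0 < K * a) by (apply Rmult_lt_0_compat; lra).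
assert (B2 : 24 * K * a * (r / 2) <= 24 * K * a * (r + f u v t))
  by (apply Rmult_le_compat_l; lra).
repeat split; lra.
Qed.

(** Orbits are parametrised by the absolute time t, which removes the third equation. The bounds x,
    y <= ln a are kept in the definition because every speed estimate depends on them. *)
Definition log_orbit (f g : R -> R -> R -> R) (a u t0 t1 : R) (x y : R -> R) : Prop :=
  t0 < t1 /\ x t0 = ln u /\ y t0 = ln a /\ x t1 = ln a /\
  forall t, t0 <= t <= t1 ->
    is_derive x t (speed f (exp (x t)) (exp (y t)) t) /\
    is_derive y t (- speed g (exp (x t)) (exp (y t)) t) /\
    x t <= ln a /\ y t <= ln a.

Lemma exp_le_of_le_ln (x a : R) : 0 < a -> x <= ln a -> 0 < exp x <= a.
Proof.
intros Ha Hx. split; [apply exp_pos|]. rewrite <- (exp_ln a Ha). now apply exp_le_compat.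
Qed.

Lemma log_orbit_speeds (eps K M a : R) (f fu fv g gu gv : R -> R -> R -> R)
  (u t0 t1 : R) (x y : R -> R) :
  admissible eps K M a f fu fv g gu gv -> log_orbit f g a u t0 t1 x y ->
  forall t, t0 <= t <= t1 ->
  let p := speed f (exp (x t)) (exp (y t)) t in
  let q := speed g (exp (x t)) (exp (y t)) t in
  let r := exp (x t) + exp (y t) in
  0 < exp (x t) <= a /\ 0 < exp (y t) <= a /\
  r / 2 <= p <= 2 * r /\ r / 2 <= q <= 2 * r /\
  (1 - 24 * K * a) * p <= q <= (1 + 24 * K * a) * p.
Proof.
intros HA [_ [_ [_ [_ HO]]]] t Ht. destruct (HO t Ht) as [_ [_ [Hx Hy]]].
assert (Ha : 0 < a) by (destruct HA as [[_ [_ [? _]]] _]; lra).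
apply exp_le_of_le_ln in Hx; [|easy]. apply exp_le_of_le_ln in Hy; [|easy].
split; [easy|split; [easy|]].
apply (speed_bounds eps K M a f fu fv g gu gv); [easy|lra|lra].
Qed.

Lemma log_orbit_sandwich (eps K M a : R) (f fu fv g gu gv : R -> R -> R -> R)
  (u t0 t1 : R) (x y : R -> R) :
  admissible eps K M a f fu fv g gu gv -> log_orbit f g a u t0 t1 x y ->
  forall s t, t0 <= s -> s <= t -> t <= t1 ->
  x s <= x t /\
  - (1 + 24 * K * a) * (x t - x s) <= y t - y s <= - (1 - 24 * K * a) * (x t - x s).
Proof.
intros HA HO s t Hs Hst Ht.
assert (HS := log_orbit_speeds eps K M a f fu fv g gu gv u t0 t1 x y HA HO).
destruct HO as [_ [_ [_ [_ HO]]]].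
assert (Hx : x s <= x t).
{ apply (derive_nonneg_le x (fun t => speed f (exp (x t)) (exp (y t)) t)); [easy| |].
  - intros w Hw. apply HO; lra.
  - intros w Hw. destruct (HS w ltac:(lra)) as [? [? [? _]]]. lra. }
split; [easy|].
split.
- cut (y s + (1 + 24 * K * a) * x s <= y t + (1 + 24 * K * a) * x t); [lra|].
  apply (derive_nonneg_le (fun t => y t + (1 + 24 * K * a) * x t)
    (fun t => - speed g (exp (x t)) (exp (y t)) t
      + (1 + 24 * K * a) * speed f (exp (x t)) (exp (y t)) t)); [easy| |].
  + intros w Hw. destruct (HO w ltac:(lra)) as [D1 [D2 _]].
    apply (is_derive_plus y (fun t => (1 + 24 * K * a) * x t)); [easy|].
    now apply (is_derive_scal x).
  + intros w Hw. destruct (HS w ltac:(lra)) as [? [? [? [? ?]]]]. lra.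
- cut (- y s - (1 - 24 * K * a) * x s <= - y t - (1 - 24 * K * a) * x t); [lra|].
  apply (derive_nonneg_le (fun t => - y t - (1 - 24 * K * a) * x t)
    (fun t => - - speed g (exp (x t)) (exp (y t)) t
      - (1 - 24 * K * a) * speed f (exp (x t)) (exp (y t)) t)); [easy| |].
  + intros w Hw. destruct (HO w ltac:(lra)) as [D1 [D2 _]].
    apply (is_derive_minus (fun t => - y t) (fun t => (1 - 24 * K * a) * x t)).
    * now apply (is_derive_opp y).
    * now apply (is_derive_scal x).
  + intros w Hw. destruct (HS w ltac:(lra)) as [? [? [? [? ?]]]]. lra.
Qed.

(** * Passage between [Psi_loc] and logarithmic orbits *)

Lemma log_orbit_of_Psi (D : R * R -> Prop) (eps K M a : R)
  (f fu fv g gu gv : R -> R -> R -> R) (u t0 : R) (q : pt) :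
  admissible eps K M a f fu fv g gu gv -> 0 < u < a ->
  Psi_loc D f g a (u, a, t0) q ->
  exists t1 x y, log_orbit f g a u t0 t1 x y /\ q = (a, exp (y t1), t1).
Proof.
intros HA Hu [tau [U [V [Th [Htau [Hsol [Hpos [H0 [H1 [HUa HUn]]]]]]]]]].
assert (Ha : 0 < a) by (destruct HA as [[_ [_ [? _]]] _]; lra).
injection H0 as HU0 HV0 HT0.
assert (HT : forall s, 0 <= s <= tau -> Th s = t0 + s).
{ intros s Hs. destruct (mean_value Th (fun _ => 1) 0 s) as [c [_ E]]; [lra| |lra].
  intros w Hw. apply (Hsol w); lra. }
(* The orbit starts below u = a, so a value above [a] would force a crossing before the first
   intersection. *)
assert (HUle : forall s, 0 <= s <= tau -> U s <= a).
{ intros s Hs. apply Rnot_lt_le. intros Hgt.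
  destruct (first_zero (fun s => a - U s) 0 s) as [z [Hz [Hz0 _]]]; try lra.
  - intros w Hw. apply (continuous_minus (fun _ => a) U); [apply continuous_const|].
    destruct (Hsol w ltac:(lra)) as [_ [D1 _]]. exact (is_derive_continuous _ _ _ D1).
  - assert (z <> tau -> False) by (intros Hne; apply (HUn z); lra).
    destruct (Req_dec z tau) as [->|Hne]; [|tauto].
    assert (s = tau) by lra. subst s. lra. }
(* At V = a the field points downwards, by the speed bounds, which apply since U <= a is already
   known. *)
assert (HVle : forall s, 0 <= s <= tau -> V s <= a).
{ intros s Hs. cut (V s - a <= 0); [lra|].
  apply (barrier (fun s => V s - a) (fun s => field_v g (U s) (V s) (Th s)) 0 tau); try easy.
  - intros w Hw. destruct (Hsol w Hw) as [_ [_ [D1 _]]].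
    replace (field_v g (U w) (V w) (Th w)) with (field_v g (U w) (V w) (Th w) - 0) by ring.
    apply (is_derive_minus V (fun _ => a)); [easy|exact (is_derive_const a w)].
  - lra.
  - intros w Hw E. destruct (Hpos w Hw) as [P1 P2]. specialize (HUle w Hw).
    destruct (speed_bounds eps K M a f fu fv g gu gv (U w) (V w) (Th w) HA) as [_ [B _]];
      try lra.
    unfold field_v. unfold speed in B. nra. }
set (x := fun t => ln (U (t - t0))). set (y := fun t => ln (V (t - t0))).
exists (t0 + tau), x, y.
assert (E : t0 + tau - t0 = tau) by ring.
assert (E0 : t0 - t0 = 0) by ring.
split.
- unfold log_orbit. split; [lra|]. unfold x, y. rewrite E, E0, HU0, HV0, HUa.
  split; [easy|split; [easy|split; [easy|]]].
  intros t Ht. set (s := t - t0). assert (Hs : 0 <= s <= tau) by (unfold s; lra).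
  destruct (Hsol s Hs) as [_ [DU [DV _]]]. destruct (Hpos s Hs) as [PU PV].
  rewrite !exp_ln by easy. rewrite (HT s Hs) in DU, DV.
  replace (t0 + s) with t in DU, DV by (unfold s; ring).
  split; [|split; [|split]].
  + unfold s in *. auto_derive.
    * repeat split; [eexists; exact DU|exact PU].
    * replace (Derive (fun x : R => U x) (t + - t0)) with (field_u f (U s) (V s) t)
        by (symmetry; now apply is_derive_unique).
      unfold field_u, speed, s, Rminus in *. field. lra.
  + unfold s in *. auto_derive.
    * repeat split; [eexists; exact DV|exact PV].
    * replace (Derive (fun x : R => V x) (t + - t0)) with (field_v g (U s) (V s) t)
        by (symmetry; now apply is_derive_unique).
      unfold field_v, speed, s, Rminus in *. field. lra.
  + apply ln_le; [easy|now apply HUle].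
  + apply ln_le; [easy|now apply HVle].
- rewrite <- H1. unfold y. rewrite E, exp_ln by (apply Hpos; lra).
  rewrite HUa, HT by lra. easy.
Qed.

Lemma Psi_of_log_orbit (D : R * R -> Prop) (eps K M a : R)
  (f fu fv g gu gv : R -> R -> R -> R) (u t0 t1 : R) (x y : R -> R) :
  admissible eps K M a f fu fv g gu gv -> 0 < u < a ->
  (forall u v, 0 < u <= a -> 0 < v <= a -> D (u, v)) ->
  log_orbit f g a u t0 t1 x y ->
  Psi_loc D f g a (u, a, t0) (a, exp (y t1), t1).
Proof.
intros HA Hu HD HO.
assert (HS := log_orbit_speeds eps K M a f fu fv g gu gv u t0 t1 x y HA HO).
destruct HO as [Ht [Hx0 [Hy0 [Hx1 HO]]]].
exists (t1 - t0), (fun s => exp (x (t0 + s))), (fun s => exp (y (t0 + s))), (fun s => t0 + s).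
replace (t0 + (t1 - t0)) with t1 by ring. rewrite !Rplus_0_r, Hx0, Hy0, Hx1.
rewrite !exp_ln by lra.
split; [lra|split; [|split; [|split; [|split; [|split]]]]]; try easy.
- intros s Hs. destruct (HO (t0 + s) ltac:(lra)) as [D1 [D2 _]].
  destruct (HS (t0 + s) ltac:(lra)) as [B1 [B2 _]].
  split; [now apply HD|split; [|split]].
  + auto_derive; [repeat split; eexists; exact D1|].
    replace (Derive (fun z : R => x z) (t0 + s)) with
      (speed f (exp (x (t0 + s))) (exp (y (t0 + s))) (t0 + s))
      by (symmetry; now apply is_derive_unique).
    unfold field_u, speed. ring.
  + auto_derive; [repeat split; eexists; exact D2|].
    replace (Derive (fun z : R => y z) (t0 + s)) with
      (- speed g (exp (x (t0 + s))) (exp (y (t0 + s))) (t0 + s))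
      by (symmetry; now apply is_derive_unique).
    unfold field_v, speed. ring.
  + auto_derive; [easy|ring].
- intros s _. split; apply exp_pos.
(* The coordinate x has positive speed, so it takes the value ln a only at the end. *)
- intros s Hs E.
  destruct (mean_value x (fun t => speed f (exp (x t)) (exp (y t)) t) (t0 + s) t1)
    as [c [Hc Ec]]; [lra| |].
  + intros w Hw. apply HO; lra.
  + destruct (HS c ltac:(lra)) as [B1 [B2 [B3 _]]].
    assert (Ex : x (t0 + s) = ln a) by (rewrite <- E; now rewrite ln_exp).
    rewrite Ex, Hx1 in Ec. nra.
Qed.

(* Clamping window for the logarithmic coordinates of the orbits that start at
   [u >= m]: these orbits stay at distance at least 1 from its end points. *)
Definition win_lo (a m : R) : R := 2 * ln m - ln a - 1.
Definition win_hi (a : R) : R := ln a + 1.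

Definition cl_field_x (f : R -> R -> R -> R) (a m : R) : R -> R -> R -> R :=
  clspeed (win_lo a m) (win_hi a) f.
Definition cl_field_y (g : R -> R -> R -> R) (a m t x y : R) : R :=
  - clspeed (win_lo a m) (win_hi a) g t x y.

Lemma win_lo_lt_hi (a m : R) : 0 < m < a -> win_lo a m + 1 < ln m /\ ln m < ln a.
Proof.
intros H. assert (ln m < ln a) by (apply ln_increasing; lra). unfold win_lo. lra.
Qed.

Lemma exp_win_hi (a : R) : 0 < a -> exp (win_hi a) <= 3 * a.
Proof.
intros Ha. unfold win_hi. rewrite exp_plus, exp_ln by easy.
assert (H := exp_le_3). nra.
Qed.

Lemma cl_speed_bounds (eps K M a m : R) (f fu fv g gu gv : R -> R -> R -> R) (t x y : R) :
  admissible eps K M a f fu fv g gu gv -> 0 < m < a ->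
  let p := clspeed (win_lo a m) (win_hi a) f t x y in
  let q := clspeed (win_lo a m) (win_hi a) g t x y in
  exp (win_lo a m) <= p <= 12 * a /\ exp (win_lo a m) <= q <= 12 * a /\
  (1 - 24 * K * a) * p <= q <= (1 + 24 * K * a) * p.
Proof.
intros HA Hm.
destruct (win_lo_lt_hi a m Hm) as [W1 W2].
assert (Wl : win_lo a m <= win_hi a) by (unfold win_hi; lra).
assert (Wh := exp_win_hi a ltac:(lra)). assert (El := exp_pos (win_lo a m)).
assert (Bx := clexp_bounds _ _ x Wl). assert (By := clexp_bounds _ _ y Wl).
destruct (speed_bounds eps K M a f fu fv g gu gv (clexp (win_lo a m) (win_hi a) x)
  (clexp (win_lo a m) (win_hi a) y) t HA) as [B1 [B2 B3]]; try lra.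
cbv zeta. unfold clspeed. repeat split; lra.
Qed.

Lemma cl_field_regularity (eps K M a m : R) (f fu fv g gu gv : R -> R -> R -> R) :
  admissible eps K M a f fu fv g gu gv -> 0 < m < a ->
  let L := (1 + 2 * eps * (K + M)) * exp (win_hi a) in
  0 < L /\
  planar_lipschitz L (cl_field_x f a m) /\ planar_lipschitz L (cl_field_y g a m) /\
  curve_continuous (cl_field_x f a m) /\ curve_continuous (cl_field_y g a m).
Proof.
intros [[HK [HM [Ha [He HKa]]]] [Rf Rg]] Hm L.
destruct (win_lo_lt_hi a m Hm) as [W1 W2].
assert (Wl : win_lo a m <= win_hi a) by (unfold win_hi; lra).
assert (Wh := exp_win_hi a ltac:(lra)). assert (Eh := exp_pos (win_hi a)).
split; [|split; [|split; [|split]]].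
- unfold L. apply Rmult_lt_0_compat; [|easy].
  assert (0 <= 2 * eps * (K + M)) by (apply Rmult_le_pos; lra). lra.
- apply (clspeed_lipschitz _ _ eps K M f fu fv); try easy; lra.
- intros t x y x' y'. unfold cl_field_y.
  match goal with |- Rabs ?z <= _ => replace z with
    (- (clspeed (win_lo a m) (win_hi a) g t x y - clspeed (win_lo a m) (win_hi a) g t x' y'))
    by ring end.
  rewrite Rabs_Ropp. apply (clspeed_lipschitz _ _ eps K M g gu gv); try easy; lra.
- apply (clspeed_curve_continuous _ _ eps K M f fu fv); try easy; lra.
- intros X Y t HX HY.
  apply (continuous_opp (fun s => clspeed (win_lo a m) (win_hi a) g s (X s) (Y s))).
  apply (clspeed_curve_continuous _ _ eps K M g gu gv); try easy; lra.
Qed.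

Lemma cl_flow_exists (eps K M a m : R) (f fu fv g gu gv : R -> R -> R -> R) (t0 x0 y0 : R) :
  admissible eps K M a f fu fv g gu gv -> 0 < m < a ->
  exists X Y, X t0 = x0 /\ Y t0 = y0 /\ solves (cl_field_x f a m) (cl_field_y g a m) X Y.
Proof.
intros HA Hm.
destruct (cl_field_regularity eps K M a m f fu fv g gu gv HA Hm) as [HL [L1 [L2 [C1 C2]]]].
assert (El := exp_pos (win_lo a m)).
apply (planar_flow_exists _ _ _ (12 * a) t0 x0 y0 HL); try easy; intros t;
  destruct (cl_speed_bounds eps K M a m f fu fv g gu gv t x0 y0 HA Hm) as [B1 [B2 _]].
- unfold cl_field_x. rewrite Rabs_pos_eq; lra.
- unfold cl_field_y. rewrite Rabs_Ropp, Rabs_pos_eq; lra.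
Qed.

Lemma log_orbit_window (eps K M a m : R) (f fu fv g gu gv : R -> R -> R -> R)
  (u t0 t1 : R) (x y : R -> R) :
  admissible eps K M a f fu fv g gu gv -> 0 < m <= u -> u < a ->
  log_orbit f g a u t0 t1 x y ->
  forall t, t0 <= t <= t1 ->
    win_lo a m + 1 <= x t <= win_hi a - 1 /\ win_lo a m + 1 <= y t <= win_hi a - 1.
Proof.
intros HA Hm Hu HO t Ht.
destruct (log_orbit_sandwich eps K M a f fu fv g gu gv u t0 t1 x y HA HO t0 t) as [S1 [S2 _]];
  try lra.
destruct HA as [[HK [HM [Ha [He HKa]]]] _].
destruct HO as [_ [Hx0 [Hy0 [_ HO]]]]. destruct (HO t Ht) as [_ [_ [B1 B2]]].
assert (L1 : ln m <= ln u) by (apply ln_le; lra).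
assert (L2 : ln u < ln a) by (apply ln_increasing; lra).
assert (0 < K * a) by (apply Rmult_lt_0_compat; lra).
rewrite Hx0, Hy0 in *. unfold win_lo, win_hi.
(* As 1 + 24 K a <= 2, the sandwich yields y >= 2 ln m - ln a, which explains the formula of
   [win_lo]. *)
assert ((1 + 24 * K * a) * (x t - ln u) <= 2 * (ln a - ln m)) by (apply Rmult_le_compat; lra).
lra.
Qed.

Lemma cl_field_inside (a m : R) (h : R -> R -> R -> R) (t x y : R) :
  win_lo a m + 1 <= x <= win_hi a - 1 -> win_lo a m + 1 <= y <= win_hi a - 1 ->
  clspeed (win_lo a m) (win_hi a) h t x y = speed h (exp x) (exp y) t.
Proof.
intros Hx Hy. unfold clspeed, clexp. rewrite !clamp_id by lra. easy.
Qed.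

(** A logarithmic orbit stays in the window and therefore solves the clamped equations too;
    uniqueness is [solutions_dist] with equal initial values. *)
Lemma log_orbit_flow (eps K M a m : R) (f fu fv g gu gv : R -> R -> R -> R)
  (u t0 t1 : R) (x y X Y : R -> R) :
  admissible eps K M a f fu fv g gu gv -> 0 < m <= u -> u < a ->
  log_orbit f g a u t0 t1 x y ->
  solves (cl_field_x f a m) (cl_field_y g a m) X Y -> X t0 = ln u -> Y t0 = ln a ->
  forall t, t0 <= t <= t1 -> X t = x t /\ Y t = y t.
Proof.
intros HA Hm Hu HO HS HX HY t Ht.
destruct (cl_field_regularity eps K M a m f fu fv g gu gv HA ltac:(lra)) as [HL [L1 [L2 _]]].
assert (HW := log_orbit_window eps K M a m f fu fv g gu gv u t0 t1 x y HA Hm Hu HO).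
destruct HO as [_ [Hx0 [Hy0 [_ HO]]]].
assert (E := solutions_dist _ _ _ t0 t X Y x y (Rlt_le _ _ HL) L1 L2 (proj1 Ht)).
assert (E' : (X t - x t) ^ 2 + (Y t - y t) ^ 2 <= 0).
{ eapply Rle_trans; [apply E|].
  - intros s _. apply HS.
  - intros s Hs. destruct (HW s ltac:(lra)) as [W1 W2]. destruct (HO s ltac:(lra)) as [D1 [D2 _]].
    unfold cl_field_x, cl_field_y. rewrite !cl_field_inside by easy. easy.
  - rewrite HX, HY, Hx0, Hy0. right; ring. }
assert (A1 := pow2_ge_0 (X t - x t)). assert (A2 := pow2_ge_0 (Y t - y t)).
split; apply Rminus_diag_uniq, Rsqr_0_uniq; unfold Rsqr; lra.
Qed.

Lemma log_orbit_unique (eps K M a : R) (f fu fv g gu gv : R -> R -> R -> R)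
  (u t0 t1 t1' : R) (x y x' y' : R -> R) :
  admissible eps K M a f fu fv g gu gv -> 0 < u < a ->
  log_orbit f g a u t0 t1 x y -> log_orbit f g a u t0 t1' x' y' ->
  t1 = t1' /\ y t1 = y' t1'.
Proof.
intros HA Hu HO HO'.
destruct (cl_flow_exists eps K M a u f fu fv g gu gv t0 (ln u) (ln a) HA Hu)
  as [X [Y [HX [HY HS]]]].
assert (E := log_orbit_flow eps K M a u f fu fv g gu gv u t0 t1 x y X Y HA ltac:(lra) ltac:(lra)
  HO HS HX HY).
assert (E' := log_orbit_flow eps K M a u f fu fv g gu gv u t0 t1' x' y' X Y HA ltac:(lra) ltac:(lra)
  HO' HS HX HY).
assert (Hmono : forall s t, s < t -> X s < X t).
{ intros s t Hst.
  destruct (mean_value X (fun w => cl_field_x f a u w (X w) (Y w)) s t) as [c [Hc Ec]]; [lra| |].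
  - intros w _. apply HS.
  - destruct (cl_speed_bounds eps K M a u f fu fv g gu gv c (X c) (Y c) HA Hu) as [B _].
    assert (El := exp_pos (win_lo a u)). unfold cl_field_x in Ec. nra. }
destruct HO as [Ht [_ [_ [Hx1 _]]]]. destruct HO' as [Ht' [_ [_ [Hx1' _]]]].
destruct (E t1 ltac:(lra)) as [E1 E2]. destruct (E' t1' ltac:(lra)) as [E1' E2'].
assert (t1 = t1').
{ destruct (Rtotal_order t1 t1') as [H|[H|H]]; [|easy|]; apply Hmono in H; lra. }
subst t1'. split; [easy|lra].
Qed.

(** The clamped solution is global and its first coordinate has speed at least [c], so it reaches ln
    a before [T]. The sandwich, which holds for the clamped speeds as well, then shows that the
    solution never left the window, hence solves the original system. *)
Lemma log_orbit_exists (eps K M a : R) (f fu fv g gu gv : R -> R -> R -> R) (u t0 : R) :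
  admissible eps K M a f fu fv g gu gv -> 0 < u < a ->
  exists t1 x y, log_orbit f g a u t0 t1 x y.
Proof.
intros HA Hu.
destruct (cl_flow_exists eps K M a u f fu fv g gu gv t0 (ln u) (ln a) HA Hu)
  as [X [Y [HX [HY HS]]]].
assert (B := fun t => cl_speed_bounds eps K M a u f fu fv g gu gv t (X t) (Y t) HA Hu).
set (c := exp (win_lo a u)) in *. assert (Hc : 0 < c) by apply exp_pos.
assert (DX : forall t, is_derive X t (clspeed (win_lo a u) (win_hi a) f t (X t) (Y t)))
  by apply HS.
assert (DY : forall t, is_derive Y t (- clspeed (win_lo a u) (win_hi a) g t (X t) (Y t)))
  by apply HS.
assert (Lu : ln u < ln a) by (apply ln_increasing; lra).
set (T := t0 + (ln a - ln u) / c).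
assert (HT : t0 < T) by (unfold T; assert (0 < (ln a - ln u) / c) by (apply Rdiv_lt_0_compat; lra); lra).
destruct (first_zero (fun t => ln a - X t) t0 T) as [t1 [Ht1 [HX1 Hlt]]].
- lra.
- intros w _. apply (continuous_minus (fun _ => ln a) X); [apply continuous_const|].
  exact (is_derive_continuous _ _ _ (DX w)).
- rewrite HX; lra.
- destruct (mean_value X (fun w => clspeed (win_lo a u) (win_hi a) f w (X w) (Y w)) t0 T)
    as [w [_ E]]; [lra|now intros|].
  destruct (B w) as [Bw _]. rewrite HX in E.
  assert (c * (T - t0) = ln a - ln u) by (unfold T; field; lra). nra.
- exists t1, X, Y. split; [lra|]. split; [easy|split; [easy|split; [lra|]]].
  intros t Ht.
  assert (HXle : X t <= ln a).
  { destruct (Req_dec t t1) as [->|Hne]; [lra|]. specialize (Hlt t ltac:(lra)). lra. }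
  assert (HXge : ln u <= X t).
  { rewrite <- HX. apply (derive_nonneg_le X
      (fun w => clspeed (win_lo a u) (win_hi a) f w (X w) (Y w))); [lra|now intros|].
    intros w _. destruct (B w) as [Bw _]. lra. }
  assert (HYle : Y t <= ln a).
  { rewrite <- HY. apply Ropp_le_cancel. apply (derive_nonneg_le (fun w => - Y w)
      (fun w => - - clspeed (win_lo a u) (win_hi a) g w (X w) (Y w))); [lra| |].
    - intros w _. apply (is_derive_opp Y), DY.
    - intros w _. destruct (B w) as [_ [Bw _]]. lra. }
  assert (HYge : Y t0 + (1 + 24 * K * a) * X t0 <= Y t + (1 + 24 * K * a) * X t).
  { apply (derive_nonneg_le (fun t => Y t + (1 + 24 * K * a) * X t)
      (fun t => - clspeed (win_lo a u) (win_hi a) g t (X t) (Y t)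
        + (1 + 24 * K * a) * clspeed (win_lo a u) (win_hi a) f t (X t) (Y t))); [lra| |].
    - intros w _. apply (is_derive_plus Y (fun t => (1 + 24 * K * a) * X t)); [apply DY|].
      apply (is_derive_scal X), DX.
    - intros w _. destruct (B w) as [_ [_ Bw]]. lra. }
  rewrite HX, HY in HYge.
  destruct HA as [[HK [HM [Ha [He HKa]]]] _].
  assert (0 < K * a) by (apply Rmult_lt_0_compat; lra).
  assert ((1 + 24 * K * a) * (X t - ln u) <= 2 * (ln a - ln u)) by (apply Rmult_le_compat; lra).
  assert (Wx : win_lo a u + 1 <= X t <= win_hi a - 1) by (unfold win_lo, win_hi; lra).
  assert (Wy : win_lo a u + 1 <= Y t <= win_hi a - 1) by (unfold win_lo, win_hi; lra).
  specialize (DX t). specialize (DY t). rewrite !cl_field_inside in DX, DY by easy. easy.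
Qed.

(** * Height and time of exit *)

Lemma exp_half_sum (x y : R) : 2 * exp ((x + y) / 2) <= exp x + exp y.
Proof.
replace x with (x / 2 + x / 2) at 2 by field. replace y with (y / 2 + y / 2) at 2 by field.
replace ((x + y) / 2) with (x / 2 + y / 2) by field. rewrite !exp_plus.
assert (H := pow2_ge_0 (exp (x / 2) - exp (y / 2))). lra.
Qed.

(** The sandwich at t1 gives the exponents 1 + 24 K a and 1 - 24 K a up to powers of a; they are
    widened to 48 K a so that one constant C serves here and for the transit time. *)
Lemma exit_height (eps K M a : R) (f fu fv g gu gv : R -> R -> R -> R)
  (u t0 t1 : R) (x y : R -> R) :
  admissible eps K M a f fu fv g gu gv -> 0 < u < a -> log_orbit f g a u t0 t1 x y ->
  Rpower u (1 + 48 * K * a) <= exp (y t1) <= Rpower u (1 - 48 * K * a).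
Proof.
intros HA Hu HO.
destruct (log_orbit_sandwich eps K M a f fu fv g gu gv u t0 t1 x y HA HO t0 t1) as [_ S];
  try (destruct HO; lra).
destruct HO as [_ [Hx0 [Hy0 [Hx1 _]]]]. rewrite Hx0, Hy0, Hx1 in S.
destruct HA as [[HK [HM [Ha [He HKa]]]] _].
assert (Lu : ln u < ln a) by (apply ln_increasing; lra).
assert (La : ln a < 0) by (rewrite <- ln_1; apply ln_increasing; lra).
assert (0 < K * a) by (apply Rmult_lt_0_compat; lra).
unfold Rpower. split; apply exp_le_compat; nra.
Qed.

(** The speed is at least r / 2 >= exp ((x + y) / 2) >= exp e, where e comes from the sandwich and
    from x < 0. Hence the time is at most - ln u / exp e, and the logarithm is absorbed by (th / 2)
    (- ln u) <= u^(- th / 2), the source of both the factor 2 / th = 1 / (12 K a) and the doubled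
    exponent. *)
Lemma transit_time_upper (eps K M a : R) (f fu fv g gu gv : R -> R -> R -> R)
  (u t0 t1 : R) (x y : R -> R) :
  admissible eps K M a f fu fv g gu gv -> 0 < u < a -> log_orbit f g a u t0 t1 x y ->
  t1 - t0 <= / (12 * K * a) * exp (- ln a / 2) * Rpower u (- ((1 + 48 * K * a) / 2)).
Proof.
intros HA Hu HO.
assert (HS := log_orbit_sandwich eps K M a f fu fv g gu gv u t0 t1 x y HA HO).
assert (HP := log_orbit_speeds eps K M a f fu fv g gu gv u t0 t1 x y HA HO).
destruct HO as [Ht [Hx0 [Hy0 [Hx1 HO]]]].
destruct HA as [[HK [HM [Ha [He HKa]]]] _].
assert (Lu : ln u < ln a) by (apply ln_increasing; lra).
assert (La : ln a < 0) by (rewrite <- ln_1; apply ln_increasing; lra).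
assert (Hth : 0 < K * a) by (apply Rmult_lt_0_compat; lra).
set (th := 24 * K * a) in *. assert (Hth' : 0 < th) by (unfold th; lra).
destruct (mean_value x (fun t => speed f (exp (x t)) (exp (y t)) t) t0 t1) as [c [Hc Ec]];
  [lra|intros w Hw; apply HO; lra|].
destruct (HP c Hc) as [_ [_ [[Hp _] _]]].
destruct (HS t0 c ltac:(lra) ltac:(lra) ltac:(lra)) as [_ [S _]].
destruct (HO c Hc) as [_ [_ [Hxc _]]].
rewrite Hx0, Hy0 in S. rewrite Hx0, Hx1 in Ec.
set (e := (ln a + (1 + th) * ln u) / 2).
assert (He' : exp e <= speed f (exp (x c)) (exp (y c)) c).
{ apply Rle_trans with (exp ((x c + y c) / 2)).
  - apply exp_le_compat. unfold e. nra.
  - assert (H := exp_half_sum (x c) (y c)). lra. }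
assert (T1 : exp e * (t1 - t0) <= - ln u).
{ apply Rle_trans with (ln a - ln u); [|lra]. rewrite Ec. apply Rmult_le_compat_r; lra. }
assert (T2 : th / 2 * - ln u <= exp (- (th / 2) * ln u)).
{ assert (H := exp_ineq1_le (- (th / 2) * ln u)). lra. }
unfold Rpower.
replace (/ (12 * K * a)) with (2 / th) by (unfold th; field; split; lra).
assert (Ee := exp_pos e).
apply Rmult_le_reg_l with (exp e); [easy|].
eapply Rle_trans; [apply T1|].
replace (exp e * (2 / th * exp (- ln a / 2) * exp (- ((1 + 48 * K * a) / 2) * ln u))) with
  (2 / th * (exp e * exp (- ln a / 2) * exp (- ((1 + 48 * K * a) / 2) * ln u))) by ring.
rewrite <- !exp_plus.
replace (e + - ln a / 2 + - ((1 + 48 * K * a) / 2) * ln u) with (- (th / 2) * ln u)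
  by (unfold e, th; field).
apply Rmult_le_reg_l with (th / 2); [lra|].
rewrite <- Rmult_assoc. replace (th / 2 * (2 / th)) with 1 by (field; lra). lra.
Qed.

(** While x goes from ln u / 2 to ln u / 2 + 1, exp x is at most 3 exp e and exp y at most exp e, so
    the speed is at most 8 exp e and this unit of x alone takes the claimed time. The smallness
    hypothesis on u makes both levels lie below the exit level. *)
Lemma transit_time_lower (eps K M a : R) (f fu fv g gu gv : R -> R -> R -> R)
  (u t0 t1 : R) (x y : R -> R) :
  admissible eps K M a f fu fv g gu gv -> 0 < u < a -> ln u / 2 + 1 <= ln a ->
  log_orbit f g a u t0 t1 x y ->
  1 / 8 * Rpower u (- ((1 - 48 * K * a) / 2)) <= t1 - t0.
Proof.
intros HA Hu Hsmall HO.
assert (HS := log_orbit_sandwich eps K M a f fu fv g gu gv u t0 t1 x y HA HO).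
assert (HP := log_orbit_speeds eps K M a f fu fv g gu gv u t0 t1 x y HA HO).
destruct HO as [Ht [Hx0 [Hy0 [Hx1 HO]]]].
destruct HA as [[HK [HM [Ha [He HKa]]]] _].
assert (Lu : ln u < ln a) by (apply ln_increasing; lra).
assert (La : ln a < 0) by (rewrite <- ln_1; apply ln_increasing; lra).
assert (Hth : 0 < K * a) by (apply Rmult_lt_0_compat; lra).
set (th := 24 * K * a) in *. assert (Hth' : 0 < th <= 1) by (unfold th; lra).
assert (Hhit : forall z, ln u < z <= ln a -> exists s, t0 <= s <= t1 /\ x s = z).
{ intros z Hz. destruct (first_zero (fun t => z - x t) t0 t1) as [s [Hs [E _]]]; try lra.
  - intros w Hw. apply (continuous_minus (fun _ => z) x); [apply continuous_const|].
    destruct (HO w Hw) as [D1 _]. exact (is_derive_continuous _ _ _ D1).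
  - exists s. lra. }
destruct (Hhit (ln u / 2) ltac:(lra)) as [s0 [Hs0 E0]].
destruct (Hhit (ln u / 2 + 1) ltac:(lra)) as [s1 [Hs1 E1]].
assert (H01 : s0 <= s1).
{ apply Rnot_lt_le. intros H. destruct (HS s1 s0) as [A _]; lra. }
destruct (mean_value x (fun t => speed f (exp (x t)) (exp (y t)) t) s0 s1) as [c [Hc Ec]];
  [lra|intros w Hw; apply HO; lra|].
destruct (HP c ltac:(lra)) as [_ [_ [[_ Hp] _]]].
destruct (HS s0 c ltac:(lra) ltac:(lra) ltac:(lra)) as [X0 _].
destruct (HS c s1 ltac:(lra) ltac:(lra) ltac:(lra)) as [X1 _].
destruct (HS t0 c ltac:(lra) ltac:(lra) ltac:(lra)) as [_ [_ S]].
rewrite Hx0, Hy0 in S. rewrite E0 in X0. rewrite E1 in X1.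
set (e := (1 - th) * ln u / 2).
assert (Yc : exp (y c) <= exp e).
{ apply exp_le_compat. unfold e.
  assert ((1 - th) * (ln u / 2 - ln u) <= (1 - th) * (x c - ln u))
    by (apply Rmult_le_compat_l; lra). lra. }
assert (Xc : exp (x c) <= 3 * exp e).
{ apply Rle_trans with (exp (1 + e)).
  - apply exp_le_compat. unfold e. nra.
  - rewrite exp_plus. apply Rmult_le_compat_r; [left; apply exp_pos|apply exp_le_3]. }
assert (Hone : 1 <= 8 * exp e * (t1 - t0)).
{ apply Rle_trans with (x s1 - x s0); [lra|]. rewrite Ec.
  assert (Ee := exp_pos e).
  apply Rle_trans with (8 * exp e * (s1 - s0)).
  - apply Rmult_le_compat_r; lra.
  - apply Rmult_le_compat_l; lra. }
apply Rle_trans with (1 / 8 * exp (- e)).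
- apply Rmult_le_compat_l; [lra|]. unfold Rpower. apply exp_le_compat. unfold e, th in *. nra.
- apply Rmult_le_reg_l with (8 * exp e); [assert (Ee := exp_pos e); lra|].
  replace (8 * exp e * (1 / 8 * exp (- e))) with (exp e * exp (- e)) by field.
  rewrite <- exp_plus, Rplus_opp_r, exp_0. easy.
Qed.

(** * Derivatives of height and time of exit *)

Lemma linear_flow_exists (A B A' B' : R -> R) (L t0 x0 y0 : R) :
  0 < L ->
  (forall t, continuous A t /\ continuous B t /\ continuous A' t /\ continuous B' t) ->
  (forall t, Rabs (A t) <= L /\ Rabs (B t) <= L /\ Rabs (A' t) <= L /\ Rabs (B' t) <= L) ->
  exists xi eta : R -> R, xi t0 = x0 /\ eta t0 = y0 /\
    forall t, is_derive xi t (A t * xi t + B t * eta t) /\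
              is_derive eta t (A' t * xi t + B' t * eta t).
Proof.
intros HL HC HB.
assert (Lip : forall a b : R -> R, (forall t, Rabs (a t) <= L /\ Rabs (b t) <= L) ->
  planar_lipschitz L (fun t x y => a t * x + b t * y)).
{ intros a b H t x y x' y'. destruct (H t) as [Ha Hb].
  replace (a t * x + b t * y - (a t * x' + b t * y')) with
    (a t * (x - x') + b t * (y - y')) by ring.
  eapply Rle_trans; [apply Rabs_triang|]. rewrite !Rabs_mult, Rmult_plus_distr_l.
  apply Rplus_le_compat; apply Rmult_le_compat_r; try easy; apply Rabs_pos. }
assert (Cont : forall a b : R -> R, (forall t, continuous a t /\ continuous b t) ->
  curve_continuous (fun t x y => a t * x + b t * y)).
{ intros a b H X Y t HX HY. destruct (H t) as [Ha Hb].
  apply (continuous_plus (fun s => a s * X s) (fun s => b s * Y s)).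
  - now apply (continuous_mult a X).
  - now apply (continuous_mult b Y). }
assert (Bd : forall a b : R -> R, (forall t, Rabs (a t) <= L /\ Rabs (b t) <= L) ->
  forall t, Rabs (a t * x0 + b t * y0) <= L * (Rabs x0 + Rabs y0)).
{ intros a b H t. destruct (H t) as [Ha Hb].
  eapply Rle_trans; [apply Rabs_triang|]. rewrite !Rabs_mult, Rmult_plus_distr_l.
  apply Rplus_le_compat; apply Rmult_le_compat_r; try easy; apply Rabs_pos. }
apply (planar_flow_exists (fun t x y => A t * x + B t * y) (fun t x y => A' t * x + B' t * y)
  L (L * (Rabs x0 + Rabs y0))); try easy.
- apply Lip. intros t. destruct (HB t) as [? [? _]]. easy.
- apply Lip. intros t. destruct (HB t) as [_ [_ ?]]. easy.
- apply Cont. intros t. destruct (HC t) as [? [? _]]. easy.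
- apply Cont. intros t. destruct (HC t) as [_ [_ ?]]. easy.
- apply Bd. intros t. destruct (HB t) as [? [? _]]. easy.
- apply Bd. intros t. destruct (HB t) as [_ [_ ?]]. easy.
Qed.

Lemma continuous_clamp (lo hi s : R) : continuous (clamp lo hi) s.
Proof.
apply continuous_epsP. intros e He. exists e. split; [easy|]. intros y Hy.
eapply Rle_lt_trans; [apply clamp_contraction|easy].
Qed.

Lemma variational_solution_exists (eps K M a : R) (f fu fv g gu gv : R -> R -> R -> R)
  (u t0 t1 x0 y0 : R) (X Y : R -> R) :
  admissible eps K M a f fu fv g gu gv -> log_orbit f g a u t0 t1 X Y ->
  (forall t, continuous X t /\ continuous Y t) ->
  let U t := exp (X t) in let V t := exp (Y t) in
  exists xi eta : R -> R, xi t0 = x0 /\ eta t0 = y0 /\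
    forall t, t0 <= t <= t1 ->
      is_derive xi t (U t * (1 + fu (U t) (V t) t) * xi t
                      + V t * (1 + fv (U t) (V t) t) * eta t) /\
      is_derive eta t (- (U t * (1 + gu (U t) (V t) t)) * xi t
                       + - (V t * (1 + gv (U t) (V t) t)) * eta t).
Proof.
intros HA HO HC U V.
assert (HS := log_orbit_speeds eps K M a f fu fv g gu gv u t0 t1 X Y HA HO).
destruct HO as [Ht _].
destruct HA as [[HK [HM [Ha [He HKa]]]] [[[_ [Cfu Cfv]] Rf] [[_ [Cgu Cgv]] Rg]]].
(* Time is clamped to [t0, t1] to have bounded continuous coefficients on the whole line. *)
set (c := clamp t0 t1).
assert (Hc : forall t, t0 <= c t <= t1) by (intros t; apply clamp_bounds; lra).
assert (Cexp : forall Z : R -> R, (forall t, continuous Z t) -> forall t,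
  continuous (fun s => exp (Z (c s))) t).
{ intros Z HZ t. apply (continuous_comp (fun s => Z (c s)) exp).
  - apply (continuous_comp c Z); [apply continuous_clamp|apply HZ].
  - apply (is_derive_continuous exp _ (exp (Z (c t)))). auto_derive; [easy|ring]. }
assert (CU := Cexp X (fun t => proj1 (HC t))).
assert (CV := Cexp Y (fun t => proj2 (HC t))).
assert (Hpos : forall t, 0 < U (c t) <= a /\ 0 < V (c t) <= a).
{ intros t. destruct (HS (c t) (Hc t)) as [B1 [B2 _]]. easy. }
assert (Ccoef : forall (W : R -> R) (h : R -> R -> R -> R), (forall t, continuous (fun s => W (c s)) t) ->
  box_continuous eps h ->
  forall t, continuous (fun s => W (c s) * (1 + h (U (c s)) (V (c s)) (c s))) t).
{ intros W h HW Hh t. destruct (Hpos t) as [B1 B2].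
  apply (continuous_mult (fun s => W (c s))); [apply HW|].
  apply (continuous_plus (fun _ => 1)); [apply continuous_const|].
  apply (Hh (fun s => U (c s)) (fun s => V (c s)) c); try lra; [apply CU|apply CV|].
  apply continuous_clamp. }
assert (Bcoef : forall w h u v, 0 < w <= a -> 0 < u <= a -> 0 < v <= a ->
  Rabs h <= K * (u + v) -> Rabs (w * (1 + h)) <= 2).
{ intros w h u' v' Hw Hu' Hv' Hh. rewrite Rabs_mult, (Rabs_pos_eq w) by lra.
  assert (K * (u' + v') <= K * (2 * a)) by (apply Rmult_le_compat_l; lra).
  assert (Rabs (1 + h) <= 2) by (eapply Rle_trans; [apply Rabs_triang|rewrite Rabs_R1; lra]).
  assert (Hh0 := Rabs_pos (1 + h)). nra. }
destruct (linear_flow_exists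
  (fun s => U (c s) * (1 + fu (U (c s)) (V (c s)) (c s)))
  (fun s => V (c s) * (1 + fv (U (c s)) (V (c s)) (c s)))
  (fun s => - (U (c s) * (1 + gu (U (c s)) (V (c s)) (c s))))
  (fun s => - (V (c s) * (1 + gv (U (c s)) (V (c s)) (c s)))) 2 t0 x0 y0)
  as [xi [eta [E1 [E2 HD]]]].
- lra.
- intros t. split; [|split; [|split]].
  + now apply (Ccoef U fu).
  + now apply (Ccoef V fv).
  + apply (continuous_opp (fun s => U (c s) * (1 + gu (U (c s)) (V (c s)) (c s)))).
    now apply (Ccoef U gu).
  + apply (continuous_opp (fun s => V (c s) * (1 + gv (U (c s)) (V (c s)) (c s)))).
    now apply (Ccoef V gv).
- intros t. destruct (Hpos t) as [B1 B2].
  destruct (Rf (U (c t)) (V (c t)) (c t)) as [_ [F1 [F2 _]]]; try lra.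
  destruct (Rg (U (c t)) (V (c t)) (c t)) as [_ [G1 [G2 _]]]; try lra.
  rewrite !Rabs_Ropp. split; [|split; [|split]]; now apply (Bcoef _ _ (U (c t)) (V (c t))).
- exists xi, eta. split; [easy|split; [easy|]]. intros t Htt.
  specialize (HD t). unfold c in HD. rewrite clamp_id in HD by easy. exact HD.
Qed.

(** Orbits of the family start and end at times that depend on l. The variation is brought from the
    moving time t0(l) to the fixed time t0(l0) by [derive_slide], carried to the fixed time t1(l0)
    by [derive_transport], and finally projected along the flow onto u = a by [derive_hitting_time]
    and [derive_slide]. *)
Lemma exit_derivatives (eps K M a l0 rho th : R) (f fu fv g gu gv : R -> R -> R -> R)
  (t0 t1 v1 : R -> R) :
  admissible eps K M a f fu fv g gu gv -> 0 < rho < l0 -> l0 + rho <= a ->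
  (forall l, Rabs (l - l0) < rho ->
     exists x y, log_orbit f g a l (t0 l) (t1 l) x y /\ v1 l = exp (y (t1 l))) ->
  is_derive t0 l0 th ->
  exists X Y xi eta : R -> R,
    let U t := exp (X t) in let V t := exp (Y t) in
    let p t := speed f (U t) (V t) t in let q t := speed g (U t) (V t) t in
    log_orbit f g a l0 (t0 l0) (t1 l0) X Y /\
    (forall t, t0 l0 <= t <= t1 l0 ->
      is_derive xi t (U t * (1 + fu (U t) (V t) t) * xi t
                      + V t * (1 + fv (U t) (V t) t) * eta t) /\
      is_derive eta t (- (U t * (1 + gu (U t) (V t) t)) * xi t
                       + - (V t * (1 + gv (U t) (V t) t)) * eta t)) /\
    xi (t0 l0) = / l0 - p (t0 l0) * th /\ eta (t0 l0) = q (t0 l0) * th /\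
    is_derive t1 l0 (- xi (t1 l0) / p (t1 l0)) /\
    is_derive v1 l0 (v1 l0 * (eta (t1 l0) + q (t1 l0) * (xi (t1 l0) / p (t1 l0)))) /\
    v1 l0 = exp (Y (t1 l0)).
Proof.
intros HA Hrho Hla Horb Hth.
(* One window for the whole family, so that all its orbits solve the same clamped equations. *)
set (m := l0 - rho). assert (Hm : 0 < m < a) by (unfold m; lra).
assert (Hlm : forall l, Rabs (l - l0) < rho -> 0 < m <= l /\ l < a).
{ intros l Hl. apply Rabs_lt_between in Hl. unfold m. lra. }
assert (H00 : Rabs (l0 - l0) < rho) by (rewrite Rminus_diag, Rabs_R0; lra).
assert (Hfl : forall l, exists XY : (R -> R) * (R -> R), fst XY (t0 l) = ln l /\
  snd XY (t0 l) = ln a /\ solves (cl_field_x f a m) (cl_field_y g a m) (fst XY) (snd XY)).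
{ intros l. destruct (cl_flow_exists eps K M a m f fu fv g gu gv (t0 l) (ln l) (ln a) HA Hm)
    as [X [Y H]]. now exists (X, Y). }
apply functional_choice in Hfl. destruct Hfl as [XY HXY].
set (xs := fun l => fst (XY l)). set (ys := fun l => snd (XY l)).
assert (Hx0 : forall l, xs l (t0 l) = ln l) by (intros l; apply HXY).
assert (Hy0 : forall l, ys l (t0 l) = ln a) by (intros l; apply HXY).
assert (HS : forall l, solves (cl_field_x f a m) (cl_field_y g a m) (xs l) (ys l))
  by (intros l; apply HXY).
assert (Hagree : forall l x y, Rabs (l - l0) < rho -> log_orbit f g a l (t0 l) (t1 l) x y ->
  forall t, t0 l <= t <= t1 l -> xs l t = x t /\ ys l t = y t).
{ intros l x y Hl HO. destruct (Hlm l Hl) as [Hl1 Hl2].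
  now apply (log_orbit_flow eps K M a m f fu fv g gu gv l (t0 l) (t1 l) x y). }
assert (Hx1 : forall l, Rabs (l - l0) < rho -> xs l (t1 l) = ln a /\ v1 l = exp (ys l (t1 l))).
{ intros l Hl. destruct (Horb l Hl) as [x [y [HO Ev]]].
  destruct (Hagree l x y Hl HO (t1 l)) as [E1 E2]; [destruct HO; lra|].
  rewrite E1, E2. split; [apply HO|easy]. }
set (X := xs l0). set (Y := ys l0).
assert (HO : log_orbit f g a l0 (t0 l0) (t1 l0) X Y).
{ destruct (Horb l0 H00) as [x [y [HO Ev]]].
  assert (E := Hagree l0 x y H00 HO). fold X Y in E.
  assert (HW := log_orbit_window eps K M a m f fu fv g gu gv l0 _ _ x y HA
    (proj1 (Hlm l0 H00)) (proj2 (Hlm l0 H00)) HO).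
  destruct HO as [Ht [_ [_ [Hx Hb]]]].
  split; [easy|]. split; [apply Hx0|]. split; [apply Hy0|]. split; [now apply Hx1|].
  intros t Htt. destruct (E t Htt) as [E1 E2]. destruct (HW t Htt) as [W1 W2].
  destruct (Hb t Htt) as [_ [_ [B1 B2]]].
  destruct (HS l0 t) as [D1 D2]. fold X Y in D1, D2.
  unfold cl_field_x, cl_field_y in D1, D2. rewrite E1, E2 in *.
  rewrite !cl_field_inside in D1, D2 by easy.
  split; [easy|split; [easy|]]. lra. }
assert (HW := log_orbit_window eps K M a m f fu fv g gu gv l0 _ _ X Y HA
    (proj1 (Hlm l0 H00)) (proj2 (Hlm l0 H00)) HO).
assert (HP := log_orbit_speeds eps K M a f fu fv g gu gv l0 _ _ X Y HA HO).
assert (Ht : t0 l0 < t1 l0) by apply HO.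
set (U := fun t => exp (X t)). set (V := fun t => exp (Y t)).
set (p := fun t => speed f (U t) (V t) t). set (q := fun t => speed g (U t) (V t) t).
destruct (variational_solution_exists eps K M a f fu fv g gu gv l0 (t0 l0) (t1 l0)
  (/ l0 - p (t0 l0) * th) (q (t0 l0) * th) X Y HA HO) as [xi [eta [Exi [Eeta Hlin]]]].
{ intros t. destruct (HS l0 t) as [D1 D2].
  split; [exact (is_derive_continuous _ _ _ D1)|exact (is_derive_continuous _ _ _ D2)]. }
destruct (cl_field_regularity eps K M a m f fu fv g gu gv HA Hm) as [HL [L1 [L2 [C1 C2]]]].
set (L := (1 + 2 * eps * (K + M)) * exp (win_hi a)) in *.
assert (Bd := fun t x y => cl_speed_bounds eps K M a m f fu fv g gu gv t x y HA Hm).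
set (c0 := exp (win_lo a m)) in *. assert (Hc0 : 0 < c0) by apply exp_pos.
assert (BP : forall t x y, Rabs (cl_field_x f a m t x y) <= 12 * a).
{ intros t x y. destruct (Bd t x y) as [B1 _]. unfold cl_field_x. rewrite Rabs_pos_eq; lra. }
assert (BQ : forall t x y, Rabs (cl_field_y g a m t x y) <= 12 * a).
{ intros t x y. destruct (Bd t x y) as [_ [B1 _]]. unfold cl_field_y.
  rewrite Rabs_Ropp, Rabs_pos_eq; lra. }
assert (Hpin : forall t, t0 l0 <= t <= t1 l0 -> cl_field_x f a m t (X t) (Y t) = p t /\
  cl_field_y g a m t (X t) (Y t) = - q t).
{ intros t Htt. destruct (HW t Htt) as [W1 W2]. unfold cl_field_x, cl_field_y.
  rewrite !cl_field_inside by easy. easy. }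
assert (Ha : 0 < a < 1) by (destruct HA as [[_ [_ [? _]]] _]; easy).
assert (Dlog : is_derive (fun l => xs l (t0 l)) l0 (/ l0)).
{ apply is_derive_ext with ln; [intros; symmetry; apply Hx0|].
  apply is_derive_Reals, derivable_pt_lim_ln. lra. }
assert (Dcst : is_derive (fun l => ys l (t0 l)) l0 0).
{ apply is_derive_ext with (fun _ => ln a); [intros; symmetry; apply Hy0|].
  exact (is_derive_const (ln a) l0). }
assert (Lim0 : forall F, planar_lipschitz L F -> curve_continuous F ->
  forall e, 0 < e -> exists d, 0 < d /\ forall l t,
    Rabs (l - l0) < d -> Rabs (t - t0 l0) < d ->
    Rabs (F t (xs l t) (ys l t) - F (t0 l0) (X (t0 l0)) (Y (t0 l0))) <= e).
{ intros F LF CF. apply (field_limit (cl_field_x f a m) (cl_field_y g a m) F L (12 * a) l0 rho);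
    try easy; try lra.
  - exact (is_derive_continuous _ _ _ Hth).
  - exact (is_derive_continuous _ _ _ Dlog).
  - exact (is_derive_continuous _ _ _ Dcst). }
(* The known value ln l is taken at time t0(l); sliding back to t0(l0) costs [p (t0 l0) * th]. *)
assert (Dx0 : is_derive (fun l => xs l (t0 l0)) l0 (xi (t0 l0))).
{ rewrite Exi. destruct (Hpin (t0 l0) ltac:(lra)) as [<- _].
  apply is_derive_ext with (fun l => xs l (t0 l) - (xs l (t0 l) - xs l (t0 l0))).
  { intros l. apply Rminus_diag_uniq. ring. }
  apply (is_derive_minus (fun l => xs l (t0 l)) (fun l => xs l (t0 l) - xs l (t0 l0))); [easy|].
  apply (derive_slide xs (fun l t => cl_field_x f a m t (xs l t) (ys l t)) t0 l0 rho);
    [lra| |now apply Lim0|easy].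
  intros l _ t. apply HS. }
assert (Dy0 : is_derive (fun l => ys l (t0 l0)) l0 (eta (t0 l0))).
{ rewrite Eeta. replace (q (t0 l0) * th) with (0 - (- q (t0 l0)) * th) by ring.
  destruct (Hpin (t0 l0) ltac:(lra)) as [_ <-].
  apply is_derive_ext with (fun l => ys l (t0 l) - (ys l (t0 l) - ys l (t0 l0))).
  { intros l. apply Rminus_diag_uniq. ring. }
  apply (is_derive_minus (fun l => ys l (t0 l)) (fun l => ys l (t0 l) - ys l (t0 l0))); [easy|].
  apply (derive_slide ys (fun l t => cl_field_y g a m t (xs l t) (ys l t)) t0 l0 rho);
    [lra| |now apply Lim0|easy].
  intros l _ t. apply HS. }
assert (Heh := exp_win_hi a ltac:(lra)).
destruct HA as [[HK [HM [_ [He HKa]]]] [Rf Rg]].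
(* A single constant must bound both the Lipschitz constant of the field and the coefficients of the
   variational equation, which are at most 2. *)
destruct (derive_transport (cl_field_x f a m) (cl_field_y g a m) (L + 2)
  ((1 + K * (2 * eps)) * (2 * exp (win_hi a)) + M * exp (win_hi a) ^ 2) l0 rho (t0 l0) (t1 l0)
  xs ys (fun t => U t * (1 + fu (U t) (V t) t)) (fun t => V t * (1 + fv (U t) (V t) t))
  (fun t => - (U t * (1 + gu (U t) (V t) t))) (fun t => - (V t * (1 + gv (U t) (V t) t)))
  xi eta) as [Dx1 Dy1]; try easy; try lra.
{ assert (Eh := exp_pos (win_hi a)).
  assert (0 <= K * (2 * eps)) by (apply Rmult_le_pos; lra).
  apply Rplus_le_le_0_compat; apply Rmult_le_pos; try lra. apply pow2_ge_0. }
{ intros t x y x' y'. eapply Rle_trans; [apply L1|].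
  apply Rmult_le_compat_r; [apply Rplus_le_le_0_compat; apply Rabs_pos|lra]. }
{ intros t x y x' y'. eapply Rle_trans; [apply L2|].
  apply Rmult_le_compat_r; [apply Rplus_le_le_0_compat; apply Rabs_pos|lra]. }
{ intros t Htt. destruct (HP t Htt) as [B1 [B2 _]]. fold (U t) in B1. fold (V t) in B2.
  assert (Bcoef : forall w h, 0 < w <= a -> Rabs h <= K * (U t + V t) ->
    Rabs (w * (1 + h)) <= L + 2).
  { intros w h Hw Hh. rewrite Rabs_mult, (Rabs_pos_eq w) by lra.
    assert (K * (U t + V t) <= K * (2 * a)) by (apply Rmult_le_compat_l; lra).
    assert (Rabs (1 + h) <= 2) by (eapply Rle_trans; [apply Rabs_triang|rewrite Rabs_R1; lra]).
    assert (Hh0 := Rabs_pos (1 + h)). nra. }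
  destruct Rf as [_ Rf]. destruct Rg as [_ Rg].
  destruct (Rf (U t) (V t) t) as [_ [F1 [F2 _]]]; try lra.
  destruct (Rg (U t) (V t) t) as [_ [G1 [G2 _]]]; try lra.
  rewrite !Rabs_Ropp. repeat split; now apply Bcoef. }
{ intros t x y Htt. fold X Y. destruct (HW t Htt) as [W1 W2].
  split.
  - apply (clspeed_remainder _ _ eps K M f fu fv); try easy; lra.
  - unfold cl_field_y. fold X Y. unfold U, V.
    assert (R := clspeed_remainder (win_lo a m) (win_hi a) eps K M g gu gv t (X t) (Y t) x y
      ltac:(lra) ltac:(lra) HM Rg W1 W2). cbv zeta in R.
    match type of R with Rabs ?z <= _ => match goal with |- Rabs ?w <= _ =>
      replace w with (- z) by ring end end.
    now rewrite Rabs_Ropp. }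
(* Here [tau] is the constant [t1 l0]: continuity of t1 is not yet known. *)
assert (Lim1 : forall F, planar_lipschitz L F -> curve_continuous F ->
  forall e, 0 < e -> exists d, 0 < d /\ forall l t,
    Rabs (l - l0) < d -> Rabs (t - t1 l0) < d ->
    Rabs (F t (xs l t) (ys l t) - F (t1 l0) (X (t1 l0)) (Y (t1 l0))) <= e).
{ intros F LF CF.
  apply (field_limit (cl_field_x f a m) (cl_field_y g a m) F L (12 * a) l0 rho xs ys
    (fun _ => t1 l0)); try easy; try lra.
  - apply continuous_const.
  - exact (is_derive_continuous _ _ _ Dx1).
  - exact (is_derive_continuous _ _ _ Dy1). }
destruct (Hpin (t1 l0) ltac:(lra)) as [Ep Eq].
assert (Dt1 : is_derive t1 l0 (- xi (t1 l0) / p (t1 l0))).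
{ rewrite <- Ep.
  apply (derive_hitting_time xs (fun l t => cl_field_x f a m t (xs l t) (ys l t)) t1 l0 rho
    _ c0 (ln a)); try easy; try lra.
  - intros l _ t. apply HS.
  - intros l _ t. apply Bd.
  - now apply Lim1.
  - intros l Hl. now apply Hx1. }
exists X, Y, xi, eta. cbv zeta.
split; [easy|split; [easy|split; [easy|split; [easy|split; [easy|]]]]].
fold (U (t1 l0)) (V (t1 l0)) (p (t1 l0)) (q (t1 l0)).
assert (Ev := proj2 (Hx1 l0 H00)). fold Y in Ev. split; [|easy].
assert (Dy : is_derive (fun l => ys l (t1 l)) l0
  (eta (t1 l0) + q (t1 l0) * (xi (t1 l0) / p (t1 l0)))).
{ replace (eta (t1 l0) + q (t1 l0) * (xi (t1 l0) / p (t1 l0))) with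
   (eta (t1 l0) + - q (t1 l0) * (- xi (t1 l0) / p (t1 l0))) by (unfold Rdiv; ring).
  rewrite <- Eq.
  apply is_derive_ext with (fun l => ys l (t1 l0) + (ys l (t1 l) - ys l (t1 l0))).
  { intros l. apply Rminus_diag_uniq. ring. }
  apply (is_derive_plus (fun l => ys l (t1 l0)) (fun l => ys l (t1 l) - ys l (t1 l0))); [easy|].
  apply (derive_slide ys (fun l t => cl_field_y g a m t (xs l t) (ys l t)) t1 l0 rho);
    [lra| |now apply Lim1|easy].
  intros l _ t. apply HS. }
apply is_derive_ext_loc with (fun l => exp (ys l (t1 l))).
{ assert (Hr0 : 0 < rho) by lra. exists (mkposreal rho Hr0). intros l Hl. symmetry.
  apply Hx1. exact Hl. }
rewrite Ev, Rmult_comm.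
apply (is_derive_comp exp (fun l => ys l (t1 l)) l0); [|easy].
fold Y. auto_derive; [easy|ring].
Qed.

(** The speeds at both ends are at most 4. With 32 Th l0 <= 1, the initial data differ from (1 / l0,
    0) by at most 1 / (8 l0), which places them in the cone. Then xi >= 7 / (32 l0) at the exit, and
    division by a speed of at most 4 gives 1 / (20 l0). The ratio is - v1 (p eta / xi + q), where
    |eta / xi| <= 2, hence 2 * 4 + 4 = 12. *)
Lemma exit_derivative_bounds (eps K M a l0 rho th Th : R) (f fu fv g gu gv : R -> R -> R -> R)
  (t0 t1 v1 : R -> R) :
  admissible eps K M a f fu fv g gu gv -> 0 < rho < l0 -> l0 + rho <= a ->
  (forall l, Rabs (l - l0) < rho ->
     exists x y, log_orbit f g a l (t0 l) (t1 l) x y /\ v1 l = exp (y (t1 l))) ->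
  is_derive t0 l0 th -> Rabs th <= Th -> 32 * Th * l0 <= 1 ->
  exists dt dv, is_derive t1 l0 dt /\ is_derive v1 l0 dv /\
    / 20 * / l0 <= Rabs dt /\ Rabs (dv / dt) <= 12 * v1 l0.
Proof.
intros HA Hrho Hla Horb Hth HTh Hsmall.
destruct (exit_derivatives eps K M a l0 rho th f fu fv g gu gv t0 t1 v1 HA Hrho Hla Horb Hth)
  as [X [Y [xi [eta [HO [Hlin [Exi [Eeta [Dt [Dv Ev]]]]]]]]]].
cbv beta in Dt, Dv.
assert (HP := log_orbit_speeds eps K M a f fu fv g gu gv l0 _ _ X Y HA HO).
set (U := fun t => exp (X t)) in *. set (V := fun t => exp (Y t)) in *.
set (p := fun t => speed f (U t) (V t) t) in *. set (q := fun t => speed g (U t) (V t) t) in *.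
change (xi (t0 l0) = / l0 - p (t0 l0) * th) in Exi.
change (eta (t0 l0) = q (t0 l0) * th) in Eeta.
destruct HO as [Ht [HX0 [HY0 [HX1 HO]]]].
destruct HA as [[HK [HM [Ha [He HKa]]]] [[_ Rf] [_ Rg]]].
assert (U0 : U (t0 l0) = l0) by (unfold U; rewrite HX0, exp_ln; lra).
assert (V0 : V (t0 l0) = a) by (unfold V; rewrite HY0, exp_ln; lra).
assert (U1 : U (t1 l0) = a) by (unfold U; rewrite HX1, exp_ln; lra).
destruct (HP (t0 l0) ltac:(lra)) as [_ [_ [Bp0 [Bq0 _]]]].
destruct (HP (t1 l0) ltac:(lra)) as [_ [V1 [Bp1 [Bq1 _]]]].
fold (U (t0 l0)) (V (t0 l0)) in Bp0, Bq0. fold (U (t1 l0)) (V (t1 l0)) in Bp1, Bq1, V1.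
fold (p (t0 l0)) in Bp0. fold (q (t0 l0)) in Bq0.
fold (p (t1 l0)) in Bp1. fold (q (t1 l0)) in Bq1.
rewrite U0, V0 in Bp0, Bq0. rewrite U1 in Bp1, Bq1.
assert (Hil : 0 < / l0) by (apply Rinv_0_lt_compat; lra).
assert (HTl : 32 * Th <= / l0).
{ apply Rmult_le_reg_r with l0; [lra|]. rewrite Rinv_l; lra. }
assert (Hpert : forall w, 0 <= w <= 4 -> Rabs (w * th) <= / l0 / 8).
{ intros w Hw. rewrite Rabs_mult, (Rabs_pos_eq w) by lra.
  assert (A := Rabs_pos th). nra. }
assert (Hp0 := Hpert (p (t0 l0)) ltac:(lra)). assert (Hq0 := Hpert (q (t0 l0)) ltac:(lra)).
apply Rabs_le_between in Hp0. apply Rabs_le_between in Hq0.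
destruct (cone_estimate U V (fun t => f (U t) (V t) t) (fun t => g (U t) (V t) t)
  (fun t => fu (U t) (V t) t) (fun t => fv (U t) (V t) t)
  (fun t => gu (U t) (V t) t) (fun t => gv (U t) (V t) t) xi eta K (2 * a) (t0 l0) (t1 l0))
  as [Hx1 [He1 Hx2]].
- easy.
- lra.
- lra.
- intros s Hs. destruct (HP s Hs) as [B1 [B2 _]]. fold (U s) in B1. fold (V s) in B2.
  destruct (Rf (U s) (V s) s) as [F0 [F1 [F2 _]]]; try lra.
  destruct (Rg (U s) (V s) s) as [G0 [G1 [G2 _]]]; lra.
- intros s Hs. destruct (HO s Hs) as [D1 [D2 _]]. destruct (Hlin s Hs) as [D3 D4].
  split; [|split; [|split; [exact D3|exact D4]]].
  + unfold U at 1. auto_derive; [repeat split; eexists; exact D1|].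
    replace (Derive (fun z : R => X z) s) with (p s) by (symmetry; now apply is_derive_unique).
    unfold p, speed, U. ring.
  + unfold V at 1. auto_derive; [repeat split; eexists; exact D2|].
    replace (Derive (fun z : R => Y z) s) with (- q s) by (symmetry; now apply is_derive_unique).
    unfold q, speed, V. ring.
- lra.
- lra.
- rewrite U0, V0.
  assert (Hbeta : a / (2 * (l0 + a)) - 5 * K * (l0 + a) <= 1 / 2).
  { assert (a / (2 * (l0 + a)) <= 1 / 2).
    { apply Rmult_le_reg_r with (2 * (l0 + a)); [lra|].
      unfold Rdiv at 1. rewrite Rmult_assoc, Rinv_l by lra. lra. }
    assert (0 <= 5 * K * (l0 + a)) by (apply Rmult_le_pos; lra). lra. }
  assert (Hxp : 0 < xi (t0 l0)) by lra.
  apply Rle_lt_trans with (1 / 2 * xi (t0 l0)); [apply Rmult_le_compat_r; lra|lra].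
- rewrite U0, V0, U1 in Hx2.
  set (x1 := xi (t1 l0)) in *. set (e1 := eta (t1 l0)) in *.
  set (p1 := p (t1 l0)) in *. set (q1 := q (t1 l0)) in *.
  assert (Hx3 : / l0 / 5 <= x1).
  { assert (A1 : 7 / 8 * / l0 / (2 * a) <= xi (t0 l0) / (l0 + a)).
    { apply Rmult_le_compat; [lra|left; apply Rinv_0_lt_compat; lra|lra|].
      apply Rinv_le_contravar; lra. }
    assert (A2 : x1 / (a + V (t1 l0)) <= x1 / a).
    { apply Rmult_le_compat_l; [lra|]. apply Rinv_le_contravar; lra. }
    assert (A3 : 7 / 8 * / l0 / (2 * a) / 2 <= x1 / a) by lra.
    apply Rmult_le_compat_r with (r := a) in A3; [|lra].
    replace (x1 / a * a) with x1 in A3 by (field; lra).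
    replace (7 / 8 * / l0 / (2 * a) / 2 * a) with (7 / 32 * / l0) in A3 by (field; lra). lra. }
  exists (- x1 / p1), (v1 l0 * (e1 + q1 * (x1 / p1))).
  split; [exact Dt|split; [exact Dv|]].
  assert (Hp1 : 0 < p1 <= 4) by lra.
  assert (Hip : 0 < / p1) by (apply Rinv_0_lt_compat; lra).
  split.
  + replace (- x1 / p1) with (- (x1 / p1)) by (unfold Rdiv; ring).
    rewrite Rabs_Ropp, Rabs_pos_eq by (apply Rdiv_le_0_compat; lra).
    apply Rmult_le_reg_r with p1; [lra|]. replace (x1 / p1 * p1) with x1 by (field; lra). nra.
  + assert (Hv : 0 < v1 l0) by (rewrite Ev; apply exp_pos).
    replace (v1 l0 * (e1 + q1 * (x1 / p1)) / (- x1 / p1)) with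
      (- (v1 l0 * (e1 / x1 * p1 + q1))) by (field; lra).
    rewrite Rabs_Ropp, Rabs_mult, (Rabs_pos_eq (v1 l0)) by lra.
    rewrite (Rmult_comm 12). apply Rmult_le_compat_l; [lra|].
    assert (He2 : Rabs (e1 / x1) <= 2).
    { unfold Rdiv. rewrite Rabs_mult, Rabs_inv, (Rabs_pos_eq x1) by lra.
      apply Rmult_le_reg_r with x1; [easy|]. rewrite Rmult_assoc, Rinv_l by lra. lra. }
    apply Rabs_le_between in He2. apply Rabs_le. split; nra.
Qed.

(** * From the hypotheses of the theorem to the estimates *)

Lemma C1_Ico_derive (d : R) (h : R -> R) : C1_Ico d h -> 0 < d ->
  exists (dh : R -> R) (B r : R), 0 <= B /\ 0 < r /\
    (forall u, 0 < u < d -> is_derive h u (dh u)) /\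
    (forall u, 0 < u < d -> u < r -> Rabs (dh u) <= B).
Proof.
intros [dh H] Hd.
(* Continuity of the derivative at the end point 0 is what bounds it on some (0, r). *)
destruct (H 0 ltac:(lra)) as [_ Hlim].
destruct (proj1 (filterlim_locally _ _) Hlim (mkposreal 1 Rlt_0_1)) as [r Hr].
exists dh, (Rabs (dh 0) + 1), r.
split; [assert (A := Rabs_pos (dh 0)); lra|]. split; [apply cond_pos|]. split.
- intros u Hu. destruct (H u ltac:(lra)) as [Hq _].
  apply is_derive_epsP. intros eps He.
  destruct (proj1 (filterlim_locally _ _) Hq (mkposreal eps He)) as [e Hee].
  exists (Rmin e (Rmin u (d - u))). split.
  { repeat apply Rmin_glb_lt; try lra. apply cond_pos. }
  intros y Hy.
  apply Rmin_Rgt_l in Hy. destruct Hy as [Hy1 Hy].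
  apply Rmin_Rgt_l in Hy. destruct Hy as [Hy2 Hy3].
  apply Rabs_lt_between in Hy2. apply Rabs_lt_between in Hy3.
  destruct (Req_dec y u) as [->|Hne].
  { replace (h u - h u - dh u * (u - u)) with 0 by ring. rewrite Rabs_R0.
    apply Rmult_le_pos; [lra|apply Rabs_pos]. }
  assert (Q := Hee y Hy1 (conj (conj (ltac:(lra) : 0 <= y) (ltac:(lra) : y < d)) Hne)).
  assert (Q' : Rabs ((h y - h u) / (y - u) - dh u) < eps) by exact Q.
  replace (h y - h u - dh u * (y - u)) with (((h y - h u) / (y - u) - dh u) * (y - u))
    by (field; lra).
  rewrite Rabs_mult. apply Rmult_le_compat_r; [apply Rabs_pos|lra].
- intros u Hu Hur.
  assert (Hb : ball 0 r u).
  { change (Rabs (u - 0) < r). rewrite Rminus_0_r, Rabs_pos_eq; lra. }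
  assert (Q := Hr u Hb (conj (ltac:(lra) : 0 <= u) (ltac:(lra) : u < d))).
  assert (Q' : Rabs (dh u - dh 0) < 1) by exact Q.
  replace (dh u) with ((dh u - dh 0) + dh 0) by ring.
  eapply Rle_trans; [apply Rabs_triang|]. lra.
Qed.

Lemma square_in_locally (P : R * R -> Prop) :
  locally ((0, 0) : R * R) P ->
  exists e, 0 < e /\ forall u v, Rabs u < e -> Rabs v < e -> P (u, v).
Proof.
intros [e He]. exists e. split; [apply cond_pos|]. intros u v Hu Hv.
apply He. split; simpl.
- change (Rabs (u - 0) < e). now rewrite Rminus_0_r.
- change (Rabs (v - 0) < e). now rewrite Rminus_0_r.
Qed.

Lemma smooth_fields_regular (D : R * R -> Prop) (f g : R -> R -> R -> R) :
  open D -> D (0, 0) -> smooth_on (cyl D) (field_u f) -> smooth_on (cyl D) (field_v g) ->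
  periodic_t D f -> periodic_t D g -> O2 f -> O2 g ->
  exists (eps K M : R) (fu fv gu gv : R -> R -> R -> R),
    0 < eps /\ 0 < K /\ 0 <= M /\
    (forall u v, Rabs u < eps -> Rabs v < eps -> D (u, v)) /\
    regular eps K M f fu fv /\ regular eps K M g gu gv.
Proof.
intros Do D0 Sf Sg Pf Pg [Kf Of] [Kg Og].
destruct (square_in_locally _ (filter_and _ _ (Do _ D0) (filter_and _ _ Of Og)))
  as [e [He H]].
cbv beta in H. simpl in H.
assert (HD : forall u v, Rabs u < e -> Rabs v < e -> D (u, v)).
{ intros u v Hu Hv. now apply H. }
assert (Hw : forall k z r, 0 <= r -> Rabs z <= k * r -> Rabs z <= Rmax 0 k * r).
{ intros k z r Hr Hz. eapply Rle_trans; [apply Hz|]. apply Rmult_le_compat_r; [easy|apply Rmax_r]. }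
assert (Hsq : forall u v : R, 0 <= u ^ 2 + v ^ 2).
{ intros u v. apply Rplus_le_le_0_compat; apply pow2_ge_0. }
destruct (regular_of_smooth D f e (Rmax 0 Kf)) as [fu [fv [K1 [M1 [HK1 [HM1 R1]]]]]]; try easy.
{ apply Rmax_l. }
{ intros u v t Hu Hv. apply Hw; [apply Hsq|]. apply (proj1 (proj2 (H u v Hu Hv)) t). }
(* The estimates on g come from those on f with u and v exchanged, hence the reversed order of [gv]
   and [gu]; [regular_swap] restores it. *)
destruct (regular_of_smooth (fun p => D (snd p, fst p)) (fun u v t => g v u t) e (Rmax 0 Kg))
  as [gv [gu [K2 [M2 [HK2 [HM2 R2]]]]]]; try easy.
{ apply Rmax_l. }
{ intros u v Hu Hv. now apply HD. }
{ intros k. replace (field_u (fun u v t => g v u t)) with (fun u v t => - field_v g v u t).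
  - apply (Ck_swap_opp (cyl D)); [easy|apply Sg].
  - do 3 (apply functional_extensionality; intro). unfold field_u, field_v. ring. }
{ intros u v t Hd. now apply Pg. }
{ intros u v t Hu Hv. apply Hw; [apply Hsq|]. rewrite (Rplus_comm (u ^ 2)).
  apply (proj2 (proj2 (H v u Hv Hu)) t). }
apply regular_swap in R2.
exists (e / 6), (K1 + K2 + 1), (M1 + M2), fu, fv, (fun u v t => gu v u t), (fun u v t => gv v u t).
split; [lra|split; [lra|split; [lra|split]]].
- intros u v Hu Hv. apply HD; lra.
- split.
  + apply (regular_weaken (e / 6) _ K1 _ M1); try lra. easy.
  + apply (regular_weaken (e / 6) _ K2 _ M2); try lra. easy.
Qed.

Theorem theorem3p2
  (D : R * R -> Prop) (f g : R -> R -> R -> R)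
  (D_open : open D) (D_origin : D (0, 0))
  (smooth_u : smooth_on (cyl D) (field_u f))
  (smooth_v : smooth_on (cyl D) (field_v g))
  (f_periodic : periodic_t D f) (g_periodic : periodic_t D g)
  (f_O2 : O2 f) (g_O2 : O2 g) :
  exists rho C : R,
    0 < rho < 1 /\ 0 < C /\
    forall a : R, 0 < a < rho ->
    exists delta : R,
      0 < delta < a / 2 /\
      (* admissible size for the section Sigma0 *)
      Rpower delta (1 - C * a) < a /\
      (* Psi_loc is a well defined map from Sigma1 to Sigma0 *)
      (forall p : pt, Sigma1 a delta p ->
         (exists! q : pt, Psi_loc D f g a p q) /\
         (forall q : pt, Psi_loc D f g a p q ->
            Sigma0 a (Rpower delta (1 - C * a)) q)) /\
      (exists Ct1 Ct2 : R,
         0 < Ct1 /\ 0 < Ct2 /\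
         forall u t0 v1 t1 : R,
           Sigma1 a delta (u, a, t0) ->
           Psi_loc D f g a (u, a, t0) (a, v1, t1) ->
           Rpower u (1 + C * a) <= v1 <= Rpower u (1 - C * a) /\
           Ct1 * Rpower u (- ((1 - C * a) / 2)) <= t1 - t0
             <= Ct2 * Rpower u (- ((1 + C * a) / 2))) /\
      (* how small delta must be taken (delta2) depends on the curve *)
      (forall (delta1 : R) (t0 v1 t1 : R -> R),
         0 < delta1 <= delta ->
         C1_Ico delta1 t0 ->
         (forall u, 0 < u < delta1 ->
            Psi_loc D f g a (u, a, t0 u) (a, v1 u, t1 u)) ->
         exists delta2 : R,
           0 < delta2 <= delta1 /\
           exists C1 C2 : R,
             0 < C1 /\ 0 < C2 /\
             forall u, 0 < u < delta2 ->
               ex_derive v1 u /\ ex_derive t1 u /\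
               Rabs (Derive v1 u / Derive t1 u) <= C1 * Rpower u (1 - C * a) /\
               Rabs (Derive t1 u) >= C2 * (1 / Rpower u (9 / 10 - C * a))).
Proof.
destruct (smooth_fields_regular D f g D_open D_origin smooth_u smooth_v f_periodic g_periodic
  f_O2 g_O2) as [eps [K [M [fu [fv [gu [gv [Heps [HK [HM [HD [Rf Rg]]]]]]]]]]]].
(* The last two bounds are those of [admissible]; a < 1 / 2 makes ln a negative and leaves room for
   delta < a / 2. *)
exists (Rmin (1 / 2) (Rmin (eps / 3) (/ (600 * K)))), (48 * K).
assert (HiK : 0 < / (600 * K)) by (apply Rinv_0_lt_compat; lra).
assert (Hrho : Rmin (1 / 2) (Rmin (eps / 3) (/ (600 * K))) <= 1 / 2) by apply Rmin_l.
split; [split; [repeat apply Rmin_glb_lt; lra|lra]|split; [lra|]].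
intros a [Ha Har].
apply Rmin_Rgt_l in Har. destruct Har as [Ha1 Har].
apply Rmin_Rgt_l in Har. destruct Har as [Ha2 Ha3].
assert (HKa : 600 * K * a <= 1).
{ apply Rmult_le_reg_l with (/ (600 * K)); [easy|].
  rewrite <- Rmult_assoc, Rinv_l; lra. }
assert (HKa0 : 0 < K * a) by (apply Rmult_lt_0_compat; lra).
assert (HA : admissible eps K M a f fu fv g gu gv).
{ split; [|easy]. repeat split; lra. }
assert (Hbox : forall u v, 0 < u <= a -> 0 < v <= a -> D (u, v)).
{ intros u v Hu Hv. apply HD; rewrite Rabs_pos_eq; lra. }
assert (La : ln a < 0) by (rewrite <- ln_1; apply ln_increasing; lra).
(* That is, delta = (a / e)^2, so that e sqrt(u) < a for u < delta: the smallness hypothesis of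
   [transit_time_lower]. *)
set (delta := exp (2 * ln a - 2)).
assert (Hd0 : 0 < delta) by apply exp_pos.
assert (Hda : delta < a / 2).
{ unfold delta. replace (2 * ln a - 2) with (ln a + (ln a + Ropp 2)) by ring.
  rewrite !exp_plus, exp_ln by easy.
  assert (E3 := exp_ineq1_le 2). rewrite exp_Ropp.
  assert (/ exp 2 <= / 3) by (apply Rinv_le_contravar; lra).
  assert (a * / exp 2 <= 1 / 2 * / 3) by (apply Rmult_le_compat; try lra; left; apply Rinv_0_lt_compat; lra).
  nra. }
assert (Hsmall : forall u, 0 < u < delta -> ln u / 2 + 1 <= ln a).
{ intros u Hu. assert (ln u < ln delta) by (apply ln_increasing; lra).
  unfold delta in *. rewrite ln_exp in *. lra. }
assert (Horb : forall u t0 q, 0 < u < delta -> Psi_loc D f g a (u, a, t0) q ->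
  exists t1 x y, log_orbit f g a u t0 t1 x y /\ q = (a, exp (y t1), t1)).
{ intros u t0 q Hu. apply (log_orbit_of_Psi D eps K M a f fu fv g gu gv u t0 q HA). lra. }
exists delta. split; [lra|]. split.
(* The exponent 1 - 48 K a is at least 0.92, so delta^(1 - C a) stays below a. *)
{ unfold Rpower, delta. rewrite ln_exp. rewrite <- (exp_ln a) at 3 by easy.
  apply exp_increasing. nra. }
split; [|split].
- intros [[u v] t0] [Hu ->]. split.
  + destruct (log_orbit_exists eps K M a f fu fv g gu gv u t0 HA ltac:(lra)) as [t1 [x [y HO]]].
    exists (a, exp (y t1), t1). split.
    * apply (Psi_of_log_orbit D eps K M a f fu fv g gu gv u t0 t1 x y HA); try easy; lra.
    * intros q Hq. destruct (Horb u t0 q Hu Hq) as [t1' [x' [y' [HO' ->]]]].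
      destruct (log_orbit_unique eps K M a f fu fv g gu gv u t0 t1 t1' x y x' y' HA
        ltac:(lra) HO HO') as [E1 E2].
      rewrite E2, E1. easy.
  + intros q Hq. destruct (Horb u t0 q Hu Hq) as [t1 [x [y [HO ->]]]].
    split; [easy|]. split; [apply exp_pos|].
    destruct (exit_height eps K M a f fu fv g gu gv u t0 t1 x y HA ltac:(lra) HO) as [_ B].
    eapply Rle_lt_trans; [apply B|]. unfold Rpower. apply exp_increasing.
    assert (ln u < ln delta) by (apply ln_increasing; lra). nra.
- exists (1 / 8), (/ (12 * K * a) * exp (- ln a / 2)).
  split; [lra|]. split.
  { apply Rmult_lt_0_compat; [apply Rinv_0_lt_compat; lra|apply exp_pos]. }
  intros u t0 v1 t1 [Hu _] HPsi.
  destruct (Horb u t0 _ Hu HPsi) as [t1' [x [y [HO E]]]].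
  injection E as -> ->.
  split; [|split].
  + apply (exit_height eps K M a f fu fv g gu gv u t0 t1' x y); try easy; lra.
  + apply (transit_time_lower eps K M a f fu fv g gu gv u t0 t1' x y); try easy; try lra.
    now apply Hsmall.
  + apply (transit_time_upper eps K M a f fu fv g gu gv u t0 t1' x y); try easy; lra.
- intros delta1 t0 v1 t1 Hd1 HC1 HPsi.
  destruct (C1_Ico_derive delta1 t0 HC1 ltac:(lra)) as [dh [Th [r [HTh [Hr [Hdh Hbd]]]]]].
  (* Below [r] the slope of the curve is at most [Th]; the last bound gives 32 Th u <= 1, with Th +
     1 to avoid a division by zero. *)
  exists (Rmin delta1 (Rmin r (/ (32 * (Th + 1))))).
  assert (HiT : 0 < / (32 * (Th + 1))) by (apply Rinv_0_lt_compat; lra).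
  split; [split; [repeat apply Rmin_glb_lt; lra|apply Rmin_l]|].
  exists 12, (/ 20). split; [lra|split; [lra|]].
  intros u [Hu0 Hu].
  apply Rmin_Rgt_l in Hu. destruct Hu as [Hu1 Hu].
  apply Rmin_Rgt_l in Hu. destruct Hu as [Hu2 Hu3].
  (* A radius for which all neighbouring parameters remain in (0, delta1). *)
  set (rho := Rmin (u / 2) (delta1 - u)).
  assert (Hrho0 : 0 < rho) by (apply Rmin_glb_lt; lra).
  assert (Hrho1 : rho <= u / 2) by apply Rmin_l.
  assert (Hrho2 : rho <= delta1 - u) by apply Rmin_r.
  assert (Hfam : forall l, 0 < l < delta1 ->
    exists x y, log_orbit f g a l (t0 l) (t1 l) x y /\ v1 l = exp (y (t1 l))).
  { intros l Hl. destruct (Horb l (t0 l) _ ltac:(lra) (HPsi l Hl)) as [t1' [x [y [HO E]]]].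
    injection E as Ev Et. exists x, y. rewrite Et. now split. }
  destruct (exit_derivative_bounds eps K M a u rho (dh u) Th f fu fv g gu gv t0 t1 v1)
    as [dt [dv [Dt [Dv [B1 B2]]]]]; try easy; try lra.
  { intros l Hl. apply Rabs_lt_between in Hl. apply Hfam. lra. }
  { apply Hdh. lra. }
  { apply Hbd; lra. }
  { apply Rle_trans with (32 * (Th + 1) * / (32 * (Th + 1))); [nra|].
    rewrite Rinv_r; lra. }
  rewrite (is_derive_unique _ _ _ Dt), (is_derive_unique _ _ _ Dv).
  split; [now exists dv|split; [now exists dt|split]].
  + eapply Rle_trans; [apply B2|]. apply Rmult_le_compat_l; [lra|].
    destruct (Hfam u ltac:(lra)) as [x [y [HO ->]]].
    apply (exit_height eps K M a f fu fv g gu gv u (t0 u) (t1 u) x y); try easy; lra.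
  (* The bound 1 / (20 u) is stronger than required: u < 1 and 9/10 - C a < 1, so u <= u^(9/10 - C
     a). *)
  + apply Rle_ge. eapply Rle_trans; [|apply B1]. apply Rmult_le_compat_l; [lra|].
    unfold Rdiv. rewrite Rmult_1_l. apply Rinv_le_contravar; [easy|].
    rewrite <- (exp_ln u) at 1 by easy. unfold Rpower. apply exp_le_compat.
    assert (ln u < 0) by (rewrite <- ln_1; apply ln_increasing; lra). nra.
Qed.
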